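(* Let $k,n$ be positive integers with $n>2k$ and let $q>k$. Let $\rho\in C^2(0,\infty)\cap C[0,\infty)$ with $\rho(r)>0$ for $r>0$, put $R(r)=r\rho'(r)/\rho(r)$, and assume: (a) the finite limit $l_0=\lim_{r\to 0}R(r)$ exists, and either [$l_0>R(r)$ for all $r>0$ and $q\ge q^*(k,l_0)$] or [$l_0\ge R(r)$ for all $r>0$ and $q>q^*(k,l_0)$]; (b) there is a constant $L>0$ such that $0<r^{-l_0}\rho(r)<L$ for all $r>0$; (c) $\rho(r)$ has at most polynomial growth as $r\to\infty$. Assume further that $q^*(k,l_0)<q<q_{JL}(k,l_0)$. Then there exists $\tilde\lambda\in(0,\lambda^* )$ such that for each $N\in\mathbb N$ one can find an $\varepsilon>0$ such that for $|\lambda-\tilde\lambda|<\varepsilon$ the problem $(P_\lambda)$ has at least $N$ solutions. In particular, if $\lambda=\tilde\lambda$, problem $(P_\lambda)$ has infinitely many solutions.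
   Context: Notation: $q^*(k,\sigma)=\frac{(n+2)k+\sigma(k+1)}{n-2k}$ for $\sigma\ge 0$, $c_{n,k}=\binom nk/n$, and $$q_{JL}(k,\sigma)=k\,\frac{k(k+1)n-k^2(2-\sigma)+2k+\sigma-2\sqrt{k(2k+\sigma)[(k+1)n-k(2-\sigma)]}}{k(k+1)n-2k^2(k+3)-2k\sigma-2\sqrt{k(2k+\sigma)[(k+1)n-k(2-\sigma)]}}\quad\text{if } n>2k+8+\tfrac{4\sigma}{k},$$ and $q_{JL}(k,\sigma)=\infty$ if $2k<n\le 2k+8+\frac{4\sigma}{k}$. Problem $(P_\lambda)$, $\lambda>0$: $c_{n,k}r^{1-n}\left(r^{n-k}(u')^k\right)'=\lambda\rho(r)(1-u)^q$ for $0<r<1$, $u(r)<0$ for $0\le r<1$, $u(1)=0$. Solutions are classical: $u\in\Phi_0^k$, where with $I=(0,1)$, $\Phi_0^k=\{u\in C^2(I)\cap C^1(\bar I): (r^{n-i}(u')^i)'\ge 0 \text{ in } I,\ i=1,\dots,k,\ u'(0)=u(1)=0\}$. $\lambda^*=\sup\{\lambda>0:\ \text{there exists a solution } u_\lambda\in C^2([0,1)) \text{ of } (P_\lambda)\}$. *)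

(* Defs.v *)
From Stdlib Require Import Reals.
From Coquelicot Require Import Coquelicot.

Open Scope R_scope.

(** Derivative of [f] at [x] relative to the set [D]: the usual derivative at an
    interior point of [D], a one-sided derivative at an endpoint of an interval. *)
Definition is_derive_on (D : R -> Prop) (f : R -> R) (x l : R) : Prop :=
  filterdiff f (within D (locally x)) (fun h => scal h l).

Fixpoint C_on (m : nat) (D : R -> Prop) (f : R -> R) : Prop :=
  match m with
  | O => continuous_on D f
  | S m' => exists g : R -> R,
      (forall x, D x -> is_derive_on D f x (g x)) /\ C_on m' D g
  end.

Definition Ioo01 (r : R) : Prop := 0 < r < 1.
Definition Ico01 (r : R) : Prop := 0 <= r < 1.
Definition Icc01 (r : R) : Prop := 0 <= r <= 1.

Definition c_nk (n k : nat) : R := Binomial.C n k / INR n.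

Definition q_star (n k : nat) (sigma : R) : R :=
  ((INR n + 2) * INR k + sigma * (INR k + 1)) / (INR n - 2 * INR k).

Definition q_JL (n k : nat) (sigma : R) : Rbar :=
  let n' := INR n in
  let k' := INR k in
  let s := sqrt (k' * (2 * k' + sigma) * ((k' + 1) * n' - k' * (2 - sigma))) in
  if Rlt_dec (2 * k' + 8 + 4 * sigma / k') n' then
    Finite (k' *
      ((k' * (k' + 1) * n' - k' ^ 2 * (2 - sigma) + 2 * k' + sigma - 2 * s) /
       (k' * (k' + 1) * n' - 2 * k' ^ 2 * (k' + 3) - 2 * k' * sigma - 2 * s)))
  else p_infty.

(** Functions are total on [R], but only the values on [0,1] are meaningful; the
    first derivative at [0] is the one-sided one. *)
Definition Phi0 (n k : nat) (u : R -> R) : Prop :=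
  C_on 2 Ioo01 u /\
  C_on 1 Icc01 u /\
  (forall i : nat, (1 <= i <= k)%nat -> forall r : R, 0 < r < 1 ->
     0 <= Derive (fun s => s ^ (n - i) * Derive u s ^ i) r) /\
  is_derive_on Icc01 u 0 0 /\
  u 1 = 0.

Definition is_solution (n k : nat) (q : R) (rho : R -> R) (lam : R)
    (u : R -> R) : Prop :=
  Phi0 n k u /\
  (forall r : R, 0 < r < 1 ->
     c_nk n k * / r ^ (n - 1) * Derive (fun s => s ^ (n - k) * Derive u s ^ k) r
     = lam * rho r * Rpower (1 - u r) q) /\
  (forall r : R, 0 <= r < 1 -> u r < 0) /\
  u 1 = 0.

(** The supremum is taken in the extended reals, so that no a priori boundedness
    or nonemptiness is built into the definition. *)
Definition lambda_star (n k : nat) (q : R) (rho : R -> R) : Rbar :=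
  Lub_Rbar (fun lam => 0 < lam /\
    exists u : R -> R, C_on 2 Ico01 u /\ is_solution n k q rho lam u).

(** Solutions count as different only if they differ somewhere on [0,1]. *)
Definition distinct01 (u v : R -> R) : Prop :=
  exists r : R, 0 <= r <= 1 /\ u r <> v r.

Definition at_least_solutions (n k : nat) (q : R) (rho : R -> R) (lam : R)
    (N : nat) : Prop :=
  exists us : nat -> R -> R,
    (forall i : nat, (i < N)%nat -> is_solution n k q rho lam (us i)) /\
    (forall i j : nat, (i < N)%nat -> (j < N)%nat -> i <> j ->
       distinct01 (us i) (us j)).

Definition infinitely_many_solutions (n k : nat) (q : R) (rho : R -> R)
    (lam : R) : Prop :=
  exists us : nat -> R -> R,
    (forall i : nat, is_solution n k q rho lam (us i)) /\
    (forall i j : nat, i <> j -> distinct01 (us i) (us j)).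

Definition log_slope (rho : R -> R) (r : R) : R := r * Derive rho r / rho r.

Definition polynomial_growth (rho : R -> R) : Prop :=
  exists (A : R) (m : nat),
    Rbar_locally p_infty (fun r => Rabs (rho r) <= A * r ^ m).

(* Main.v *)
Require Import Defs.
From Stdlib Require Import Reals Lra Lia Psatz Classical_Prop IndefiniteDescription.
From Coquelicot Require Import Coquelicot.

Open Scope R_scope.

(** Put [m = 2 k + l0], [ys = m / (q - k)] and [xs = n + l0 - q ys]. A solution [u] of
    the boundary value problem corresponds to a regular solution [w] of the radial
    equation with [w 0 = 1] and weight [s^l0 th (kap s)], where [th] is
    [r^(- l0) rho r] divided by its limit at the origin: [u r = 1 - w (r / kap) / w (1 / kap)].
    The scale [kap > 0] is free, and the parameter is an increasing function of
    [ln (w s^ys)] at [s = 1 / kap]. So the theorem says that this quantity oscillates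
    around a limit as [kap] tends to 0. Then every level near the limit is attained at
    many scales, the limit itself at infinitely many, and solutions with the same
    parameter and different scales differ in their value at the origin.

    The regular solution exists globally as the fixed point of a Volterra operator
    ([volterra_contraction]). In [t = ln r], [a = ln (w r^ys)] and [b = a + ln (- r w' / (ys w))]
    the equation becomes the planar system
    [a' = ys (1 - e^(b - a))], [b' = xs / k * (Th e^(q a - k b) - 1)] with a nonincreasing
    weight [Th <= 1] that tends to 1 at [t = -oo]. All scales give orbits of one system,
    translated in time. The equilibrium is the origin. The hypothesis [q > q_star] means
    [xs > ys], so that the linearisation has negative trace, and [q < q_JL] means that its
    eigenvalues are not real ([supercritical_gap], [spiral_condition]). For [xs > ys] an
    energy is dissipated ([energy_derive]). It shows that [w] stays positive ([w_pos]),
    bounds the orbits and, completed to a strict Lyapunov function, makes the orbit of the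
    pure power weight converge to the equilibrium ([energy_reaches_minimum]), around which
    it spirals ([autonomous_thirds_of_turn]).

    For small scales the orbit follows the pure power one until it is close to the
    equilibrium at a very negative time, and is kept there by the energy until the weight
    departs from 1. The rotation would have to be followed through the remaining long
    time, including a final stretch where the weight is arbitrary. This is avoided by
    comparing members of the family with each other: the determinant of two differences
    of orbits, multiplied by the integrating factor of Liouville's formula, changes only
    by cubic terms ([wedge_slope]), while the differences decay ([pair_decay]). Three
    members a third of a turn apart surround the equilibrium at the beginning; the three
    determinants keep their signs, and at time 0 the three end points surround the common
    limit ([wedge_persists], [endpoint_limit], [family_oscillates]). So the amplitude at
    time 0 takes values on both sides of its limit at arbitrarily small scales. *)

(** * Elementary calculus *)

(** For the equations left by [auto_derive], which mention [Derive f x] for every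
    unspecified function [f] of known derivative. *)
Ltac rewrite_derive H :=
  match type of H with
  | is_derive ?f ?x ?l =>
      match goal with
      | |- context [Derive ?g x] => replace (Derive g x) with l by (symmetry; exact (is_derive_unique f x l H))
      end
  end.

Ltac unfold_ball := unfold ball; simpl; unfold AbsRing_ball, abs, minus, plus, opp; simpl.
Ltac unfold_ball_in H :=
  unfold ball in H; simpl in H; unfold AbsRing_ball, abs, minus, plus, opp in H; simpl in H.
Ltac unfold_ball_all :=
  unfold ball in *; simpl in *; unfold AbsRing_ball, abs, minus, plus, opp in *; simpl in *.

Lemma continuous_of_ex_derive (f : R -> R) (x : R) : ex_derive f x -> continuous f x.
Proof. apply (ex_derive_continuous (K := R_AbsRing) (V := R_NormedModule)). Qed.

Lemma RInt_const_from_zero (m x : R) : RInt (fun _ => m) 0 x = m * x.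
Proof. rewrite RInt_const. unfold scal; simpl; unfold mult; simpl. ring. Qed.

Lemma nonincreasing_of_derive (f df : R -> R) (s t : R) :
  s <= t ->
  (forall x, s <= x <= t -> is_derive f x (df x)) ->
  (forall x, s <= x <= t -> df x <= 0) ->
  f t <= f s.
Proof.
  intros Hst Hd Hneg.
  destruct (Req_dec s t) as [<-|Hne]; [lra|].
  destruct (MVT_cor2 f df s t) as [c [Hc Hin]]; [lra| |].
  - intros c Hc. apply is_derive_Reals, Hd; lra.
  - assert (df c <= 0) by (apply Hneg; lra). nra.
Qed.

Lemma nondecreasing_of_derive (f df : R -> R) (s t : R) :
  s <= t ->
  (forall x, s <= x <= t -> is_derive f x (df x)) ->
  (forall x, s <= x <= t -> 0 <= df x) ->
  f s <= f t.
Proof.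
  intros Hst Hd Hpos.
  assert (H : - f t <= - f s); [|lra].
  apply (nonincreasing_of_derive (fun x => - f x) (fun x => - df x)); auto.
  - intros x Hx. apply (is_derive_opp f). now apply Hd.
  - intros x Hx. specialize (Hpos x Hx). lra.
Qed.

(** Gronwall's inequality, by monotonicity of [f x * exp (- c * x)]. *)
Lemma exp_growth_upper (f : R -> R) (c s t : R) :
  s <= t ->
  (forall x, s <= x <= t -> exists l, is_derive f x l /\ l <= c * f x) ->
  f t <= f s * exp (c * (t - s)).
Proof.
  intros Hst Hd.
  assert (H : f t * exp (- c * t) <= f s * exp (- c * s)).
  { apply (nonincreasing_of_derive (fun x => f x * exp (- c * x))
      (fun x => (Derive f x - c * f x) * exp (- c * x))); auto;
      intros x Hx; destruct (Hd x Hx) as [l [Hl Hle]]; rewrite_derive Hl.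
    - auto_derive; [eexists; exact Hl|]. rewrite_derive Hl. ring.
    - pose proof (exp_pos (- c * x)). nra. }
  apply (Rmult_le_compat_r (exp (c * t))) in H; [|left; apply exp_pos].
  rewrite !Rmult_assoc, <- !exp_plus in H.
  replace (- c * t + c * t) with 0 in H by ring.
  rewrite exp_0 in H.
  replace (c * (t - s)) with (- c * s + c * t) by ring. lra.
Qed.

Lemma exp_growth_lower (f : R -> R) (c s t : R) :
  s <= t ->
  (forall x, s <= x <= t -> exists l, is_derive f x l /\ c * f x <= l) ->
  f s * exp (c * (t - s)) <= f t.
Proof.
  intros Hst Hd.
  assert (H : - f t <= - f s * exp (c * (t - s))); [|lra].
  apply (exp_growth_upper (fun x => - f x)); [exact Hst|].
  intros x Hx. destruct (Hd x Hx) as [l [Hl Hle]].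
  exists (- l). split; [now apply (is_derive_opp f)|lra].
Qed.

Lemma exp_le_compat (x y : R) : x <= y -> exp x <= exp y.
Proof. intros [H| ->]; [left; now apply exp_increasing | lra]. Qed.

Lemma exp_tangent (u v : R) : exp v * (u - v) <= exp u - exp v.
Proof.
  replace (exp u) with (exp v * exp (u - v)) by (rewrite <- exp_plus; f_equal; ring).
  pose proof (exp_pos v). pose proof (exp_ineq1_le (u - v)). nra.
Qed.

(** The bound [M] is on the two values and not on the arguments, because along the
    orbits below only the exponentials are controlled. *)
Lemma exp_diff_bound (u v M : R) :
  exp u <= M -> exp v <= M -> Rabs (exp u - exp v) <= M * Rabs (u - v).
Proof.
  intros Hu Hv.
  pose proof (exp_tangent u v). pose proof (exp_tangent v u).
  pose proof (exp_pos u). pose proof (exp_pos v).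
  unfold Rabs; destruct (Rcase_abs (exp u - exp v)), (Rcase_abs (u - v)); nra.
Qed.

Lemma exp_taylor_bound (u v M : R) :
  exp u <= M -> exp v <= M ->
  Rabs (exp u - exp v - exp v * (u - v)) <= M * (u - v) ^ 2.
Proof.
  intros Hu Hv.
  pose proof (exp_tangent u v) as H1. pose proof (exp_tangent v u) as H2.
  pose proof (exp_diff_bound u v M Hu Hv) as H3.
  rewrite Rabs_pos_eq; [|lra].
  (* exp u - exp v <= exp u (u - v), so the remainder is at most (exp u - exp v)(u - v) *)
  apply Rle_trans with ((exp u - exp v) * (u - v)); [nra|].
  apply Rle_trans with (Rabs ((exp u - exp v) * (u - v))); [apply Rle_abs|].
  rewrite Rabs_mult. rewrite <- (pow2_abs (u - v)).
  pose proof (Rabs_pos (u - v)). nra.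
Qed.

Lemma exp_sub_one_bound (u r : R) :
  Rabs u <= r -> Rabs (exp u - 1) <= exp r - 1.
Proof.
  intros Hu. assert (Hr : - r <= u <= r) by (apply Rabs_le_between; exact Hu).
  pose proof (exp_le_compat u r (proj2 Hr)) as H1.
  pose proof (exp_le_compat (- r) u (proj1 Hr)) as H2.
  assert (H3 : exp (- r) * exp r = 1) by (rewrite <- exp_plus, Rplus_opp_l; apply exp_0).
  pose proof (exp_pos r). pose proof (exp_pos (- r)).
  apply Rabs_le. split; nra.
Qed.

Lemma exp_diff_near_zero (u v r : R) :
  Rabs u <= r -> Rabs v <= r ->
  Rabs (exp u - exp v - (u - v)) <= (exp r - 1) * Rabs (u - v).
Proof.
  intros Hu Hv.
  assert (Hu' : - r <= u <= r) by (apply Rabs_le_between; exact Hu).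
  assert (Hv' : - r <= v <= r) by (apply Rabs_le_between; exact Hv).
  pose proof (exp_tangent u v) as H1. pose proof (exp_tangent v u) as H2.
  pose proof (exp_sub_one_bound u r Hu) as H3. pose proof (exp_sub_one_bound v r Hv) as H4.
  apply Rabs_le_between in H3. apply Rabs_le_between in H4.
  unfold Rabs at 2; destruct (Rcase_abs (u - v)); apply Rabs_le; split; nra.
Qed.

Lemma lipschitz_of_derive (f df : R -> R) (M s t : R) :
  s <= t ->
  (forall x, s <= x <= t -> is_derive f x (df x)) ->
  (forall x, s <= x <= t -> Rabs (df x) <= M) ->
  Rabs (f t - f s) <= M * (t - s).
Proof.
  intros Hst Hd Hb. destruct (Req_dec s t) as [<-|Hne].
  - rewrite Rminus_diag. rewrite Rabs_R0. lra.
  - destruct (MVT_cor2 f df s t) as [c [Hc Hin]]; [lra| |].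
    + intros c Hc. apply is_derive_Reals, Hd; lra.
    + rewrite Hc, Rabs_mult, (Rabs_pos_eq (t - s)) by lra.
      apply Rmult_le_compat_r; [lra|]. apply Hb; lra.
Qed.

Lemma exp_minus_one_lipschitz (c B x : R) :
  0 <= c -> 0 <= B -> Rabs x <= B -> Rabs (exp (c * x) - 1) <= c * exp (c * B) * Rabs x.
Proof.
  intros Hc HB Hx. apply Rabs_le_between in Hx.
  replace (exp (c * x) - 1) with (exp (c * x) - exp 0) by (rewrite exp_0; reflexivity).
  replace (c * exp (c * B) * Rabs x) with (exp (c * B) * Rabs (c * x - 0)).
  - apply exp_diff_bound; apply exp_le_compat; nra.
  - rewrite Rminus_0_r, Rabs_mult, (Rabs_pos_eq c Hc). ring.
Qed.

Lemma exp_minus_one_expansive (B x : R) :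
  Rabs x <= B -> exp (- B) ^ 2 * x ^ 2 <= (exp x - 1) ^ 2.
Proof.
  intros Hx. apply Rabs_le_between in Hx.
  pose proof (exp_tangent x 0) as H1. pose proof (exp_tangent 0 x) as H2.
  rewrite exp_0 in H1, H2.
  pose proof (exp_le_compat (- B) x (proj1 Hx)). pose proof (exp_pos (- B)).
  assert (exp (- B) <= 1) by (rewrite <- exp_0; apply exp_le_compat; lra).
  rewrite <- Rpow_mult_distr.
  destruct (Rle_dec 0 x).
  - apply pow_incr. nra.
  - replace ((exp x - 1) ^ 2) with ((1 - exp x) ^ 2) by ring.
    replace ((exp (- B) * x) ^ 2) with ((exp (- B) * - x) ^ 2) by ring.
    apply pow_incr. nra.
Qed.

Lemma exp_comonotone_scaled (K d : R) :
  1 <= K -> (exp d - 1) ^ 2 <= (exp d - 1) * (exp (K * d) - 1).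
Proof.
  intros HK. destruct (Rle_dec 0 d) as [Hd|Hd].
  - assert (1 <= exp d) by (rewrite <- exp_0; apply exp_le_compat; lra).
    assert (exp d <= exp (K * d)) by (apply exp_le_compat; nra). nra.
  - assert (exp d <= 1) by (rewrite <- exp_0; apply exp_le_compat; lra).
    assert (exp (K * d) <= exp d) by (apply exp_le_compat; nra). nra.
Qed.

Lemma exp_minus_one_le (x : R) : exp x - 1 <= x * exp x.
Proof. pose proof (exp_tangent 0 x) as H. rewrite exp_0 in H. lra. Qed.

Lemma exp_nat_mul_le (p x eps : R) :
  1 <= p -> 0 < eps <= 1 -> exp x <= eps -> exp (p * x) <= eps.
Proof.
  intros Hp He Hx.
  assert (Hx0 : x <= 0).
  { apply Rnot_lt_le; intro Hl. apply exp_increasing in Hl. rewrite exp_0 in Hl. lra. }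
  apply Rle_trans with (exp x); [apply exp_le_compat; nra | exact Hx].
Qed.

(** * Powers and averages *)

(** Unlike [Rpower], continuous on the whole line for nonnegative exponents. *)
Definition pw (x s : R) : R :=
  if Rlt_dec 0 x then Rpower x s else if Req_EM_T s 0 then 1 else 0.

Lemma pw_pos_eq (x s : R) : 0 < x -> pw x s = Rpower x s.
Proof. intros H. unfold pw. destruct (Rlt_dec 0 x); [reflexivity|lra]. Qed.

Lemma pw_nonpos (x s : R) : x <= 0 -> 0 < s -> pw x s = 0.
Proof.
  intros H Hs. unfold pw. destruct (Rlt_dec 0 x); [lra|].
  destruct (Req_EM_T s 0); [lra|reflexivity].
Qed.

Lemma pw_exp0 (x : R) : pw x 0 = 1.
Proof.
  unfold pw. destruct (Rlt_dec 0 x); [apply Rpower_O; assumption|].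
  destruct (Req_EM_T 0 0); lra.
Qed.

Lemma Rpower_pos (x s : R) : 0 < Rpower x s.
Proof. apply exp_pos. Qed.

Lemma pw_gt0 (x s : R) : 0 < x -> 0 < pw x s.
Proof. intros H. rewrite pw_pos_eq by assumption. apply Rpower_pos. Qed.

Lemma pw_ge0 (x s : R) : 0 <= pw x s.
Proof.
  unfold pw. destruct (Rlt_dec 0 x); [left; apply Rpower_pos|].
  destruct (Req_EM_T s 0); lra.
Qed.

Lemma pw_one (s : R) : pw 1 s = 1.
Proof. rewrite pw_pos_eq by lra. unfold Rpower. rewrite ln_1, Rmult_0_r. apply exp_0. Qed.

Lemma pw_mono (x y s : R) : 0 <= s -> x <= y -> pw x s <= pw y s.
Proof.
  intros Hs Hxy. destruct (Req_dec s 0) as [->|Hs0]; [rewrite !pw_exp0; lra|].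
  destruct (Rle_dec x 0) as [Hx|Hx].
  - rewrite (pw_nonpos x) by lra. apply pw_ge0.
  - rewrite !pw_pos_eq by lra. apply Rle_Rpower_l; lra.
Qed.

Lemma pw_le1 (x s : R) : 0 <= s -> x <= 1 -> pw x s <= 1.
Proof. intros Hs Hx. rewrite <- (pw_one s). now apply pw_mono. Qed.

Lemma Rpower_derive (x s : R) : 0 < x -> is_derive (fun x => Rpower x s) x (s * Rpower x (s - 1)).
Proof. intros H. apply is_derive_Reals. now apply derivable_pt_lim_power. Qed.

Lemma pw_locally (x s : R) : 0 < x -> locally x (fun y => Rpower y s = pw y s).
Proof.
  intros H. exists (mkposreal x H). intros y Hy. symmetry. apply pw_pos_eq.
  unfold_ball_in Hy.
  apply Rabs_lt_between in Hy. lra.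
Qed.

Lemma pw_derive (x s : R) : 0 < x -> is_derive (fun x => pw x s) x (s * pw x (s - 1)).
Proof.
  intros H. rewrite (pw_pos_eq x (s - 1)) by assumption.
  apply (is_derive_ext_loc (fun x => Rpower x s)); [now apply pw_locally|].
  now apply Rpower_derive.
Qed.

Lemma pw_continuous (s : R) : 0 <= s -> forall x, continuous (fun x => pw x s) x.
Proof.
  intros Hs x. destruct (Req_dec s 0) as [->|Hs0].
  { apply (continuous_ext (fun _ => 1)); [intros y; symmetry; apply pw_exp0|apply continuous_const]. }
  destruct (Rlt_dec 0 x) as [Hx|Hx].
  { apply (continuous_of_ex_derive (fun x => pw x s)).
    eexists. now apply pw_derive. }
  apply filterlim_locally. intros eps. rewrite (pw_nonpos x) by lra.
  set (d := Rpower eps (/ s)).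
  assert (Hd : 0 < d) by apply Rpower_pos.
  exists (mkposreal d Hd). intros y Hy.
  unfold_ball_all.
  apply Rabs_lt_between in Hy. rewrite Ropp_0, Rplus_0_r, Rabs_pos_eq by apply pw_ge0.
  destruct (Rlt_dec 0 y) as [Hy0|Hy0].
  - rewrite pw_pos_eq by assumption.
    replace (pos eps) with (Rpower d s).
    + apply Rlt_Rpower_l; lra.
    + unfold d. rewrite Rpower_mult, Rinv_l by lra. apply Rpower_1, cond_pos.
  - rewrite pw_nonpos by lra. apply cond_pos.
Qed.

Lemma pw_inverse (x s : R) : 0 < s -> 0 <= x -> pw (pw x s) (/ s) = x.
Proof.
  intros Hs [Hx|<-].
  - rewrite (pw_pos_eq x) by assumption. rewrite pw_pos_eq by apply Rpower_pos.
    rewrite Rpower_mult, Rinv_r by lra. now apply Rpower_1.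
  - rewrite (pw_nonpos 0 s) by lra. apply pw_nonpos; [lra|now apply Rinv_0_lt_compat].
Qed.

Lemma Rpower_lipschitz (s c x y : R) :
  0 < x -> x <= y -> (forall z, x <= z <= y -> s * Rpower z (s - 1) <= c) -> 0 <= s ->
  Rabs (Rpower y s - Rpower x s) <= c * (y - x).
Proof.
  intros Hx Hxy Hc Hs.
  apply (lipschitz_of_derive (fun z => Rpower z s) (fun z => s * Rpower z (s - 1))); [exact Hxy| |].
  - intros z Hz. apply Rpower_derive. lra.
  - intros z Hz. rewrite Rabs_pos_eq; [now apply Hc|].
    apply Rmult_le_pos; [exact Hs|left; apply Rpower_pos].
Qed.

Lemma pw_lipschitz_below1 (s x y : R) :
  1 <= s -> x <= 1 -> y <= 1 -> Rabs (pw x s - pw y s) <= s * Rabs (x - y).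
Proof.
  intros Hs.
  assert (Hw : forall x y, x <= y -> y <= 1 -> Rabs (pw y s - pw x s) <= s * (y - x)).
  { clear x y. intros x y Hxy Hy.
    destruct (Rle_dec y 0) as [Hy0|Hy0].
    - rewrite !pw_nonpos by lra. rewrite Rminus_diag, Rabs_R0. nra.
    - destruct (Rle_dec x 0) as [Hx0|Hx0].
      + rewrite (pw_nonpos x), Rminus_0_r by lra. rewrite Rabs_pos_eq by apply pw_ge0.
        rewrite pw_pos_eq by lra.
        apply Rle_trans with (Rpower y 1).
        * unfold Rpower. apply exp_le_compat.
          assert (ln y <= 0) by (rewrite <- ln_1; apply ln_le; lra). nra.
        * rewrite Rpower_1 by lra. nra.
      + rewrite !pw_pos_eq by lra. apply Rpower_lipschitz; try lra.
        intros z Hz.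
        assert (Rpower z (s - 1) <= 1) by (rewrite <- (pw_pos_eq z) by lra; apply pw_le1; lra). nra. }
  intros Hx Hy. destruct (Rle_dec x y) as [H|H].
  - rewrite Rabs_minus_sym, (Rabs_minus_sym x), (Rabs_pos_eq (y - x)) by lra. now apply Hw.
  - rewrite (Rabs_pos_eq (x - y)) by lra. apply Hw; lra.
Qed.

Lemma pw_lipschitz_above (s c x y : R) :
  0 <= s <= 1 -> 0 < c -> c <= x -> c <= y ->
  Rabs (pw x s - pw y s) <= Rpower c (s - 1) * Rabs (x - y).
Proof.
  intros Hs Hc.
  assert (Hw : forall x y, c <= x -> x <= y -> Rabs (pw y s - pw x s) <= Rpower c (s - 1) * (y - x)).
  { clear x y. intros x y Hx Hxy. rewrite !pw_pos_eq by lra.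
    apply Rpower_lipschitz; try lra. intros z Hz.
    assert (Hz1 : Rpower z (s - 1) <= Rpower c (s - 1)).
    { unfold Rpower. apply exp_le_compat.
      assert (ln c <= ln z) by (apply ln_le; lra). nra. }
    pose proof (Rpower_pos z (s - 1)). nra. }
  intros Hx Hy. destruct (Rle_dec x y) as [H|H].
  - rewrite Rabs_minus_sym, (Rabs_minus_sym x), (Rabs_pos_eq (y - x)) by lra. now apply Hw.
  - rewrite (Rabs_pos_eq (x - y)) by lra. apply Hw; lra.
Qed.

(** The value for [x <= 0] makes the average continuous on the whole line. *)
Definition avg (h : R -> R) (x : R) : R :=
  if Rlt_dec 0 x then RInt h 0 x / x else h 0.

Lemma ex_RInt_of_continuous (h : R -> R) (x y : R) : (forall z, continuous h z) -> ex_RInt h x y.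
Proof. intros H. apply (ex_RInt_continuous (V := R_CompleteNormedModule)). intros z _. apply H. Qed.

Lemma avg_ge (h : R -> R) (x m : R) :
  (forall z, continuous h z) -> 0 <= x -> (forall z, 0 <= z <= x -> m <= h z) -> m <= avg h x.
Proof.
  intros Hc Hx Hm. unfold avg. destruct (Rlt_dec 0 x) as [H|H]; [|apply Hm; lra].
  apply Rmult_le_reg_r with x; [exact H|]. unfold Rdiv. rewrite Rmult_assoc, Rinv_l, Rmult_1_r by lra.
  replace (m * x) with (RInt (fun _ => m) 0 x)
    by apply RInt_const_from_zero.
  apply RInt_le; [lra|apply ex_RInt_const|now apply ex_RInt_of_continuous|].
  intros z Hz. apply Hm; lra.
Qed.

Lemma avg_le (h : R -> R) (x m : R) :
  (forall z, continuous h z) -> 0 <= x -> (forall z, 0 <= z <= x -> h z <= m) -> avg h x <= m.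
Proof.
  intros Hc Hx Hm. unfold avg. destruct (Rlt_dec 0 x) as [H|H]; [|apply Hm; lra].
  apply Rmult_le_reg_r with x; [exact H|]. unfold Rdiv. rewrite Rmult_assoc, Rinv_l, Rmult_1_r by lra.
  replace (m * x) with (RInt (fun _ => m) 0 x)
    by apply RInt_const_from_zero.
  apply RInt_le; [lra|now apply ex_RInt_of_continuous|apply ex_RInt_const|].
  intros z Hz. apply Hm; lra.
Qed.

Lemma avg_diff (h1 h2 : R -> R) (x d : R) :
  (forall z, continuous h1 z) -> (forall z, continuous h2 z) -> 0 <= x ->
  (forall z, 0 <= z <= x -> Rabs (h1 z - h2 z) <= d) -> Rabs (avg h1 x - avg h2 x) <= d.
Proof.
  intros Hc1 Hc2 Hx Hd. unfold avg. destruct (Rlt_dec 0 x) as [H|H]; [|apply Hd; lra].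
  replace (RInt h1 0 x / x - RInt h2 0 x / x) with ((RInt h1 0 x - RInt h2 0 x) / x) by (field; lra).
  unfold Rdiv. rewrite Rabs_mult, (Rabs_pos_eq (/ x)) by (left; now apply Rinv_0_lt_compat).
  apply Rmult_le_reg_r with x; [exact H|]. rewrite Rmult_assoc, Rinv_l, Rmult_1_r by lra.
  assert (Heq : RInt h1 0 x - RInt h2 0 x = RInt (fun z => h1 z - h2 z) 0 x).
  { symmetry. apply (RInt_minus (V := R_CompleteNormedModule)); now apply ex_RInt_of_continuous. }
  rewrite Heq, (Rmult_comm d).
  replace (x * d) with ((x - 0) * d) by ring.
  apply abs_RInt_le_const; [lra| |intros z Hz; apply Hd; lra].
  apply ex_RInt_of_continuous. intros z. now apply (continuous_minus (V := R_NormedModule) h1 h2).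
Qed.

Lemma RInt_derive (h : R -> R) (x0 x : R) :
  (forall z, continuous h z) -> is_derive (fun x => RInt h x0 x) x (h x).
Proof.
  intros Hc. apply (is_derive_RInt (V := R_NormedModule) h _ x0); [|apply Hc].
  apply filter_forall. intros y. apply (RInt_correct (V := R_CompleteNormedModule)).
  now apply ex_RInt_of_continuous.
Qed.

Lemma avg_derive (h : R -> R) (x : R) :
  (forall z, continuous h z) -> 0 < x -> is_derive (avg h) x ((h x - avg h x) / x).
Proof.
  intros Hc Hx.
  apply (is_derive_ext_loc (fun x => RInt h 0 x / x)).
  - exists (mkposreal x Hx). intros y Hy.
    unfold_ball_in Hy.
    apply Rabs_lt_between in Hy. unfold avg. destruct (Rlt_dec 0 y); [reflexivity|lra].
  - pose proof (RInt_derive h 0 x Hc) as HI.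
    set (F := fun x => RInt h 0 x) in *.
    assert (Hder : is_derive (fun x => F x / x) x ((h x * x - F x) / x ^ 2)).
    { change (is_derive F x (h x)) in HI. clearbody F. auto_derive.
      - split; [eexists; exact HI|split; [lra|trivial]].
      - rewrite_derive HI. field. lra. }
    evar_last; [exact Hder|]. unfold avg, F. destruct (Rlt_dec 0 x); [|lra]. field. lra.
Qed.

Lemma avg_continuous (h : R -> R) : (forall z, continuous h z) -> forall x, continuous (avg h) x.
Proof.
  intros Hc x. destruct (Rlt_dec 0 x) as [Hx|Hx].
  { apply (continuous_of_ex_derive (avg h)).
    eexists. now apply avg_derive. }
  apply filterlim_locally. intros eps.
  assert (Hx0 : avg h x = h 0) by (unfold avg; destruct (Rlt_dec 0 x); [lra|reflexivity]).
  rewrite Hx0.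
  pose proof (proj1 (filterlim_locally h (h 0)) (Hc 0) (mkposreal (eps / 2) ltac:(destruct eps; simpl; lra))) as [d Hd].
  exists d. intros y Hy.
  unfold_ball_all.
  apply Rabs_lt_between in Hy.
  destruct (Rle_dec y 0) as [Hy0|Hy0].
  - unfold avg. destruct (Rlt_dec 0 y); [lra|]. rewrite Rplus_opp_r, Rabs_R0. apply cond_pos.
  - apply Rle_lt_trans with (eps / 2); [|destruct eps; simpl; lra].
    assert (Hz : forall z, 0 <= z <= y -> - (eps / 2) <= h z + - h 0 <= eps / 2).
    { intros z Hz. specialize (Hd z). rewrite Ropp_0, Rplus_0_r in Hd.
      assert (Hlt : Rabs z < d) by (apply Rabs_lt_between; lra).
      specialize (Hd Hlt). apply Rabs_lt_between in Hd. lra. }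
    apply Rabs_le. split.
    + assert (h 0 - eps / 2 <= avg h y); [|lra].
      apply avg_ge; [exact Hc|lra|]. intros z Hzz. specialize (Hz z Hzz). lra.
    + assert (avg h y <= h 0 + eps / 2); [|lra].
      apply avg_le; [exact Hc|lra|]. intros z Hzz. specialize (Hz z Hzz). lra.
Qed.

Lemma avg_ext (h1 h2 : R -> R) (x : R) :
  (forall z, 0 <= z -> h1 z = h2 z) -> avg h1 x = avg h2 x.
Proof.
  intros H. unfold avg. destruct (Rlt_dec 0 x) as [Hx|Hx]; [|apply H; lra].
  f_equal. apply RInt_ext. intros z Hz. apply H. rewrite Rmin_left in Hz by lra. lra.
Qed.

(** * The integral equation for regular solutions *)

(** The tail of the geometric series bounds the remaining steps. *)
Lemma geometric_limit (x : nat -> R) (c : R) :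
  (forall j, Rabs (x (S j) - x j) <= c / 2 ^ j) ->
  forall j, Rabs (x j - real (Lim_seq x)) <= 2 * c / 2 ^ j.
Proof.
  intros Hx.
  assert (H2 : forall j, 0 < 2 ^ j) by (intros j; apply pow_lt; lra).
  assert (Hc : 0 <= c).
  { specialize (Hx 0%nat). simpl in Hx. pose proof (Rabs_pos (x 1%nat - x 0%nat)). lra. }
  assert (Htail : forall j m, Rabs (x (m + j)%nat - x j) <= 2 * c / 2 ^ j - 2 * c / 2 ^ (m + j)).
  { intros j m. induction m as [|m IH].
    - simpl. rewrite Rminus_diag, Rabs_R0. lra.
    - replace (x (S m + j)%nat - x j) with ((x (S (m + j)) - x (m + j)%nat) + (x (m + j)%nat - x j))
        by (simpl; ring).
      eapply Rle_trans; [apply Rabs_triang|].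
      specialize (Hx (m + j)%nat). pose proof (H2 (m + j)%nat).
      assert (E : 2 * c / 2 ^ (S m + j) = c / 2 ^ (m + j)) by (simpl; field; lra).
      rewrite E. assert (2 * c / 2 ^ (m + j) = c / 2 ^ (m + j) + c / 2 ^ (m + j)) by (field; lra). lra. }
  assert (Hle : forall j m, Rabs (x (m + j)%nat - x j) <= 2 * c / 2 ^ j).
  { intros j m. eapply Rle_trans; [apply Htail|].
    assert (0 <= 2 * c / 2 ^ (m + j)) by (apply Rmult_le_pos; [lra|left; apply Rinv_0_lt_compat, H2]). lra. }
  assert (Hcv : ex_finite_lim_seq x).
  { apply ex_lim_seq_cauchy_corr. intros eps.
    destruct (pow_lt_1_zero (/ 2) ltac:(rewrite Rabs_pos_eq; lra) (eps / (4 * (c + 1)))) as [N HN].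
    { apply Rdiv_lt_0_compat; [apply cond_pos|lra]. }
    exists N.
    assert (Hsmall : 2 * c / 2 ^ N < eps / 2).
    { specialize (HN N (le_n N)). rewrite Rabs_pos_eq in HN by (left; apply pow_lt; lra).
      rewrite pow_inv in HN. unfold Rdiv.
      assert (0 < / 2 ^ N) by (apply Rinv_0_lt_compat, H2).
      apply Rle_lt_trans with (2 * (c + 1) * / 2 ^ N); [nra|].
      apply Rlt_le_trans with (2 * (c + 1) * (eps / (4 * (c + 1)))); [apply Rmult_lt_compat_l; lra|].
      right. field. lra. }
    intros n m Hn Hm.
    assert (Hn' : Rabs (x n - x N) <= 2 * c / 2 ^ N).
    { replace n with ((n - N) + N)%nat by lia. apply Hle. }
    assert (Hm' : Rabs (x m - x N) <= 2 * c / 2 ^ N).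
    { replace m with ((m - N) + N)%nat by lia. apply Hle. }
    apply Rabs_le_between in Hn'. apply Rabs_le_between in Hm'.
    apply Rabs_lt_between. lra. }
  apply Lim_seq_correct' in Hcv. intros j.
  assert (Hlim : is_lim_seq (fun m => Rabs (x (m + j)%nat - x j)) (Rabs (real (Lim_seq x) - x j))).
  { apply (is_lim_seq_abs (fun m => x (m + j)%nat - x j) (Finite (real (Lim_seq x) - x j))).
    apply is_lim_seq_minus'; [|apply is_lim_seq_const].
    apply (is_lim_seq_incr_n x j). exact Hcv. }
  rewrite Rabs_minus_sym.
  apply (is_lim_seq_le (fun m => Rabs (x (m + j)%nat - x j)) (fun _ => 2 * c / 2 ^ j)
    (Finite (Rabs (real (Lim_seq x) - x j))) (Finite (2 * c / 2 ^ j)) (Hle j) Hlim).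
  apply is_lim_seq_const.
Qed.

(** Iterating [A |-> A / 2 + c] from any starting bound converges to [2 c]. *)
Lemma fixed_bound_of_contraction (D : R -> Prop) (h g : R -> R) (A0 c : R) :
  (forall s, 0 <= g s) ->
  (forall s, D s -> h s <= A0 * g s) ->
  (forall A, (forall s, D s -> h s <= A * g s) -> forall s, D s -> h s <= (A / 2 + c) * g s) ->
  forall s, D s -> h s <= 2 * c * g s.
Proof.
  intros Hg H0 Hstep.
  assert (Hj : forall j s, D s -> h s <= (A0 / 2 ^ j + 2 * c - 2 * c / 2 ^ j) * g s).
  { induction j as [|j IH].
    - intros s Hs. simpl. eapply Rle_trans; [apply (H0 s Hs)|]. right. field.
    - intros s Hs. eapply Rle_trans; [apply (Hstep _ IH s Hs)|]. right. simpl.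
      pose proof (pow_lt 2 j ltac:(lra)). field. lra. }
  intros s Hs.
  assert (Hlim : is_lim_seq (fun j => (A0 / 2 ^ j + 2 * c - 2 * c / 2 ^ j) * g s) (2 * c * g s)).
  { assert (Hz : is_lim_seq (fun j => / 2 ^ j) 0).
    { apply (is_lim_seq_ext (fun j => (/ 2) ^ j)).
      - intros j. apply pow_inv.
      - apply is_lim_seq_geom. rewrite Rabs_pos_eq; lra. }
    apply (is_lim_seq_ext (fun j => ((A0 - 2 * c) * g s) * / 2 ^ j + 2 * c * g s)).
    - intros j. pose proof (pow_lt 2 j ltac:(lra)). field. lra.
    - replace (Finite (2 * c * g s)) with (Finite ((A0 - 2 * c) * g s * 0 + 2 * c * g s)) by (f_equal; ring).
      apply is_lim_seq_plus'; [|apply is_lim_seq_const].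
      apply (is_lim_seq_scal_l _ _ (Finite 0) Hz). }
  apply (is_lim_seq_le (fun _ => h s) _ (Finite (h s)) (Finite (2 * c * g s)) (fun j => Hj j s Hs)
    (is_lim_seq_const _) Hlim).
Qed.

Lemma positive_part_abs (z : R) : (z + Rabs z) / 2 = Rmax 0 z.
Proof.
  unfold Rmax. destruct (Rle_dec 0 z); [rewrite Rabs_pos_eq by lra; field|].
  rewrite Rabs_left by lra. field.
Qed.

Section Volterra.

Variables p e r c2 q : R.
Hypothesis Hp : 0 < p.
Hypothesis He : 0 <= e.
Hypothesis Hr : 0 < r <= 1.
Hypothesis Hc2 : 0 < c2.
Hypothesis Hq : 1 <= q.

Variable th : R -> R.
Hypothesis th_cont : forall s, continuous th s.
Hypothesis th_range : forall s, 0 < th s <= 1.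
Hypothesis th_mono : forall s t, 0 <= s <= t -> th t <= th s.

(** With [r = 1 / k] and [p = n + l], the radial equation
    [(s^(n-k) (- w')^k)' = C s^(n-1+l) th(kap s) w^q], integrated once, says that
    [- w'] is [speed kap w], and integrated twice, that [w] is a fixed point of
    [volterra kap]. The factor [kap] is the scale at which the solution sees the
    normalised weight [th]; at [kap = 0] the weight is a pure power. *)
Definition source (kap : R) (u : R -> R) (s : R) : R := th (kap * s) * pw (u s) q.

(** The mean [s^(- p) * (p * int_0^s x^(p - 1) source x dx)], after the substitution
    [z = x^p]: in this form its continuity and its bounds at the origin are those of
    an ordinary average. *)
Definition mean_source (kap : R) (u : R -> R) (s : R) : R :=
  avg (fun z => source kap u (pw z (/ p))) (pw s p).

Definition speed (kap : R) (u : R -> R) (s : R) : R :=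
  c2 * (s * pw s e * pw (mean_source kap u s) r).

Definition volterra (kap : R) (u : R -> R) (s : R) : R := 1 - RInt (speed kap u) 0 s.

Let s0 : R := Rmin 1 (/ (2 * c2)).

Lemma start_pos : 0 < s0.
Proof. apply Rmin_pos; [lra|]. apply Rinv_0_lt_compat; lra. Qed.

(** The lower bound near 0 keeps the mean of the source away from 0 where the
    [r]-th power would not be Lipschitz. *)
Record admissible (u : R -> R) : Prop := {
  adm_cont : forall s, continuous u s;
  adm_le1 : forall s, 0 <= s -> u s <= 1;
  adm_start : forall s, 0 <= s <= s0 -> 1 / 2 <= u s
}.

Lemma source_continuous (kap : R) (u : R -> R) :
  (forall s, continuous u s) -> forall s, continuous (source kap u) s.
Proof.
  intros Hu s. apply (continuous_mult (K := R_AbsRing) (fun s => th (kap * s)) (fun s => pw (u s) q)).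
  - apply (continuous_comp (fun s => kap * s) th); [|apply th_cont].
    apply (continuous_scal_r (V := R_NormedModule) kap (fun s => s)). apply continuous_id.
  - apply (continuous_comp u (fun x => pw x q)); [apply Hu|]. apply pw_continuous. lra.
Qed.

Lemma mean_source_integrand_continuous (kap : R) (u : R -> R) :
  (forall s, continuous u s) -> forall z, continuous (fun z => source kap u (pw z (/ p))) z.
Proof.
  intros Hu z. apply (continuous_comp (fun z => pw z (/ p)) (source kap u)).
  - apply pw_continuous. left. now apply Rinv_0_lt_compat.
  - now apply source_continuous.
Qed.

Lemma mean_source_continuous (kap : R) (u : R -> R) :
  (forall s, continuous u s) -> forall s, continuous (mean_source kap u) s.
Proof.
  intros Hu s. apply (continuous_comp (fun s => pw s p) (avg _)).
  - apply pw_continuous. lra.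
  - apply avg_continuous. now apply mean_source_integrand_continuous.
Qed.

Lemma speed_continuous (kap : R) (u : R -> R) :
  (forall s, continuous u s) -> forall s, continuous (speed kap u) s.
Proof.
  intros Hu s. apply (continuous_scal_r (V := R_NormedModule) c2 (fun s => s * pw s e * pw (mean_source kap u s) r)).
  apply (continuous_mult (K := R_AbsRing) (fun s => s * pw s e)).
  - apply (continuous_mult (K := R_AbsRing) (fun s => s)); [apply continuous_id|]. now apply pw_continuous.
  - apply (continuous_comp (mean_source kap u) (fun x => pw x r)).
    + now apply mean_source_continuous.
    + apply pw_continuous. lra.
Qed.

Lemma volterra_derive (kap : R) (u : R -> R) :
  (forall s, continuous u s) -> forall s, is_derive (volterra kap u) s (- speed kap u s).
Proof.
  intros Hu s. unfold volterra.
  replace (- speed kap u s) with (0 - speed kap u s) by ring.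
  apply (is_derive_minus (V := R_NormedModule) (fun _ => 1)).
  - apply (is_derive_const (V := R_NormedModule)).
  - apply RInt_derive. now apply speed_continuous.
Qed.

Lemma root_between (s z : R) : 0 <= s -> 0 <= z <= pw s p -> 0 <= pw z (/ p) <= s.
Proof.
  intros Hs Hz. assert (Hip : 0 < / p) by now apply Rinv_0_lt_compat.
  split; [apply pw_ge0|].
  rewrite <- (pw_inverse s p) at 1 by lra. apply pw_mono; lra.
Qed.

Lemma mean_source_ge (kap : R) (u : R -> R) (s m : R) :
  (forall s, continuous u s) -> 0 <= s -> (forall x, 0 <= x <= s -> m <= source kap u x) ->
  m <= mean_source kap u s.
Proof.
  intros Hu Hs Hm. apply avg_ge.
  - now apply mean_source_integrand_continuous.
  - apply pw_ge0.
  - intros z Hz. apply Hm. now apply root_between.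
Qed.

Lemma mean_source_le (kap : R) (u : R -> R) (s m : R) :
  (forall s, continuous u s) -> 0 <= s -> (forall x, 0 <= x <= s -> source kap u x <= m) ->
  mean_source kap u s <= m.
Proof.
  intros Hu Hs Hm. apply avg_le.
  - now apply mean_source_integrand_continuous.
  - apply pw_ge0.
  - intros z Hz. apply Hm. now apply root_between.
Qed.

Lemma source_range (kap : R) (u : R -> R) (s : R) :
  0 <= s -> (forall s, 0 <= s -> u s <= 1) -> 0 <= source kap u s <= 1.
Proof.
  intros Hs Hu. unfold source. pose proof (th_range (kap * s)).
  pose proof (pw_ge0 (u s) q). pose proof (pw_le1 (u s) q ltac:(lra) (Hu s Hs)). nra.
Qed.

Lemma mean_source_range (kap : R) (u : R -> R) (s : R) :
  admissible u -> 0 <= s -> 0 <= mean_source kap u s <= 1.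
Proof.
  intros [Hu1 Hu2 _] Hs. split.
  - apply mean_source_ge; [exact Hu1|exact Hs|]. intros x Hx. apply source_range; [lra|exact Hu2].
  - apply mean_source_le; [exact Hu1|exact Hs|]. intros x Hx. apply source_range; [lra|exact Hu2].
Qed.

Lemma speed_range (kap : R) (u : R -> R) (s S : R) :
  admissible u -> 0 <= s <= S -> 0 <= speed kap u s <= c2 * (S * pw S e).
Proof.
  intros Hu Hs. unfold speed.
  pose proof (mean_source_range kap u s Hu ltac:(lra)) as HM.
  pose proof (pw_ge0 (mean_source kap u s) r). pose proof (pw_le1 (mean_source kap u s) r ltac:(lra) ltac:(lra)).
  pose proof (pw_ge0 s e). pose proof (pw_mono s S e He ltac:(lra)).
  assert (0 <= s * pw s e) by (apply Rmult_le_pos; lra).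
  assert (s * pw s e <= S * pw S e) by (apply Rmult_le_compat; lra).
  split; [apply Rmult_le_pos; [lra|]; apply Rmult_le_pos; lra|].
  apply Rmult_le_compat_l; [lra|]. nra.
Qed.

Lemma volterra_range (kap : R) (u : R -> R) (s : R) :
  admissible u -> 0 <= s -> 1 - s * (c2 * (s * pw s e)) <= volterra kap u s <= 1.
Proof.
  intros Hu Hs. unfold volterra.
  assert (Hex : ex_RInt (speed kap u) 0 s).
  { apply ex_RInt_of_continuous. apply speed_continuous, adm_cont, Hu. }
  assert (0 <= RInt (speed kap u) 0 s).
  { apply RInt_ge_0; [exact Hs|exact Hex|]. intros x Hx. apply (speed_range kap u x s Hu); lra. }
  assert (RInt (speed kap u) 0 s <= s * (c2 * (s * pw s e))); [|lra].
  replace (s * (c2 * (s * pw s e))) with (RInt (fun _ => c2 * (s * pw s e)) 0 s)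
    by exact (eq_trans (RInt_const_from_zero _ _) (Rmult_comm _ _)).
  apply RInt_le; [exact Hs|exact Hex|apply ex_RInt_const|].
  intros x Hx. apply (speed_range kap u x s Hu); lra.
Qed.

Lemma volterra_admissible (kap : R) (u : R -> R) : admissible u -> admissible (volterra kap u).
Proof.
  intros Hu. split.
  - intros s. apply (continuous_of_ex_derive (volterra kap u)).
    eexists. apply volterra_derive, adm_cont, Hu.
  - intros s Hs. apply (volterra_range kap u s Hu Hs).
  - intros s Hs. pose proof (volterra_range kap u s Hu ltac:(lra)) as HV.
    assert (Hs1 : s <= 1) by (eapply Rle_trans; [apply Hs|apply Rmin_l]).
    assert (Hs2 : s * c2 <= 1 / 2).
    { apply Rle_trans with (/ (2 * c2) * c2).
      - apply Rmult_le_compat_r; [lra|]. eapply Rle_trans; [apply Hs|apply Rmin_r].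
      - right. field. lra. }
    pose proof (pw_ge0 s e). pose proof (pw_le1 s e He Hs1).
    assert (s * (c2 * (s * pw s e)) <= 1 / 2); [|lra].
    replace (s * (c2 * (s * pw s e))) with (s * c2 * (s * pw s e)) by ring.
    assert (0 <= s * pw s e <= 1) by nra. nra.
Qed.

Lemma one_admissible : admissible (fun _ => 1).
Proof. split; intros; try lra. apply continuous_const. Qed.

(** By [adm_start] the source is bounded below on [[0, s0]], and this interval carries
    at least a fixed fraction of the mean over [[0, s]]. *)
Lemma mean_source_lower (S km : R) :
  0 <= S -> 0 <= km -> exists m, 0 < m /\ forall kap u s,
    0 <= kap <= km -> admissible u -> 0 <= s <= S -> m <= mean_source kap u s.
Proof.
  intros HS Hkm.
  pose proof start_pos as Hs0.
  set (S' := S + s0).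
  set (X0 := pw s0 p). set (XS := pw S' p).
  assert (HX0 : 0 < X0) by (apply pw_gt0; exact Hs0).
  assert (HXS : X0 <= XS) by (apply pw_mono; unfold S'; lra).
  set (g0 := th (km * S') * pw (1 / 2) q).
  assert (Hg0 : 0 < g0).
  { unfold g0. apply Rmult_lt_0_compat; [apply th_range|apply pw_gt0; lra]. }
  assert (Hlow : forall kap u x, 0 <= kap <= km -> admissible u -> 0 <= x <= s0 -> g0 <= source kap u x).
  { intros kap u x Hk Hu Hx. unfold source, g0.
    pose proof (th_range (km * S')). pose proof (pw_gt0 (1 / 2) q ltac:(lra)).
    apply Rmult_le_compat; try lra.
    - apply th_mono. split; [nra|]. apply Rmult_le_compat; unfold S'; lra.
    - apply pw_mono; [lra|]. apply (adm_start u Hu). exact Hx. }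
  exists (X0 / XS * g0). split.
  { apply Rmult_lt_0_compat; [apply Rdiv_lt_0_compat; lra|exact Hg0]. }
  intros kap u s Hk Hu Hs.
  assert (Hfrac : X0 / XS <= 1).
  { apply Rmult_le_reg_r with XS; [lra|]. unfold Rdiv. rewrite Rmult_assoc, Rinv_l; lra. }
  destruct (Rle_dec s s0) as [Hc|Hc].
  - apply mean_source_ge; [apply (adm_cont u Hu)|lra|]. intros x Hx.
    apply Rle_trans with g0; [nra|]. apply Hlow; [exact Hk|exact Hu|lra].
  - set (x := pw s p).
    assert (Hx0 : X0 <= x) by (apply pw_mono; lra).
    assert (HxS : x <= XS) by (apply pw_mono; unfold S'; lra).
    unfold mean_source. fold x. set (h := fun z => source kap u (pw z (/ p))).
    assert (Hh : forall z, continuous h z) by (apply mean_source_integrand_continuous, adm_cont, Hu).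
    unfold avg. destruct (Rlt_dec 0 x) as [Hxp|Hxp]; [|lra].
    assert (Hch : RInt h 0 x = RInt h 0 X0 + RInt h X0 x).
    { symmetry. apply (RInt_Chasles (V := R_CompleteNormedModule)); now apply ex_RInt_of_continuous. }
    assert (H1 : g0 * X0 <= RInt h 0 X0).
    { replace (g0 * X0) with (RInt (fun _ => g0) 0 X0)
        by apply RInt_const_from_zero.
      apply RInt_le; [lra|apply ex_RInt_const|now apply ex_RInt_of_continuous|].
      intros z Hz. apply Hlow; [exact Hk|exact Hu|]. apply root_between; [lra|fold X0; lra]. }
    assert (H2 : 0 <= RInt h X0 x).
    { apply RInt_ge_0; [exact Hx0|now apply ex_RInt_of_continuous|].
      intros z Hz. apply source_range; [apply pw_ge0|apply (adm_le1 u Hu)]. }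
    apply Rle_trans with (X0 / x * g0).
    + apply Rmult_le_compat_r; [lra|]. apply Rmult_le_compat_l; [lra|]. now apply Rinv_le_contravar.
    + replace (X0 / x * g0) with (g0 * X0 / x) by (field; lra).
      apply Rmult_le_compat_r; [left; now apply Rinv_0_lt_compat|]. lra.
Qed.

Lemma mean_source_diff (k1 k2 : R) (u1 u2 : R -> R) (s A L d : R) :
  admissible u1 -> admissible u2 -> 0 <= s -> 0 <= A -> 0 <= L ->
  (forall x, 0 <= x <= s -> Rabs (u1 x - u2 x) <= A * exp (L * x)) ->
  (forall x, 0 <= x <= s -> Rabs (th (k1 * x) - th (k2 * x)) <= d) ->
  Rabs (mean_source k1 u1 s - mean_source k2 u2 s) <= q * A * exp (L * s) + d.
Proof.
  intros Hu1 Hu2 Hs HA HL Hdu Hdt.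
  apply avg_diff; try (apply mean_source_integrand_continuous, adm_cont; assumption).
  { apply pw_ge0. }
  intros z Hz. destruct (root_between s z Hs Hz) as [Hx0 Hx1].
  set (x := pw z (/ p)) in *. unfold source.
  replace (th (k1 * x) * pw (u1 x) q - th (k2 * x) * pw (u2 x) q)
    with (th (k2 * x) * (pw (u1 x) q - pw (u2 x) q) + (th (k1 * x) - th (k2 * x)) * pw (u1 x) q) by ring.
  eapply Rle_trans; [apply Rabs_triang|]. rewrite !Rabs_mult.
  pose proof (th_range (k2 * x)) as Ht.
  rewrite (Rabs_pos_eq (th (k2 * x))), (Rabs_pos_eq (pw (u1 x) q)) by (try apply pw_ge0; lra).
  pose proof (pw_lipschitz_below1 q (u1 x) (u2 x) Hq (adm_le1 _ Hu1 x Hx0) (adm_le1 _ Hu2 x Hx0)) as Hl.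
  pose proof (pw_ge0 (u1 x) q). pose proof (pw_le1 (u1 x) q ltac:(lra) (adm_le1 _ Hu1 x Hx0)).
  specialize (Hdu x (conj Hx0 Hx1)). specialize (Hdt x (conj Hx0 Hx1)).
  assert (He1 : A * exp (L * x) <= A * exp (L * s)).
  { apply Rmult_le_compat_l; [exact HA|]. apply exp_le_compat. nra. }
  pose proof (Rabs_pos (pw (u1 x) q - pw (u2 x) q)). pose proof (Rabs_pos (th (k1 * x) - th (k2 * x))).
  apply Rplus_le_compat; [|nra].
  apply Rle_trans with (1 * Rabs (pw (u1 x) q - pw (u2 x) q)); [apply Rmult_le_compat_r; lra|].
  rewrite Rmult_1_l. eapply Rle_trans; [exact Hl|]. rewrite Rmult_assoc. apply Rmult_le_compat_l; lra.
Qed.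

(** Contraction in an exponentially weighted norm: the operator is an integral of a
    Lipschitz function, since the mean source stays above a positive [m], where the
    [r]-th power is Lipschitz although [r <= 1]. *)
Lemma volterra_contraction (S km : R) :
  0 <= S -> 0 <= km -> exists L D, 0 < L /\ 0 < D /\
  forall k1 k2 u1 u2 A d,
    0 <= k1 <= km -> 0 <= k2 <= km -> admissible u1 -> admissible u2 -> 0 <= A -> 0 <= d ->
    (forall x, 0 <= x <= S -> Rabs (u1 x - u2 x) <= A * exp (L * x)) ->
    (forall x, 0 <= x <= S -> Rabs (th (k1 * x) - th (k2 * x)) <= d) ->
    forall s, 0 <= s <= S -> Rabs (volterra k1 u1 s - volterra k2 u2 s) <= (A / 2 + D * d) * exp (L * s).
Proof.
  intros HS Hkm.
  destruct (mean_source_lower S km HS Hkm) as [m [Hm Hlow]].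
  set (R1 := Rpower m (r - 1)). assert (HR1 : 0 < R1) by apply Rpower_pos.
  set (c3 := c2 * (S * pw S e) + 1).
  pose proof (pw_ge0 S e) as HpS.
  assert (HSp : 0 <= S * pw S e) by (apply Rmult_le_pos; lra).
  assert (Hc3 : 0 < c3) by (unfold c3; nra).
  set (L := 2 * (c3 * R1 * q)).
  assert (HcR : 0 < c3 * R1) by (apply Rmult_lt_0_compat; lra).
  assert (HL : 0 < L) by (unfold L; nra).
  exists L, (c3 * R1 * (S + 1)). split; [exact HL|]. split; [nra|].
  intros k1 k2 u1 u2 A d Hk1 Hk2 Hu1 Hu2 HA Hd Hdu Hdt s Hs.
  unfold volterra.
  replace (1 - RInt (speed k1 u1) 0 s - (1 - RInt (speed k2 u2) 0 s))
    with (- (RInt (speed k1 u1) 0 s - RInt (speed k2 u2) 0 s)) by ring.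
  rewrite Rabs_Ropp.
  pose proof (speed_continuous k1 u1 (adm_cont _ Hu1)) as Hc1.
  pose proof (speed_continuous k2 u2 (adm_cont _ Hu2)) as Hcc2.
  assert (Heq : RInt (speed k1 u1) 0 s - RInt (speed k2 u2) 0 s = RInt (fun z => speed k1 u1 z - speed k2 u2 z) 0 s).
  { symmetry. apply (RInt_minus (V := R_CompleteNormedModule)); now apply ex_RInt_of_continuous. }
  rewrite Heq.
  assert (Hcd : forall z, continuous (fun z => speed k1 u1 z - speed k2 u2 z) z).
  { intros z. apply (continuous_minus (V := R_NormedModule) (speed k1 u1)); [apply Hc1|apply Hcc2]. }
  set (bnd := fun x => c3 * R1 * (q * A * exp (L * x) + d)).
  assert (Hpt : forall x, 0 <= x <= S -> Rabs (speed k1 u1 x - speed k2 u2 x) <= bnd x).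
  { intros x Hx. unfold speed, bnd.
    replace (c2 * (x * pw x e * pw (mean_source k1 u1 x) r) - c2 * (x * pw x e * pw (mean_source k2 u2 x) r))
      with (c2 * (x * pw x e) * (pw (mean_source k1 u1 x) r - pw (mean_source k2 u2 x) r)) by ring.
    rewrite Rabs_mult. pose proof (pw_ge0 x e). pose proof (pw_mono x S e He ltac:(lra)).
    assert (0 <= x * pw x e) by (apply Rmult_le_pos; lra).
    rewrite (Rabs_pos_eq (c2 * (x * pw x e))) by (apply Rmult_le_pos; lra).
    rewrite (Rmult_assoc c3). apply Rmult_le_compat; [apply Rmult_le_pos; lra|apply Rabs_pos| |].
    - unfold c3. assert (x * pw x e <= S * pw S e) by (apply Rmult_le_compat; lra). nra.
    - eapply Rle_trans.
      + apply (pw_lipschitz_above r m); [lra|exact Hm| |]; apply Hlow; assumption.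
      + fold R1. apply Rmult_le_compat_l; [lra|].
        apply mean_source_diff; try assumption; try lra.
        * intros y Hy. apply Hdu. lra.
        * intros y Hy. apply Hdt. lra. }
  (* L is chosen so that the first term of the bound integrates to half the norm *)
  set (Fb := fun x => A / 2 * exp (L * x) + c3 * R1 * d * x).
  assert (HFb : forall x, is_derive Fb x (bnd x)).
  { intros x. unfold Fb, bnd. auto_derive; [trivial|]. unfold L. field. }
  assert (Hbc : forall x, continuous bnd x).
  { intros x. apply (continuous_of_ex_derive bnd).
    unfold bnd. auto_derive. trivial. }
  assert (Hint : RInt bnd 0 s = Fb s - Fb 0).
  { apply is_RInt_unique. apply (is_RInt_derive (V := R_CompleteNormedModule) Fb bnd); intros x _; auto. }
  eapply Rle_trans; [apply abs_RInt_le; [lra|now apply ex_RInt_of_continuous]|].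
  apply Rle_trans with (RInt bnd 0 s).
  - apply RInt_le; [lra| |now apply ex_RInt_of_continuous|].
    + apply ex_RInt_of_continuous. intros z.
      apply (continuous_comp (fun z => speed k1 u1 z - speed k2 u2 z) Rabs); [apply Hcd|].
      apply continuity_pt_filterlim, Rcontinuity_abs.
    + intros x Hx. apply Hpt. lra.
  - rewrite Hint. unfold Fb. rewrite !Rmult_0_r, exp_0.
    assert (H1 : 1 <= exp (L * s)) by (rewrite <- exp_0; apply exp_le_compat; nra).
    assert (H2 : c3 * R1 * d * s <= c3 * R1 * (S + 1) * d * exp (L * s)).
    { assert (0 <= c3 * R1 * d) by (apply Rmult_le_pos; lra).
      replace (c3 * R1 * (S + 1) * d * exp (L * s)) with (c3 * R1 * d * ((S + 1) * exp (L * s))) by ring.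
      apply Rmult_le_compat_l; [assumption|]. nra. }
    lra.
Qed.

Fixpoint iterate (kap : R) (j : nat) : R -> R :=
  match j with
  | O => fun _ => 1
  | S j => volterra kap (iterate kap j)
  end.

(** Frozen to the left of 0, where nothing controls the iterates. *)
Definition picard_limit (kap s : R) : R := real (Lim_seq (fun j => iterate kap j (Rmax 0 s))).

(** Applied once more, the operator gives a function that is differentiable by
    construction and agrees with the limit on the half-line. *)
Definition sol (kap : R) : R -> R := volterra kap (picard_limit kap).

Lemma iterate_admissible (kap : R) (j : nat) : admissible (iterate kap j).
Proof. induction j; [apply one_admissible|now apply volterra_admissible]. Qed.

Lemma picard_error (S kap : R) :
  0 <= S -> 0 <= kap -> exists A L, 0 <= A /\ 0 < L /\
  forall j s, 0 <= s <= S -> Rabs (iterate kap j s - picard_limit kap s) <= A / 2 ^ j * exp (L * s).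
Proof.
  intros HS Hk.
  destruct (volterra_contraction S kap HS Hk) as [L [D [HL [HD Hcon]]]].
  pose proof (pw_ge0 S e) as HpS.
  set (A := S * (c2 * (S * pw S e))).
  assert (HA : 0 <= A).
  { unfold A. apply Rmult_le_pos; [lra|]. apply Rmult_le_pos; [lra|]. apply Rmult_le_pos; lra. }
  assert (Hstep : forall j s, 0 <= s <= S ->
    Rabs (iterate kap (Datatypes.S j) s - iterate kap j s) <= A / 2 ^ j * exp (L * s)).
  { induction j as [|j IH]; intros s Hs.
    - simpl. pose proof (volterra_range kap (fun _ => 1) s one_admissible ltac:(lra)) as HV.
      assert (1 <= exp (L * s)) by (rewrite <- exp_0; apply exp_le_compat; nra).
      assert (s * (c2 * (s * pw s e)) <= A).
      { unfold A. pose proof (pw_ge0 s e). pose proof (pw_mono s S e He ltac:(lra)).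
        assert (0 <= s * pw s e) by (apply Rmult_le_pos; lra).
        assert (s * pw s e <= S * pw S e) by (apply Rmult_le_compat; lra).
        apply Rmult_le_compat; try lra; [apply Rmult_le_pos; lra|]. apply Rmult_le_compat_l; lra. }
      rewrite Rabs_minus_sym, Rabs_pos_eq by lra.
      replace (A / 1) with A by field. nra.
    - assert (Hpos : 0 <= A / 2 ^ j).
      { apply Rmult_le_pos; [exact HA|]. left. apply Rinv_0_lt_compat, pow_lt. lra. }
      pose proof (Hcon kap kap _ _ (A / 2 ^ j) 0 (conj Hk (Rle_refl _)) (conj Hk (Rle_refl _))
        (iterate_admissible kap (Datatypes.S j)) (iterate_admissible kap j) Hpos (Rle_refl 0) IH) as H.
      simpl in H |- *. eapply Rle_trans; [apply H|].
      + intros x Hx. rewrite Rminus_diag, Rabs_R0. lra.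
      + exact Hs.
      + right. field. apply pow_nonzero. lra. }
  exists (2 * A), L. split; [lra|]. split; [exact HL|].
  intros j s Hs. unfold picard_limit. rewrite (Rmax_right 0 s) by lra.
  pose proof (geometric_limit (fun j => iterate kap j s) (A * exp (L * s))) as Hg.
  assert (HgS : forall j, Rabs (iterate kap (Datatypes.S j) s - iterate kap j s) <= A * exp (L * s) / 2 ^ j).
  { intros i. eapply Rle_trans; [apply (Hstep i s Hs)|]. right. unfold Rdiv. ring. }
  specialize (Hg HgS j). eapply Rle_trans; [exact Hg|]. right. unfold Rdiv. ring.
Qed.

Lemma below_geometric (x c : R) : (forall j, x <= c / 2 ^ j) -> x <= 0.
Proof.
  intros H.
  assert (Hlim : is_lim_seq (fun j => c / 2 ^ j) (c * 0)).
  { apply (is_lim_seq_scal_l (fun j => / 2 ^ j) c (Finite 0)).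
    apply (is_lim_seq_ext (fun j => (/ 2) ^ j)); [intros j; apply pow_inv|].
    apply is_lim_seq_geom. rewrite Rabs_pos_eq; lra. }
  pose proof (is_lim_seq_le (fun _ => x) (fun j => c / 2 ^ j) (Finite x) (Finite (c * 0)) H (is_lim_seq_const _) Hlim) as Hle.
  simpl in Hle. lra.
Qed.

Lemma picard_limit_continuous (kap : R) : 0 <= kap -> forall s, continuous (picard_limit kap) s.
Proof.
  intros Hk s.
  set (S := Rabs s + 1).
  assert (HS : 0 <= S) by (unfold S; pose proof (Rabs_pos s); lra).
  destruct (picard_error S kap HS Hk) as [A [L [HA [HL Herr]]]].
  apply continuity_pt_filterlim.
  apply (CVU_continuity (fun j s => iterate kap j (Rmax 0 s)) (picard_limit kap) s (mkposreal 1 Rlt_0_1)).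
  - intros eps Heps.
    set (B := A * exp (L * S) + 1).
    assert (HB : 0 < B) by (unfold B; pose proof (exp_pos (L * S)); nra).
    destruct (pow_lt_1_zero (/ 2) ltac:(rewrite Rabs_pos_eq; lra) (eps / B)) as [N HN].
    { apply Rdiv_lt_0_compat; lra. }
    exists N. intros j y Hj Hy. unfold Boule in Hy. simpl in Hy. apply Rabs_lt_between in Hy.
    assert (Hm : 0 <= Rmax 0 y <= S).
    { split; [apply Rmax_l|]. apply Rmax_lub; [exact HS|]. unfold S. pose proof (Rle_abs s). lra. }
    rewrite Rabs_minus_sym.
    replace (picard_limit kap y) with (picard_limit kap (Rmax 0 y))
      by (unfold picard_limit; rewrite (Rmax_right 0 (Rmax 0 y)) by apply Hm; reflexivity).
    eapply Rle_lt_trans; [apply (Herr j _ Hm)|].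
    specialize (HN j Hj). rewrite Rabs_pos_eq in HN by (left; apply pow_lt; lra). rewrite pow_inv in HN.
    assert (H2 : 0 < / 2 ^ j) by (apply Rinv_0_lt_compat, pow_lt; lra).
    apply Rle_lt_trans with (/ 2 ^ j * B).
    + replace (A / 2 ^ j * exp (L * Rmax 0 y)) with (/ 2 ^ j * (A * exp (L * Rmax 0 y))) by (unfold Rdiv; ring).
      apply Rmult_le_compat_l; [lra|].
      assert (exp (L * Rmax 0 y) <= exp (L * S)) by (apply exp_le_compat; apply Rmult_le_compat_l; lra).
      unfold B. nra.
    + apply Rlt_le_trans with (eps / B * B); [apply Rmult_lt_compat_r; lra|]. right. field. lra.
  - intros j y _. apply continuity_pt_filterlim.
    apply (continuous_comp (fun y => Rmax 0 y) (iterate kap j)).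
    + apply (continuous_ext (fun y => (y + Rabs y) / 2)).
      * intros z. apply positive_part_abs.
      * apply continuity_pt_filterlim. apply continuity_pt_mult.
        -- apply continuity_pt_plus; [apply derivable_continuous_pt, derivable_pt_id|apply Rcontinuity_abs].
        -- apply continuity_pt_const. intros x y'. reflexivity.
    + apply adm_cont, iterate_admissible.
  - unfold Boule. simpl. rewrite Rminus_diag, Rabs_R0. lra.
Qed.

Lemma picard_limit_admissible (kap : R) : 0 <= kap -> admissible (picard_limit kap).
Proof.
  intros Hk. split.
  - now apply picard_limit_continuous.
  - intros s Hs. destruct (picard_error s kap Hs Hk) as [A [L [HA [HL Herr]]]].
    assert (picard_limit kap s - 1 <= 0); [|lra].
    apply (below_geometric _ (A * exp (L * s))). intros j.
    specialize (Herr j s ltac:(lra)). apply Rabs_le_between in Herr.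
    pose proof (adm_le1 _ (iterate_admissible kap j) s Hs).
    replace (A * exp (L * s) / 2 ^ j) with (A / 2 ^ j * exp (L * s)) by (unfold Rdiv; ring). lra.
  - intros s Hs. destruct (picard_error s kap ltac:(lra) Hk) as [A [L [HA [HL Herr]]]].
    assert (1 / 2 - picard_limit kap s <= 0); [|lra].
    apply (below_geometric _ (A * exp (L * s))). intros j.
    specialize (Herr j s ltac:(lra)). apply Rabs_le_between in Herr.
    pose proof (adm_start _ (iterate_admissible kap j) s Hs).
    replace (A * exp (L * s) / 2 ^ j) with (A / 2 ^ j * exp (L * s)) by (unfold Rdiv; ring). lra.
Qed.

Lemma sol_eq_limit (kap s : R) : 0 <= kap -> 0 <= s -> sol kap s = picard_limit kap s.
Proof.
  intros Hk Hs.
  destruct (picard_error s kap Hs Hk) as [A [L [HA [HL Herr]]]].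
  destruct (volterra_contraction s kap Hs Hk) as [L' [D [HL' [HD Hcon]]]].
  set (B := A * exp (L * s)).
  assert (HB : 0 <= B) by (unfold B; pose proof (exp_pos (L * s)); nra).
  assert (Hz : Rabs (sol kap s - picard_limit kap s) <= 0).
  { apply (below_geometric _ (B * exp (L' * s) + B)). intros j.
    assert (H2 : 0 < / 2 ^ j) by (apply Rinv_0_lt_compat, pow_lt; lra).
    assert (HBj : 0 <= B / 2 ^ j) by (apply Rmult_le_pos; lra).
    pose proof (Hcon kap kap (picard_limit kap) (iterate kap j) (B / 2 ^ j) 0 (conj Hk (Rle_refl _)) (conj Hk (Rle_refl _))
      (picard_limit_admissible kap Hk) (iterate_admissible kap j) HBj (Rle_refl 0)) as H1.
    assert (Hd : forall x, 0 <= x <= s -> Rabs (picard_limit kap x - iterate kap j x) <= B / 2 ^ j * exp (L' * x)).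
    { intros x Hx. rewrite Rabs_minus_sym. eapply Rle_trans; [apply (Herr j x Hx)|].
      assert (1 <= exp (L' * x)) by (rewrite <- exp_0; apply exp_le_compat; nra).
      assert (exp (L * x) <= exp (L * s)) by (apply exp_le_compat; nra).
      apply Rle_trans with (B / 2 ^ j); [|nra].
      unfold B, Rdiv. replace (A * exp (L * s) * / 2 ^ j) with (A * / 2 ^ j * exp (L * s)) by ring.
      apply Rmult_le_compat_l; [apply Rmult_le_pos; lra|lra]. }
    specialize (H1 Hd). specialize (H1 (fun x _ => Req_le _ _ (eq_trans (f_equal Rabs (Rminus_diag _)) Rabs_R0)) s ltac:(lra)).
    pose proof (Herr (Datatypes.S j) s ltac:(lra)) as H3.
    change (iterate kap (Datatypes.S j) s) with (volterra kap (iterate kap j) s) in H3.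
    fold (sol kap) in H1.
    replace (sol kap s - picard_limit kap s) with
      ((sol kap s - volterra kap (iterate kap j) s) + (volterra kap (iterate kap j) s - picard_limit kap s)) by ring.
    eapply Rle_trans; [apply Rabs_triang|].
    replace ((B * exp (L' * s) + B) / 2 ^ j) with (B / 2 ^ j * exp (L' * s) + B / 2 ^ j) by (unfold Rdiv; ring).
    apply Rplus_le_compat.
    - eapply Rle_trans; [exact H1|]. apply Rmult_le_compat_r; [left; apply exp_pos|]. lra.
    - eapply Rle_trans; [exact H3|].
      replace (A / 2 ^ Datatypes.S j * exp (L * s)) with (B / 2 ^ j / 2)
        by (unfold B; simpl; field; apply pow_nonzero; lra). lra. }
  pose proof (Rabs_pos (sol kap s - picard_limit kap s)).
  assert (Rabs (sol kap s - picard_limit kap s) = 0) as H0 by lra.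
  apply Rabs_eq_0 in H0. lra.
Qed.

Lemma mean_source_ext (kap : R) (u1 u2 : R -> R) (s : R) :
  (forall x, 0 <= x -> u1 x = u2 x) -> mean_source kap u1 s = mean_source kap u2 s.
Proof.
  intros H. apply avg_ext. intros z Hz. unfold source. rewrite (H (pw z (/ p))); [reflexivity|apply pw_ge0].
Qed.

Lemma speed_ext (kap : R) (u1 u2 : R -> R) (s : R) :
  (forall x, 0 <= x -> u1 x = u2 x) -> speed kap u1 s = speed kap u2 s.
Proof. intros H. unfold speed. rewrite (mean_source_ext kap u1 u2 s H). reflexivity. Qed.

Lemma sol_admissible (kap : R) : 0 <= kap -> admissible (sol kap).
Proof. intros Hk. exact (volterra_admissible kap _ (picard_limit_admissible kap Hk)). Qed.

Lemma sol_derive (kap s : R) : 0 <= kap -> is_derive (sol kap) s (- speed kap (sol kap) s).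
Proof.
  intros Hk.
  rewrite (speed_ext kap (sol kap) (picard_limit kap)) by (intros x Hx; now apply sol_eq_limit).
  exact (volterra_derive kap _ (picard_limit_continuous kap Hk) s).
Qed.

Lemma sol_zero (kap : R) : sol kap 0 = 1.
Proof.
  unfold sol, volterra. rewrite RInt_point. unfold zero; simpl. lra.
Qed.

Lemma sol_fixed (kap s : R) : 0 <= kap -> sol kap s = volterra kap (sol kap) s.
Proof.
  intros Hk. unfold sol at 1, volterra. f_equal. apply RInt_ext. intros x _.
  symmetry. apply speed_ext. intros y Hy. now apply sol_eq_limit.
Qed.

(** Both solutions are fixed points, so the contraction turns the distance of the two
    weights into a distance of the solutions. *)
Lemma sol_stability (S km : R) :
  0 <= S -> 0 <= km -> exists D, 0 < D /\ forall k1 k2 d,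
    0 <= k1 <= km -> 0 <= k2 <= km -> 0 <= d ->
    (forall x, 0 <= x <= S -> Rabs (th (k1 * x) - th (k2 * x)) <= d) ->
    forall s, 0 <= s <= S -> Rabs (sol k1 s - sol k2 s) <= D * d.
Proof.
  intros HS Hkm.
  destruct (volterra_contraction S km HS Hkm) as [L [D [HL [HD Hcon]]]].
  exists (2 * D * exp (L * S)).
  split; [apply Rmult_lt_0_compat; [lra|apply exp_pos]|].
  intros k1 k2 d Hk1 Hk2 Hd Hdt s Hs.
  pose proof (sol_admissible k1 ltac:(lra)) as Ha1. pose proof (sol_admissible k2 ltac:(lra)) as Ha2.
  pose proof (pw_ge0 S e) as HpS.
  set (A0 := S * (c2 * (S * pw S e))).
  assert (HA0 : 0 <= A0).
  { unfold A0. apply Rmult_le_pos; [lra|]. apply Rmult_le_pos; [lra|]. apply Rmult_le_pos; lra. }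
  assert (Hb : Rabs (sol k1 s - sol k2 s) <= 2 * (D * d) * exp (L * s)).
  { apply (fixed_bound_of_contraction (fun s => 0 <= s <= S) (fun s => Rabs (sol k1 s - sol k2 s))
      (fun s => exp (L * s)) A0 (D * d)); [intros x; left; apply exp_pos| | |exact Hs].
    - intros x Hx.
      assert (Hr' : forall k, 0 <= k <= km -> 1 - A0 <= sol k x <= 1).
      { intros k Hk. rewrite sol_fixed by lra.
        pose proof (volterra_range k (sol k) x (sol_admissible k ltac:(lra)) ltac:(lra)) as HV.
        assert (x * (c2 * (x * pw x e)) <= A0); [|lra].
        unfold A0. pose proof (pw_ge0 x e). pose proof (pw_mono x S e He ltac:(lra)).
        assert (0 <= x * pw x e) by (apply Rmult_le_pos; lra).
        assert (x * pw x e <= S * pw S e) by (apply Rmult_le_compat; lra).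
        apply Rmult_le_compat; try lra; [apply Rmult_le_pos; lra|]. apply Rmult_le_compat_l; lra. }
      pose proof (Hr' k1 Hk1). pose proof (Hr' k2 Hk2).
      assert (1 <= exp (L * x)) by (rewrite <- exp_0; apply exp_le_compat; nra).
      apply Rle_trans with A0; [apply Rabs_le; lra|nra].
    - intros A HA x Hx.
      assert (HA1 : 0 <= A).
      { specialize (HA 0 ltac:(lra)). rewrite Rmult_0_r, exp_0, Rmult_1_r in HA.
        eapply Rle_trans; [apply Rabs_pos|exact HA]. }
      rewrite (sol_fixed k1), (sol_fixed k2) by lra.
      apply Hcon; try assumption. }
  eapply Rle_trans; [exact Hb|].
  replace (2 * D * exp (L * S) * d) with (2 * (D * d) * exp (L * S)) by ring.
  apply Rmult_le_compat_l; [apply Rmult_le_pos; [lra|apply Rmult_le_pos; lra]|]. apply exp_le_compat. nra.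
Qed.

End Volterra.

(** * Relative derivatives and the hypotheses of the theorem *)

(** [filterdiff] quantifies over all limits of the filter, not only over [x]. *)
Lemma within_limit_unique (D : R -> Prop) (x x' : R) :
  D x -> is_filter_lim (within D (locally x)) x' -> x' = x.
Proof.
  intros HD Hx'. destruct (Req_dec x' x) as [H|H]; [exact H|exfalso].
  assert (Hd : 0 < Rabs (x - x')) by (apply Rabs_pos_lt; lra).
  assert (Hloc : locally x' (fun y => Rabs (y - x') < Rabs (x - x'))).
  { exists (mkposreal _ Hd). intros y Hy. exact Hy. }
  specialize (Hx' _ Hloc). destruct Hx' as [d Hd'].
  specialize (Hd' x (ball_center x d) HD). lra.
Qed.

Lemma is_derive_on_of_is_derive (D : R -> Prop) (f : R -> R) (x l : R) :
  D x -> is_derive f x l -> is_derive_on D f x l.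
Proof.
  intros HD [Hlin Hdom]. split; [exact Hlin|].
  intros x' Hx'. rewrite (within_limit_unique D x x' HD Hx').
  intros eps. specialize (Hdom x (fun P HP => HP) eps).
  apply filter_le_within. exact Hdom.
Qed.

Lemma is_derive_of_is_derive_on (D : R -> Prop) (f : R -> R) (x l : R) :
  locally x D -> is_derive_on D f x l -> is_derive f x l.
Proof.
  intros HD [Hlin Hdom]. split; [exact Hlin|].
  intros x' Hx' eps.
  assert (Hlim : is_filter_lim (within D (locally x)) x').
  { intros P HP. apply filter_le_within. now apply Hx'. }
  specialize (Hdom x' Hlim eps). unfold within in Hdom.
  apply (filter_imp (fun y => D y /\ (D y -> norm (minus (minus (f y) (f x')) ((fun h => scal h l) (minus y x'))) <= eps * norm (minus y x')))).
  - intros y [H1 H2]. exact (H2 H1).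
  - apply filter_and; [exact HD|exact Hdom].
Qed.

Lemma continuous_on_of_continuous (D : R -> Prop) (f : R -> R) :
  (forall x, D x -> continuous f x) -> C_on 0 D f.
Proof.
  intros H x Hx. eapply filterlim_filter_le_1; [|exact (H x Hx)]. apply filter_le_within.
Qed.

Lemma pos_locally (x : R) : 0 < x -> locally x (fun y => 0 < y).
Proof.
  intros Hx. exists (mkposreal x Hx). intros y Hy.
  unfold_ball_in Hy.
  apply Rabs_lt_between in Hy. lra.
Qed.

(** ** The normalised weight [r^(- l0) rho r] *)

Section Weight.

Variables (rho : R -> R) (l0 L : R).
Hypothesis rho_C2 : C_on 2 (fun r => 0 < r) rho.
Hypothesis rho_C0 : C_on 0 (fun r => 0 <= r) rho.
Hypothesis rho_pos : forall r, 0 < r -> 0 < rho r.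
Hypothesis rho_slope : forall r, 0 < r -> log_slope rho r <= l0.
Hypothesis rho_bound : forall r, 0 < r -> 0 < Rpower r (- l0) * rho r < L.

Let f (r : R) : R := Rpower r (- l0) * rho r.

Lemma rho_derive (r : R) : 0 < r -> is_derive rho r (Derive rho r).
Proof.
  intros Hr. destruct rho_C2 as [g [Hg _]].
  pose proof (is_derive_of_is_derive_on _ _ _ _ (pos_locally r Hr) (Hg r Hr)) as H.
  rewrite (is_derive_unique _ _ _ H). exact H.
Qed.

Lemma normalised_derive (r : R) : 0 < r -> is_derive f r (f r / r * (log_slope rho r - l0)).
Proof.
  intros Hr. pose proof (rho_derive r Hr) as Hd.
  assert (Hp : is_derive (fun r => Rpower r (- l0)) r (- l0 * Rpower r (- l0 - 1))).
  { apply is_derive_Reals. now apply derivable_pt_lim_power. }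
  evar_last.
  - apply (is_derive_mult (fun r => Rpower r (- l0)) rho); [exact Hp|exact Hd|].
    intros x y. apply Rmult_comm.
  - unfold plus, mult; simpl. unfold f, log_slope. specialize (rho_pos r Hr).
    replace (Rpower r (- l0 - 1)) with (Rpower r (- l0) / r).
    + field. lra.
    + unfold Rminus. rewrite Rpower_plus, (Rpower_Ropp r 1), Rpower_1 by assumption. reflexivity.
Qed.

Lemma normalised_slope (r : R) : 0 < r -> f r / r * (log_slope rho r - l0) <= 0.
Proof.
  intros Hr. pose proof (rho_slope r Hr). destruct (rho_bound r Hr) as [Hf _]. fold (f r) in Hf.
  assert (0 < f r / r) by (apply Rdiv_lt_0_compat; lra). nra.
Qed.

Lemma normalised_nonincreasing (r s : R) : 0 < r <= s -> f s <= f r.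
Proof.
  intros [Hr Hrs].
  apply (nonincreasing_of_derive f (fun r => f r / r * (log_slope rho r - l0)) r s Hrs).
  - intros x Hx. apply normalised_derive. lra.
  - intros x Hx. apply normalised_slope. lra.
Qed.

Lemma normalised_limit : exists d, 0 < d /\ (forall r, 0 < r -> f r <= d) /\
  forall eps, 0 < eps -> exists r0, 0 < r0 /\ forall r, 0 < r <= r0 -> d - eps < f r.
Proof.
  set (E := fun y => exists r, 0 < r /\ y = f r).
  destruct (completeness E) as [d [Hd1 Hd2]].
  - exists L. intros y [r [Hr ->]]. left. apply (rho_bound r Hr).
  - exists (f 1). exists 1. split; [lra|reflexivity].
  - assert (Hle : forall r, 0 < r -> f r <= d) by (intros r Hr; apply Hd1; exists r; auto).
    exists d. split; [|split].
    + apply Rlt_le_trans with (f 1); [apply (rho_bound 1 Rlt_0_1)|apply Hle; lra].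
    + exact Hle.
    + intros eps Heps. apply Classical_Prop.NNPP. intro Hno.
      assert (d <= d - eps); [|lra]. apply Hd2. intros y [r [Hr ->]].
      apply Rnot_lt_le; intro Hl. apply Hno. exists r. split; [exact Hr|].
      intros s Hs. eapply Rlt_le_trans; [exact Hl|]. apply normalised_nonincreasing. exact Hs.
Qed.

(** A negative exponent would make [rho] unbounded at the origin. *)
Lemma exponent_nonneg : 0 <= l0.
Proof.
  apply Rnot_lt_le; intro Hneg.
  destruct normalised_limit as [d [Hd [_ Hlim]]].
  destruct (Hlim (d / 2) ltac:(lra)) as [r0 [Hr0 Hnear]].
  pose proof (rho_C0 0 (Rle_refl 0)) as Hc.
  destruct (proj1 (filterlim_locally (F := within (fun r => 0 <= r) (locally 0)) rho (rho 0)) Hc (mkposreal 1 Rlt_0_1)) as [dl Hdl].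
  set (X := 2 / d * (Rabs (rho 0) + 1)).
  pose proof (Rabs_pos (rho 0)).
  assert (HX : 0 < X) by (unfold X; apply Rmult_lt_0_compat; [apply Rdiv_lt_0_compat; lra|lra]).
  set (r := Rmin (Rmin (dl / 2) r0) (exp (ln X / l0))).
  assert (Hr : 0 < r).
  { unfold r. repeat apply Rmin_pos; [destruct dl; simpl; lra|lra|apply exp_pos]. }
  assert (Hr1 : r <= dl / 2) by (eapply Rle_trans; [apply Rmin_l|apply Rmin_l]).
  assert (Hr2 : r <= r0) by (eapply Rle_trans; [apply Rmin_l|apply Rmin_r]).
  assert (Hr3 : r <= exp (ln X / l0)) by apply Rmin_r.
  assert (HXr : X <= Rpower r l0).
  { rewrite <- (exp_ln X HX). apply exp_le_compat.
    assert (Hln : ln r <= ln X / l0) by (rewrite <- (ln_exp (ln X / l0)); apply ln_le; assumption).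
    replace (ln X) with (l0 * (ln X / l0)) by (field; lra). nra. }
  specialize (Hnear r ltac:(lra)).
  assert (Hrho : rho r = f r * Rpower r l0).
  { unfold f. rewrite Rpower_Ropp. pose proof (exp_pos (l0 * ln r)) as Hp. fold (Rpower r l0) in Hp. field. lra. }
  assert (Hbig : Rabs (rho 0) + 1 <= rho r).
  { rewrite Hrho. replace (Rabs (rho 0) + 1) with (d / 2 * X) by (unfold X; field; lra).
    apply Rmult_le_compat; lra. }
  assert (Hb : ball 0 dl r).
  { unfold_ball.
    rewrite Ropp_0, Rplus_0_r, Rabs_pos_eq by lra. destruct dl; simpl in *; lra. }
  specialize (Hdl r Hb ltac:(lra)).
  unfold_ball_in Hdl.
  apply Rabs_lt_between in Hdl. pose proof (Rle_abs (rho 0)). lra.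
Qed.

(** Dividing by the supremum, which is the limit at the origin by monotonicity, makes
    the weight extend continuously by 1. *)
Lemma weight_normalisation : exists d th dth,
  0 < d /\ (forall r, 0 < r -> th r = Rpower r (- l0) * rho r / d) /\
  (forall s, continuous th s) /\ (forall s, 0 < th s <= 1) /\ th 0 = 1 /\
  (forall s, 0 < s -> is_derive th s (dth s)) /\ (forall s, 0 < s -> dth s <= 0).
Proof.
  destruct normalised_limit as [d [Hd [Hle Hlim]]].
  set (th := fun r => if Rlt_dec 0 r then f r / d else 1).
  set (dth := fun r => f r / r * (log_slope rho r - l0) / d).
  assert (Hpos : forall r, 0 < r -> th r = f r / d).
  { intros r Hr. unfold th. destruct (Rlt_dec 0 r); [reflexivity|lra]. }
  assert (Hder : forall s, 0 < s -> is_derive th s (dth s)).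
  { intros s Hs. apply (is_derive_ext_loc (fun r => f r / d)).
    - apply (filter_imp (fun r => 0 < r)); [|now apply pos_locally].
      intros r Hr. symmetry. now apply Hpos.
    - pose proof (normalised_derive s Hs) as Hf.
      set (v := f s / s * (log_slope rho s - l0)) in *.
      apply (is_derive_ext (fun r => / d * f r)); [intros r; apply Rmult_comm|].
      replace (dth s) with (/ d * v) by (unfold dth, v, Rdiv; ring).
      now apply is_derive_scal. }
  assert (Hth1 : forall s, th s <= 1).
  { intros s. unfold th. destruct (Rlt_dec 0 s) as [Hs|Hs]; [|lra].
    apply Rmult_le_reg_r with d; [exact Hd|]. unfold Rdiv. rewrite Rmult_assoc, Rinv_l, Rmult_1_r by lra.
    rewrite Rmult_1_l. now apply Hle. }
  exists d, th, dth. split; [exact Hd|]. split; [exact Hpos|].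
  split; [|split; [|split; [|split]]].
  - intros s. destruct (Rlt_dec 0 s) as [Hs|Hs].
    + apply (continuous_of_ex_derive th). eexists. now apply Hder.
    + assert (Hths : th s = 1) by (unfold th; destruct (Rlt_dec 0 s); [lra|reflexivity]).
      apply filterlim_locally. intros eps. rewrite Hths.
      destruct (Hlim (eps * d)) as [r0 [Hr0 Hnear]].
      { apply Rmult_lt_0_compat; [apply cond_pos|exact Hd]. }
      exists (mkposreal r0 Hr0). intros r Hr.
      unfold_ball_all.
      apply Rabs_lt_between in Hr.
      assert (Hlow : 1 - eps < th r).
      { destruct (Rlt_dec 0 r) as [Hr'|Hr'].
        - rewrite Hpos by assumption. apply Rmult_lt_reg_r with d; [exact Hd|].
          unfold Rdiv. rewrite Rmult_assoc, Rinv_l, Rmult_1_r by lra.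
          specialize (Hnear r ltac:(lra)). lra.
        - unfold th. destruct (Rlt_dec 0 r); [lra|]. pose proof (cond_pos eps). lra. }
      specialize (Hth1 r). pose proof (cond_pos eps). apply Rabs_lt_between. lra.
  - intros s. split; [|apply Hth1]. unfold th. destruct (Rlt_dec 0 s) as [Hs|Hs]; [|lra].
    apply Rdiv_lt_0_compat; [apply (rho_bound s Hs)|exact Hd].
  - unfold th. destruct (Rlt_dec 0 0); [lra|reflexivity].
  - exact Hder.
  - intros s Hs. unfold dth. pose proof (normalised_slope s Hs).
    apply Rmult_le_reg_r with d; [exact Hd|]. unfold Rdiv at 1. rewrite Rmult_assoc, Rinv_l by lra. lra.
Qed.

End Weight.

(** ** The critical exponents *)

(** The trace of the linearisation at the equilibrium is [y - (n + l - q y)], so that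
    it is negative exactly above the critical exponent. *)
Lemma supercritical_gap (K n q l y : R) :
  0 < K -> 2 * K < n -> 0 <= l -> K < q ->
  ((n + 2) * K + l * (K + 1)) / (n - 2 * K) < q ->
  y = (2 * K + l) / (q - K) -> y < n + l - q * y.
Proof.
  intros HK Hn Hl Hq Hstar ->.
  assert (H : (n + 2) * K + l * (K + 1) < q * (n - 2 * K)).
  { apply Rmult_lt_reg_r with (/ (n - 2 * K)); [apply Rinv_0_lt_compat; lra|].
    rewrite Rmult_assoc, Rinv_r, Rmult_1_r by lra. exact Hstar. }
  apply Rmult_lt_reg_r with (q - K); [lra|].
  replace ((2 * K + l) / (q - K) * (q - K)) with (2 * K + l) by (field; lra).
  replace ((n + l - q * ((2 * K + l) / (q - K))) * (q - K)) with ((n + l) * (q - K) - q * (2 * K + l)) by (field; lra).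
  lra.
Qed.

(** Below the Joseph-Lundgren exponent the linearisation at the equilibrium has
    non-real eigenvalues. *)
Lemma spiral_condition (K n q l y : R) :
  0 < K -> 2 * K < n -> 0 <= l -> K < q ->
  y = (2 * K + l) / (q - K) -> y < n + l - q * y ->
  (n <= 2 * K + 8 + 4 * l / K \/
   (2 * K + 8 + 4 * l / K < n /\
    let s := sqrt (K * (2 * K + l) * ((K + 1) * n - K * (2 - l))) in
    q < K * ((K * (K + 1) * n - K ^ 2 * (2 - l) + 2 * K + l - 2 * s) /
             (K * (K + 1) * n - 2 * K ^ 2 * (K + 3) - 2 * K * l - 2 * s)))) ->
  ((n + l - q * y) - y) ^ 2 < 4 * (n + l - q * y) * y * (q - K) / K.
Proof.
  intros HK Hn Hl Hq Hy Hgap Hcase.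
  set (m := 2 * K + l). set (N := n - 2 * K).
  assert (Hm : 0 < m) by (unfold m; lra). assert (HN : 0 < N) by (unfold N; lra).
  assert (Hym : y * (q - K) = m) by (rewrite Hy; unfold m; field; lra).
  assert (Hy0 : 0 < y) by (rewrite Hy; apply Rdiv_lt_0_compat; unfold m in *; lra).
  assert (Hx : n + l - q * y = N - K * y) by (unfold N; replace (q * y) with (y * (q - K) + K * y) by ring; rewrite Hym; unfold m; ring).
  rewrite Hx in *.
  assert (HyN : (K + 1) * y < N) by lra.
  replace (4 * (N - K * y) * y * (q - K) / K) with (4 * m / K * (N - K * y)) by (rewrite <- Hym; field; lra).
  destruct Hcase as [Hc|[Hc Hs]].
  - assert (HN4 : N <= 4 * m / K).
    { unfold N, m. replace (4 * (2 * K + l) / K) with (8 + 4 * l / K) by (field; lra). lra. }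
    assert (Hz : 0 < N - (K + 1) * y < N) by nra.
    apply Rle_lt_trans with (N * (N - (K + 1) * y)); [nra|].
    apply Rle_lt_trans with (4 * m / K * (N - (K + 1) * y)).
    + apply Rmult_le_compat_r; lra.
    + apply Rmult_lt_compat_l; [apply Rdiv_lt_0_compat; lra|lra].
  - cbv zeta in Hs.
    set (s := sqrt (K * (2 * K + l) * ((K + 1) * n - K * (2 - l)))) in *.
    assert (HT : (K + 1) * n - K * (2 - l) = K * m + N * (K + 1)) by (unfold m, N; ring).
    assert (Hs2 : s ^ 2 = K * m * (K * m + N * (K + 1))).
    { unfold s. rewrite HT. fold m. apply pow2_sqrt. apply Rmult_le_pos; nra. }
    assert (Hs0 : 0 <= s) by apply sqrt_pos.
    set (c := K * ((K + 1) * N - 2 * m)).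
    assert (Hden : K * (K + 1) * n - 2 * K ^ 2 * (K + 3) - 2 * K * l - 2 * s = c - 2 * s)
      by (unfold c, m, N; ring).
    assert (Hnum : K * (K + 1) * n - K ^ 2 * (2 - l) + 2 * K + l - 2 * s = (c - 2 * s) + m * (K + 1) ^ 2)
      by (unfold c, m, N; ring).
    rewrite Hden, Hnum in Hs.
    assert (HN4 : 4 * m < K * N).
    { unfold N, m. apply Rmult_lt_reg_r with (/ K); [now apply Rinv_0_lt_compat|].
      replace (4 * (2 * K + l) * / K) with (8 + 4 * l / K) by (field; lra).
      replace (K * (n - 2 * K) * / K) with (n - 2 * K) by (field; lra). lra. }
    assert (Hc0 : 0 < c) by (unfold c; apply Rmult_lt_0_compat; [lra|nra]).
    assert (Hc2 : c ^ 2 - 4 * s ^ 2 = (K + 1) ^ 2 * N * K * (K * N - 4 * m)) by (rewrite Hs2; unfold c; ring).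
    assert (Hpos : 0 < (K + 1) ^ 2 * N * K * (K * N - 4 * m)).
    { repeat apply Rmult_lt_0_compat; lra. }
    assert (Hcs : 0 < c - 2 * s).
    { apply Rmult_lt_reg_r with (c + 2 * s); [lra|].
      replace ((c - 2 * s) * (c + 2 * s)) with (c ^ 2 - 4 * s ^ 2) by ring. lra. }
    assert (Hq2 : (q - K) * (c - 2 * s) < K * (m * (K + 1) ^ 2)).
    { apply Rmult_lt_reg_r with (/ (c - 2 * s)); [now apply Rinv_0_lt_compat|].
      rewrite Rmult_assoc, Rinv_r, Rmult_1_r by lra.
      replace (K * ((c - 2 * s + m * (K + 1) ^ 2) / (c - 2 * s))) with (K + K * (m * (K + 1) ^ 2) * / (c - 2 * s)) in Hs
        by (field; lra).
      lra. }
    (* the claim is quadratic in y; q < q_JL puts y above its smaller root and the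
       supercritical gap puts it below the larger one *)
    assert (Hlow : c - 2 * s < K * (K + 1) ^ 2 * y).
    { apply Rmult_lt_reg_l with (q - K); [lra|]. eapply Rlt_le_trans; [exact Hq2|]. rewrite <- Hym. right. ring. }
    assert (Hup : K * (K + 1) ^ 2 * y - c < 2 * s).
    { apply Rlt_le_trans with (2 * (K * m)).
      - unfold c. assert (K * (K + 1) * ((K + 1) * y) < K * (K + 1) * N) by (apply Rmult_lt_compat_l; nra). lra.
      - assert (K * m <= s); [|lra]. apply Rsqr_incr_0_var; [|exact Hs0]. rewrite !Rsqr_pow2, Hs2.
        assert (0 < K * m) by (apply Rmult_lt_0_compat; lra).
        assert (0 < N * (K + 1)) by (apply Rmult_lt_0_compat; lra). nra. }
    assert (Hsq : (K * (K + 1) ^ 2 * y - c) ^ 2 < 4 * s ^ 2) by nra.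
    apply Rmult_lt_reg_l with (K ^ 2 * (K + 1) ^ 2); [apply Rmult_lt_0_compat; apply pow_lt; lra|].
    apply Rminus_lt_0.
    replace (K ^ 2 * (K + 1) ^ 2 * (4 * m / K * (N - K * y)) - K ^ 2 * (K + 1) ^ 2 * (N - K * y - y) ^ 2)
      with (4 * s ^ 2 - (K * (K + 1) ^ 2 * y - c) ^ 2).
    + lra.
    + rewrite Hs2. unfold c. field. lra.
Qed.

Lemma C_pos (n k : nat) : (k <= n)%nat -> 0 < Binomial.C n k.
Proof.
  intros H. unfold Binomial.C. apply Rdiv_lt_0_compat; [apply INR_fact_lt_0|].
  apply Rmult_lt_0_compat; apply INR_fact_lt_0.
Qed.

(** * From oscillation to multiplicity *)

Lemma intermediate_value (f : R -> R) (x y v : R) :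
  (forall z, continuous f z) -> x <= y -> (f x <= v <= f y \/ f y <= v <= f x) ->
  exists z, x <= z <= y /\ f z = v.
Proof.
  intros Hf Hxy Hv.
  destruct (IVT_gen f x y v) as [z [Hz1 Hz2]].
  - intros z. apply continuity_pt_filterlim. apply Hf.
  - unfold Rmin, Rmax. destruct (Rle_dec (f x) (f y)); lra.
  - exists z. rewrite Rmin_left, Rmax_right in Hz1 by lra. auto.
Qed.

Section Oscillation.

Variables (f : R -> R) (al : R).
Hypothesis f_cont : forall t, continuous f t.
Hypothesis f_osc : forall M, (exists t, t <= M /\ al < f t) /\ (exists t, t <= M /\ f t < al).

Lemma crossing (M : R) : exists m d, m <= M /\ 0 < d /\
  forall v, Rabs (v - al) < d -> exists t, m <= t <= M /\ f t = v.
Proof.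
  destruct (f_osc M) as [[t1 [Ht1 H1]] [t2 [Ht2 H2]]].
  exists (Rmin t1 t2), (Rmin (f t1 - al) (al - f t2)).
  split; [eapply Rle_trans; [apply Rmin_l|exact Ht1]|].
  split; [apply Rmin_pos; lra|].
  intros v Hv. apply Rabs_lt_between in Hv.
  pose proof (Rmin_l (f t1 - al) (al - f t2)). pose proof (Rmin_r (f t1 - al) (al - f t2)).
  destruct (Rle_dec t1 t2) as [Hle|Hle].
  - destruct (intermediate_value f t1 t2 v f_cont Hle ltac:(lra)) as [t [Ht Hft]].
    exists t. rewrite Rmin_left by lra. split; [lra|exact Hft].
  - destruct (intermediate_value f t2 t1 v f_cont ltac:(lra) ltac:(lra)) as [t [Ht Hft]].
    exists t. rewrite Rmin_right by lra. split; [lra|exact Hft].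
Qed.

(** The levels near [al] are crossed again below any given bound, so preimages can be
    collected one below the other. *)
Lemma many_preimages (N : nat) : forall M, exists d, 0 < d /\
  forall v, Rabs (v - al) < d -> exists ts : nat -> R,
    (forall i, (i < N)%nat -> ts i <= M /\ f (ts i) = v) /\
    (forall i j, (i < N)%nat -> (j < N)%nat -> i <> j -> ts i <> ts j).
Proof.
  induction N as [|N IH]; intros M.
  - exists 1. split; [lra|]. intros v _. exists (fun _ => 0). split; intros; lia.
  - destruct (crossing M) as [m [d1 [Hm [Hd1 H1]]]].
    destruct (IH (m - 1)) as [d2 [Hd2 H2]].
    exists (Rmin d1 d2). split; [apply Rmin_pos; assumption|].
    intros v Hv.
    destruct (H1 v ltac:(eapply Rlt_le_trans; [exact Hv|apply Rmin_l])) as [t [Ht Hft]].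
    destruct (H2 v ltac:(eapply Rlt_le_trans; [exact Hv|apply Rmin_r])) as [ts [Hts Hinj]].
    exists (fun i => if Nat.eq_dec i N then t else ts i). split.
    + intros i Hi. destruct (Nat.eq_dec i N) as [->|Hne]; [split; [lra|exact Hft]|].
      destruct (Hts i ltac:(lia)). split; [lra|assumption].
    + intros i j Hi Hj Hij.
      destruct (Nat.eq_dec i N) as [Hi'|Hi'], (Nat.eq_dec j N) as [Hj'|Hj'].
      * lia.
      * destruct (Hts j ltac:(lia)). lra.
      * destruct (Hts i ltac:(lia)). lra.
      * apply Hinj; lia.
Qed.

Lemma infinitely_many_preimages : exists ts : nat -> R,
  (forall i, f (ts i) = al) /\ (forall i j, i <> j -> ts i <> ts j).
Proof.
  destruct (functional_choice (fun M t => t <= M /\ f t = al)) as [g Hg].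
  { intros M. destruct (crossing M) as [m [d [_ [Hd H]]]].
    destruct (H al ltac:(rewrite Rminus_diag, Rabs_R0; exact Hd)) as [t [Ht Hft]].
    exists t. split; [lra|exact Hft]. }
  set (ts := fix ts i := match i with O => g 0 | S i => g (ts i - 1) end).
  assert (Hdec : forall i m, ts (S m + i)%nat < ts i).
  { intros i. induction m as [|m IHm].
    - simpl. destruct (Hg (ts i - 1)). lra.
    - change (ts (S (S m) + i)%nat) with (g (ts (S m + i)%nat - 1)).
      destruct (Hg (ts (S m + i)%nat - 1)). lra. }
  exists ts. split.
  - intros [|i]; simpl; apply Hg.
  - intros i j Hij.
    destruct (Nat.lt_total i j) as [H|[H|H]]; [|contradiction|].
    + replace j with (S (j - i - 1) + i)%nat by lia. apply Rgt_not_eq, Hdec.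
    + replace i with (S (i - j - 1) + j)%nat by lia. apply Rlt_not_eq, Hdec.
Qed.

End Oscillation.

(** * The planar system in logarithmic coordinates *)

(** The normalised weight in the variable [t = ln r]. *)
Record weight (Th dTh : R -> R) : Prop := {
  weight_pos : forall t, 0 < Th t;
  weight_le1 : forall t, Th t <= 1;
  weight_derive : forall t, is_derive Th t (dTh t);
  weight_slope : forall t, dTh t <= 0
}.

Lemma weight_one : weight (fun _ => 1) (fun _ => 0).
Proof.
  split; intros; try lra. apply (is_derive_const (V := R_NormedModule) 1 t).
Qed.

(** Regularity at the origin [r = 0], which is [t = -oo]. *)
Definition vanishing (f : R -> R) : Prop :=
  forall eps, 0 < eps -> exists T, forall t, t <= T -> exp (f t) <= eps.

Section Plane.

Variables K q xs ys : R.
Hypothesis HK : 1 <= K.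
Hypothesis Hq : K < q.
Hypothesis Hys : 0 < ys.
Hypothesis Hxs : ys < xs.

(** The radial equation in the variables [a = ln (w r^ys)] and [b], where
    [ys e^(b - a) = - r w' / w]. The singular solution [r^(- ys)] of the pure power
    weight is the equilibrium [a = b = 0]. Orbits are considered on a set [D] of times
    because [a] makes sense only as long as [w] is positive. *)
Definition orbit (Th : R -> R) (D : R -> Prop) (a b : R -> R) : Prop :=
  forall t, D t ->
    is_derive a t (ys * (1 - exp (b t - a t))) /\
    is_derive b t (xs / K * (Th t * exp (q * a t - K * b t) - 1)).

(** Conserved for a constant weight at the critical exponent, where [xs = ys]. *)
Definition energy (th a b : R) : R :=
  xs * th * exp ((q + 1) * a) / (q + 1) + ys * K / (K + 1) * exp ((K + 1) * b)
  - ys * exp (a + K * b) - (xs - ys) * exp ((K + 1) * a) / (K + 1).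

Lemma orbit_shift (tau : R) (Th Th' a b : R -> R) :
  orbit Th' (fun _ => True) a b -> (forall t, Th t = Th' (t - tau)) ->
  orbit Th (fun _ => True) (fun t => a (t - tau)) (fun t => b (t - tau)).
Proof.
  intros Ho HT t _. destruct (Ho (t - tau) I) as [Ha Hb]. rewrite HT.
  assert (Hs : is_derive (fun t => t - tau) t 1) by (auto_derive; [trivial|ring]).
  split.
  - evar_last; [apply (is_derive_comp a (fun t => t - tau) t _ _ Ha Hs)|].
    unfold scal; simpl; unfold mult; simpl. ring.
  - evar_last; [apply (is_derive_comp b (fun t => t - tau) t _ _ Hb Hs)|].
    unfold scal; simpl; unfold mult; simpl. ring.
Qed.

Lemma vanishing_shift (tau : R) (f : R -> R) : vanishing f -> vanishing (fun t => f (t - tau)).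
Proof.
  intros Hf eps Heps. destruct (Hf eps Heps) as [T HT]. exists (T + tau).
  intros t Ht. apply HT. lra.
Qed.

Section Energy.

Variables Th dTh : R -> R.
Hypothesis HTh : weight Th dTh.

Lemma exp_comonotone (a b : R) : 0 <= (exp a - exp b) * (exp (K * a) - exp (K * b)).
Proof.
  destruct (Rle_dec a b) as [H|H].
  - pose proof (exp_le_compat a b H).
    assert (exp (K * a) <= exp (K * b)) by (apply exp_le_compat; nra). nra.
  - pose proof (exp_le_compat b a ltac:(lra)).
    assert (exp (K * b) <= exp (K * a)) by (apply exp_le_compat; nra). nra.
Qed.

(** Along orbits the energy is dissipated: the Hamiltonian part leaves
    [(xs - ys) e^(a + K b) a'], which the last term of the energy turns into a
    product of two factors of opposite signs. *)
Lemma energy_derive (D : R -> Prop) (a b : R -> R) (t : R) :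
  orbit Th D a b -> D t ->
  is_derive (fun t => energy (Th t) (a t) (b t)) t
    (xs * dTh t * exp ((q + 1) * a t) / (q + 1)
     - (xs - ys) * ys * ((exp (a t) - exp (b t)) * (exp (K * a t) - exp (K * b t)))).
Proof.
  intros Ho Ht. destruct (Ho t Ht) as [Ha Hb].
  pose proof (weight_derive _ _ HTh t) as HT.
  unfold energy. auto_derive.
  - repeat split; first [eexists; exact HT | eexists; exact Ha | eexists; exact Hb].
  - rewrite_derive HT. rewrite_derive Ha. rewrite_derive Hb.
    set (A := exp (a t)). set (B := exp (b t)).
    set (AK := exp (K * a t)). set (BK := exp (K * b t)). set (Aq := exp (q * a t)).
    assert (HA : A <> 0) by (apply Rgt_not_eq, exp_pos).
    assert (HBK : BK <> 0) by (apply Rgt_not_eq, exp_pos).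
    replace (exp (b t - a t)) with (B / A)
      by (unfold Rminus; rewrite exp_plus, exp_Ropp; reflexivity).
    replace (exp (q * a t - K * b t)) with (Aq / BK)
      by (unfold Rminus; rewrite exp_plus, exp_Ropp; reflexivity).
    replace (exp ((q + 1) * a t)) with (Aq * A)
      by (unfold Aq, A; rewrite <- exp_plus; f_equal; ring).
    replace (exp ((K + 1) * a t)) with (AK * A)
      by (unfold AK, A; rewrite <- exp_plus; f_equal; ring).
    replace (exp ((K + 1) * b t)) with (BK * B)
      by (unfold BK, B; rewrite <- exp_plus; f_equal; ring).
    replace (exp (a t + K * b t)) with (A * BK)
      by (unfold BK, A; rewrite <- exp_plus; f_equal; ring).
    field. repeat split; try assumption; lra.
Qed.

Lemma energy_slope_nonpos (a b t : R) :
  xs * dTh t * exp ((q + 1) * a) / (q + 1)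
   - (xs - ys) * ys * ((exp a - exp b) * (exp (K * a) - exp (K * b))) <= 0.
Proof.
  pose proof (weight_slope _ _ HTh t) as HT.
  pose proof (exp_comonotone a b) as Hc.
  pose proof (exp_pos ((q + 1) * a)) as He.
  assert (H1 : xs * dTh t * exp ((q + 1) * a) / (q + 1) <= 0).
  { apply Rmult_le_0_r; [|left; apply Rinv_0_lt_compat; lra].
    apply Rmult_le_0_r; [|lra]. apply Rmult_le_0_l; lra. }
  assert (H2 : 0 <= (xs - ys) * ys) by nra. nra.
Qed.

Lemma energy_nonincreasing (D : R -> Prop) (a b : R -> R) (s t : R) :
  orbit Th D a b -> s <= t -> (forall x, s <= x <= t -> D x) ->
  energy (Th t) (a t) (b t) <= energy (Th s) (a s) (b s).
Proof.
  intros Ho Hst HD.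
  eapply (nonincreasing_of_derive (fun t => energy (Th t) (a t) (b t))); [exact Hst| |].
  - intros x Hx. apply (energy_derive D a b x Ho (HD x Hx)).
  - intros x Hx. apply energy_slope_nonpos.
Qed.

(** The energy starts from the value 0 at [t = -oo] and only decreases. *)
Lemma energy_nonpos (D : R -> Prop) (a b : R -> R) (t : R) :
  orbit Th D a b -> vanishing a -> vanishing b ->
  (forall x, x <= t -> D x) ->
  energy (Th t) (a t) (b t) <= 0.
Proof.
  intros Ho Ha Hb HD.
  apply Rnot_lt_le; intro Hpos.
  set (v := energy (Th t) (a t) (b t)) in *.
  set (eps := Rmin 1 (v / (2 * (xs + ys)))).
  assert (He : 0 < eps).
  { unfold eps. apply Rmin_pos; [lra|]. apply Rdiv_lt_0_compat; lra. }
  assert (He1 : eps <= 1) by apply Rmin_l.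
  assert (He2 : eps * (xs + ys) <= v / 2).
  { replace (v / 2) with (v / (2 * (xs + ys)) * (xs + ys)) by (field; lra).
    apply Rmult_le_compat_r; [lra|]. apply Rmin_r. }
  destruct (Ha eps He) as [T1 HT1]. destruct (Hb eps He) as [T2 HT2].
  set (s := Rmin t (Rmin T1 T2)).
  assert (Hst : s <= t) by apply Rmin_l.
  assert (Hs1 : s <= T1) by (eapply Rle_trans; [apply Rmin_r|apply Rmin_l]).
  assert (Hs2 : s <= T2) by (eapply Rle_trans; [apply Rmin_r|apply Rmin_r]).
  pose proof (energy_nonincreasing D a b s t Ho Hst (fun x Hx => HD x (proj2 Hx))) as Hdec.
  fold v in Hdec.
  assert (E1 : exp ((q + 1) * a s) <= eps) by (apply exp_nat_mul_le; [lra|lra|auto]).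
  assert (E2 : exp ((K + 1) * b s) <= eps) by (apply exp_nat_mul_le; [lra|lra|auto]).
  assert (Hup : energy (Th s) (a s) (b s) <= xs * eps + ys * eps); [|lra].
  unfold energy.
  pose proof (weight_pos _ _ HTh s). pose proof (weight_le1 _ _ HTh s).
  pose proof (exp_pos ((q + 1) * a s)). pose proof (exp_pos ((K + 1) * b s)).
  pose proof (exp_pos (a s + K * b s)). pose proof (exp_pos ((K + 1) * a s)).
  assert (xs * Th s * exp ((q + 1) * a s) / (q + 1) <= xs * eps).
  { apply Rmult_le_reg_r with (q + 1); [lra|].
    replace (xs * Th s * exp ((q + 1) * a s) / (q + 1) * (q + 1))
      with (xs * (Th s * exp ((q + 1) * a s))) by (field; lra).
    rewrite Rmult_assoc. apply Rmult_le_compat_l; [lra|]. nra. }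
  assert (ys * K / (K + 1) * exp ((K + 1) * b s) <= ys * eps).
  { apply Rmult_le_compat; try lra.
    - apply Rlt_le, Rdiv_lt_0_compat; nra.
    - apply Rmult_le_reg_r with (K + 1); [lra|].
      unfold Rdiv. rewrite Rmult_assoc, Rinv_l; nra. }
  assert (0 <= (xs - ys) * exp ((K + 1) * a s) / (K + 1)).
  { apply Rlt_le, Rdiv_lt_0_compat; [apply Rmult_lt_0_compat; lra | lra]. }
  nra.
Qed.

Definition slope_bound : R := (K + 1) / K * (1 + (xs - ys) / ((K + 1) * ys)).

(** When [e^((K + 1) a)] is factored out of the energy, what remains is positive as soon
    as [e^(b - a)], the logarithmic slope [- r w' / w] up to the factor [ys], exceeds
    [slope_bound]. *)
Lemma slope_bounded (th a b : R) :
  0 < th -> energy th a b <= 0 -> exp (b - a) <= slope_bound.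
Proof.
  intros Hth HV.
  apply Rnot_lt_le; intro Hlt.
  set (y := exp (b - a)) in *.
  set (yK := exp (K * (b - a))).
  assert (HE : energy th a b = xs * th * exp ((q + 1) * a) / (q + 1)
    + exp ((K + 1) * a) * (ys * yK * (K / (K + 1) * y - 1) - (xs - ys) / (K + 1))).
  { unfold energy, yK, y.
    replace (exp ((K + 1) * b)) with (exp ((K + 1) * a) * exp (K * (b - a)) * exp (b - a))
      by (rewrite <- !exp_plus; f_equal; ring).
    replace (exp (a + K * b)) with (exp ((K + 1) * a) * exp (K * (b - a)))
      by (rewrite <- !exp_plus; f_equal; ring).
    field. lra. }
  assert (Hs : K / (K + 1) * slope_bound - 1 = (xs - ys) / ((K + 1) * ys)).
  { unfold slope_bound. field. lra. }
  assert (Hr : 0 < (xs - ys) / ((K + 1) * ys)) by (apply Rdiv_lt_0_compat; nra).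
  assert (HKp : 0 < K / (K + 1)) by (apply Rdiv_lt_0_compat; lra).
  assert (Hy : (xs - ys) / ((K + 1) * ys) < K / (K + 1) * y - 1) by nra.
  assert (Hy1 : 1 <= yK).
  { unfold yK. rewrite <- exp_0. apply exp_le_compat.
    assert (0 <= b - a); [|nra].
    apply Rnot_lt_le; intro Hl. apply exp_increasing in Hl. rewrite exp_0 in Hl.
    fold y in Hl. assert (y < slope_bound); [|lra].
    assert (1 <= slope_bound); [|lra].
    clearbody y yK. assert (1 <= (K + 1) / K).
    { apply Rmult_le_reg_r with K; [lra|]. unfold Rdiv. rewrite Rmult_assoc, Rinv_l; lra. }
    unfold slope_bound. clear - Hr H. set (z := (xs - ys) / ((K + 1) * ys)) in *. nra. }
  assert (Hz : 0 < ys * yK * (K / (K + 1) * y - 1) - (xs - ys) / (K + 1)).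
  { assert (ys * ((xs - ys) / ((K + 1) * ys)) = (xs - ys) / (K + 1)) by (field; lra).
    assert (ys * ((xs - ys) / ((K + 1) * ys)) < ys * (K / (K + 1) * y - 1)) by (apply Rmult_lt_compat_l; lra).
    set (g := K / (K + 1) * y - 1) in *.
    replace (ys * yK * g) with (yK * (ys * g)) by ring.
    assert (1 * (ys * g) <= yK * (ys * g)); [|lra].
    apply Rmult_le_compat_r; [|lra]. apply Rmult_le_pos; lra. }
  assert (0 < xs * th * exp ((q + 1) * a) / (q + 1)).
  { pose proof (exp_pos ((q + 1) * a)).
    apply Rdiv_lt_0_compat; [apply Rmult_lt_0_compat; [nra|lra]|lra]. }
  pose proof (exp_pos ((K + 1) * a)). nra.
Qed.

(** The energy splits into a function [well] of [a] alone and the defect [gap] in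
    Young's inequality for [e^a] and [e^(K b)]. *)
Definition well (th a : R) : R :=
  th * exp ((q + 1) * a) / (q + 1) - exp ((K + 1) * a) / (K + 1).

Definition gap (d : R) : R := (K * exp ((K + 1) * d) + 1) / (K + 1) - exp (K * d).

Lemma energy_split (th a b : R) :
  energy th a b = xs * well th a + ys * exp ((K + 1) * a) * gap (b - a).
Proof.
  unfold energy, well, gap.
  replace (exp ((K + 1) * b)) with (exp ((K + 1) * a) * exp ((K + 1) * (b - a)))
    by (rewrite <- !exp_plus; f_equal; ring).
  replace (exp (a + K * b)) with (exp ((K + 1) * a) * exp (K * (b - a)))
    by (rewrite <- !exp_plus; f_equal; ring).
  field. lra.
Qed.

Lemma gap_derive (d : R) :
  is_derive gap d (K * (exp ((K + 1) * d) - exp (K * d))).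
Proof. unfold gap. auto_derive; [trivial|]. field. lra. Qed.

Lemma gap_mono_pos (d e : R) : 0 <= d <= e -> gap d <= gap e.
Proof.
  intros [H0 H1].
  apply (nondecreasing_of_derive gap _ d e H1 (fun x _ => gap_derive x)).
  intros x Hx. assert (exp (K * x) <= exp ((K + 1) * x)) by (apply exp_le_compat; nra). nra.
Qed.

Lemma gap_mono_neg (d e : R) : e <= d <= 0 -> gap d <= gap e.
Proof.
  intros [H0 H1].
  apply (nonincreasing_of_derive gap _ e d H0 (fun x _ => gap_derive x)).
  intros x Hx. assert (exp ((K + 1) * x) <= exp (K * x)) by (apply exp_le_compat; nra). nra.
Qed.

Lemma gap_zero : gap 0 = 0.
Proof. unfold gap. rewrite !Rmult_0_r, exp_0. field. lra. Qed.

Lemma gap_nonneg (d : R) : 0 <= gap d.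
Proof.
  rewrite <- gap_zero. destruct (Rle_dec 0 d).
  - apply gap_mono_pos; lra.
  - apply gap_mono_neg; lra.
Qed.

Lemma well_derive (a : R) :
  is_derive (well 1) a (exp ((q + 1) * a) - exp ((K + 1) * a)).
Proof. unfold well. auto_derive; [trivial|]. field. lra. Qed.

Lemma well_mono_pos (d e : R) : 0 <= d <= e -> well 1 d <= well 1 e.
Proof.
  intros [H0 H1].
  apply (nondecreasing_of_derive (well 1) _ d e H1 (fun x _ => well_derive x)).
  intros x Hx. assert (exp ((K + 1) * x) <= exp ((q + 1) * x)) by (apply exp_le_compat; nra). nra.
Qed.

Lemma well_mono_neg (d e : R) : e <= d <= 0 -> well 1 d <= well 1 e.
Proof.
  intros [H0 H1].
  apply (nonincreasing_of_derive (well 1) _ e d H0 (fun x _ => well_derive x)).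
  intros x Hx. assert (exp ((q + 1) * x) <= exp ((K + 1) * x)) by (apply exp_le_compat; nra). nra.
Qed.

Lemma well_min (a : R) : well 1 0 <= well 1 a.
Proof.
  destruct (Rle_dec 0 a); [apply well_mono_pos | apply well_mono_neg]; lra.
Qed.

Lemma strict_of_derive (f df : R -> R) (s t : R) :
  s < t -> (forall x, is_derive f x (df x)) ->
  (forall x, s < x < t -> 0 < df x) -> f s < f t.
Proof.
  intros Hst Hd Hp.
  destruct (MVT_cor2 f df s t Hst) as [c [Hc Hin]].
  - intros c _. apply is_derive_Reals, Hd.
  - specialize (Hp c Hin). nra.
Qed.

Lemma strict_of_derive_neg (f df : R -> R) (s t : R) :
  s < t -> (forall x, is_derive f x (df x)) ->
  (forall x, s < x < t -> df x < 0) -> f t < f s.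
Proof.
  intros Hst Hd Hp.
  destruct (MVT_cor2 f df s t Hst) as [c [Hc Hin]].
  - intros c _. apply is_derive_Reals, Hd.
  - specialize (Hp c Hin). nra.
Qed.

Lemma gap_strict (d : R) : d <> 0 -> 0 < gap d.
Proof.
  intros Hd. rewrite <- gap_zero. destruct (Rlt_dec 0 d).
  - apply (strict_of_derive gap _ 0 d r gap_derive).
    intros x Hx. assert (exp (K * x) < exp ((K + 1) * x)) by (apply exp_increasing; nra). nra.
  - apply (strict_of_derive_neg gap _ d 0 ltac:(lra) gap_derive).
    intros x Hx. assert (exp ((K + 1) * x) < exp (K * x)) by (apply exp_increasing; nra). nra.
Qed.

Lemma well_strict (a : R) : a <> 0 -> well 1 0 < well 1 a.
Proof.
  intros Hd. destruct (Rlt_dec 0 a).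
  - apply (strict_of_derive (well 1) _ 0 a r well_derive).
    intros x Hx. assert (exp ((K + 1) * x) < exp ((q + 1) * x)) by (apply exp_increasing; nra). lra.
  - apply (strict_of_derive_neg (well 1) _ a 0 ltac:(lra) well_derive).
    intros x Hx. assert (exp ((q + 1) * x) < exp ((K + 1) * x)) by (apply exp_increasing; nra). lra.
Qed.

Definition energy_min : R := xs * well 1 0.

(** The two terms of [energy_split] have strict minima at [a = 0] and [b - a = 0] and
    are monotone on both sides, so that low energy confines both. *)
Lemma sublevel_small (eps : R) :
  0 < eps -> exists eta, 0 < eta /\
  forall a b, energy 1 a b < energy_min + eta -> Rabs a <= eps /\ Rabs (b - a) <= eps.
Proof.
  intros He.
  set (c1 := Rmin (well 1 eps - well 1 0) (well 1 (- eps) - well 1 0)).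
  set (c2 := Rmin (gap eps) (gap (- eps))).
  assert (Hc1 : 0 < c1).
  { pose proof (well_strict eps ltac:(lra)). pose proof (well_strict (- eps) ltac:(lra)).
    unfold c1. apply Rmin_pos; lra. }
  assert (Hc2 : 0 < c2) by (apply Rmin_pos; apply gap_strict; lra).
  set (e0 := exp ((K + 1) * - eps)).
  assert (He0 : 0 < e0) by apply exp_pos.
  exists (Rmin (xs * c1) (ys * e0 * c2)). split.
  { apply Rmin_pos; [nra|]. apply Rmult_lt_0_compat; [nra|lra]. }
  intros a b HV. rewrite energy_split in HV. unfold energy_min in HV.
  pose proof (Rmin_l (xs * c1) (ys * e0 * c2)). pose proof (Rmin_r (xs * c1) (ys * e0 * c2)).
  pose proof (well_min a) as Hw. pose proof (gap_nonneg (b - a)) as Hg.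
  pose proof (exp_pos ((K + 1) * a)) as Hea.
  assert (Hyg : 0 <= ys * exp ((K + 1) * a) * gap (b - a)) by (apply Rmult_le_pos; [nra|lra]).
  assert (Ha : Rabs a <= eps).
  { assert (Hwa : well 1 a < well 1 0 + c1) by nra.
    assert (c1 <= well 1 eps - well 1 0) by apply Rmin_l.
    assert (c1 <= well 1 (- eps) - well 1 0) by apply Rmin_r.
    apply Rabs_le. split; apply Rnot_lt_le; intro Hl.
    - assert (well 1 (- eps) <= well 1 a) by (apply well_mono_neg; lra). lra.
    - assert (well 1 eps <= well 1 a) by (apply well_mono_pos; lra). lra. }
  split; [exact Ha|].
  assert (Hle : e0 <= exp ((K + 1) * a)).
  { apply exp_le_compat. apply Rabs_le_between in Ha. nra. }
  assert (Hgd : gap (b - a) < c2).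
  { apply Rnot_le_lt; intro Hl.
    assert (ys * e0 * c2 <= ys * exp ((K + 1) * a) * gap (b - a)).
    { apply Rmult_le_compat; nra. }
    nra. }
  assert (c2 <= gap eps) by apply Rmin_l. assert (c2 <= gap (- eps)) by apply Rmin_r.
  apply Rabs_le. split; apply Rnot_lt_le; intro Hl.
  - assert (gap (- eps) <= gap (b - a)) by (apply gap_mono_neg; lra). lra.
  - assert (gap eps <= gap (b - a)) by (apply gap_mono_pos; lra). lra.
Qed.

(** The nonnegative [gap] can be dropped, and [well] is nonpositive only up to its zero. *)
Lemma amplitude_bounded (th a b : R) :
  0 < th -> energy th a b <= 0 -> exp ((q - K) * a) <= (q + 1) / ((K + 1) * th).
Proof.
  intros Hth HV. rewrite energy_split in HV.
  pose proof (exp_pos ((K + 1) * a)) as He.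
  assert (0 <= ys * exp ((K + 1) * a) * gap (b - a)).
  { apply Rmult_le_pos; [nra|apply gap_nonneg]. }
  assert (Hw : well th a <= 0) by nra.
  unfold well in Hw.
  replace (exp ((q + 1) * a)) with (exp ((q - K) * a) * exp ((K + 1) * a)) in Hw
    by (rewrite <- exp_plus; f_equal; ring).
  assert (Hz : th * exp ((q - K) * a) / (q + 1) - / (K + 1) <= 0).
  { apply Rmult_le_reg_l with (exp ((K + 1) * a)); [exact He|].
    replace (exp ((K + 1) * a) * (th * exp ((q - K) * a) / (q + 1) - / (K + 1)))
      with (th * (exp ((q - K) * a) * exp ((K + 1) * a)) / (q + 1) - exp ((K + 1) * a) / (K + 1))
      by (field; lra). lra. }
  apply Rmult_le_reg_r with (th / (q + 1)); [apply Rdiv_lt_0_compat; lra|].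
  replace ((q + 1) / ((K + 1) * th) * (th / (q + 1))) with (/ (K + 1)) by (field; lra).
  replace (exp ((q - K) * a) * (th / (q + 1))) with (th * exp ((q - K) * a) / (q + 1)) by (field; lra).
  lra.
Qed.

End Energy.

(** * Convergence of autonomous regular orbits to the equilibrium *)

Section Autonomous.

Let phi (x : R) := exp ((q - K) * x) - 1.

(** The energy is not strictly dissipated where [a = b]; adding a small multiple of
    [- (b - a) * phi a] makes it a strict Lyapunov function on bounded sets. *)
Lemma strict_lyapunov (B : R) :
  0 <= B -> exists eta c, 0 < eta /\ 0 < c /\
  forall (D : R -> Prop) (a b : R -> R) (t : R),
    orbit (fun _ => 1) D a b -> D t ->
    Rabs (a t) <= B -> Rabs (b t - a t) <= B ->
    exists l, is_derive (fun t => energy 1 (a t) (b t) - eta * ((b t - a t) * phi (a t))) t l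
      /\ l <= - c * ((b t - a t) ^ 2 + phi (a t) ^ 2).
Proof.
  intros HB.
  set (C1 := xs / K * (exp ((q - K) * B) * (K * exp (K * B))) + ys * exp (1 * B)).
  set (C2 := (q - K) * exp ((q - K) * B) * (ys * exp (1 * B))).
  set (c0 := (xs - ys) * ys * (exp (- (K + 1) * B) * exp (- B) ^ 2)).
  pose proof (exp_pos ((q - K) * B)). pose proof (exp_pos (K * B)).
  pose proof (exp_pos (1 * B)). pose proof (exp_pos (- (K + 1) * B)).
  assert (0 < exp (- B) ^ 2) by (apply pow_lt, exp_pos).
  assert (HxK : 0 < xs / K) by (apply Rdiv_lt_0_compat; lra).
  assert (HC1 : 0 < C1).
  { unfold C1. apply Rplus_lt_0_compat; repeat first [assumption | apply Rmult_lt_0_compat]; lra. }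
  assert (HC2 : 0 < C2) by (unfold C2; repeat first [assumption | apply Rmult_lt_0_compat]; lra).
  assert (Hc0 : 0 < c0) by (unfold c0; repeat first [assumption | apply Rmult_lt_0_compat]; lra).
  set (C3 := C1 ^ 2 / (2 * (xs / K)) + C2).
  assert (HC3 : 0 < C3).
  { unfold C3. apply Rplus_lt_0_compat; [apply Rdiv_lt_0_compat; nra|lra]. }
  set (eta := c0 / (2 * C3)).
  assert (Heta : 0 < eta) by (apply Rdiv_lt_0_compat; lra).
  assert (Heta2 : eta * C3 = c0 / 2) by (unfold eta; field; lra).
  exists eta, (Rmin (c0 / 2) (eta * (xs / K) / 2)).
  split; [exact Heta|]. split; [apply Rmin_pos; [lra|] |].
  { assert (0 < eta * (xs / K)) by (apply Rmult_lt_0_compat; lra). lra. }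
  intros D a b t Ho Ht Ha Hd.
  pose proof (energy_derive _ _ weight_one D a b t Ho Ht) as HV.
  cbv beta in HV.
  destruct (Ho t Ht) as [Hda Hdb].
  set (d := b t - a t) in *. set (f := phi (a t)).
  eexists. split.
  - apply (is_derive_minus (fun t => energy 1 (a t) (b t))); [exact HV|].
    assert (Hder : is_derive (fun t => eta * ((b t - a t) * phi (a t))) t
      (eta * ((xs / K * (1 * exp (q * a t - K * b t) - 1) - ys * (1 - exp d)) * f
         + d * ((q - K) * exp ((q - K) * a t) * (ys * (1 - exp d)))))); [|exact Hder].
    unfold phi. auto_derive.
    + repeat split; first [eexists; exact Hda | eexists; exact Hdb].
    + rewrite_derive Hda. rewrite_derive Hdb. fold d. unfold f, phi. generalize (exp d); intros ed; unfold d; ring.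
  - unfold minus, plus, opp; simpl. rewrite Rmult_0_r.
    (* the dissipation is at least quadratic in d = b - a *)
    assert (Hdis : c0 * d ^ 2 <= (xs - ys) * ys * ((exp (a t) - exp (b t)) * (exp (K * a t) - exp (K * b t)))).
    { unfold c0. rewrite (Rmult_assoc ((xs - ys) * ys)).
      apply Rmult_le_compat_l; [nra|].
      replace (exp (b t)) with (exp (a t) * exp d) by (rewrite <- exp_plus; f_equal; unfold d; ring).
      replace (exp (K * b t)) with (exp (K * a t) * exp (K * d)) by (rewrite <- exp_plus; f_equal; unfold d; ring).
      replace ((exp (a t) - exp (a t) * exp d) * (exp (K * a t) - exp (K * a t) * exp (K * d)))
        with (exp ((K + 1) * a t) * ((exp d - 1) * (exp (K * d) - 1)))
        by (replace ((K + 1) * a t) with (a t + K * a t) by ring; rewrite exp_plus; ring).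
      pose proof (exp_minus_one_expansive B d Hd) as He1.
      pose proof (exp_comonotone_scaled K d HK) as He2.
      apply Rabs_le_between in Ha.
      assert (HE : exp (- (K + 1) * B) <= exp ((K + 1) * a t)) by (apply exp_le_compat; nra).
      rewrite Rmult_assoc. apply Rmult_le_compat; try lra.
      apply Rmult_le_pos; [lra|apply pow2_ge_0]. }
    (* the slope of d is xs / K * f up to O(d), and phi (a t) has slope O(d) *)
    set (r1 := xs / K * (1 * exp (q * a t - K * b t) - 1) - ys * (1 - exp d) - xs / K * f).
    set (r2 := (q - K) * exp ((q - K) * a t) * (ys * (1 - exp d))).
    assert (HeB : exp ((q - K) * a t) <= exp ((q - K) * B)).
    { apply Rabs_le_between in Ha. apply exp_le_compat; nra. }
    pose proof (exp_pos ((q - K) * a t)) as HeP.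
    assert (Hd1 : Rabs (1 - exp d) <= exp (1 * B) * Rabs d).
    { rewrite Rabs_minus_sym. replace d with (1 * d) at 1 by ring.
      pose proof (exp_minus_one_lipschitz 1 B d ltac:(lra) HB Hd). lra. }
    assert (HdK : Rabs (exp (- K * d) - 1) <= K * exp (K * B) * Rabs d).
    { replace (- K * d) with (K * - d) by ring. rewrite <- (Rabs_Ropp d).
      apply exp_minus_one_lipschitz; [lra|lra|rewrite Rabs_Ropp; exact Hd]. }
    pose proof (Rabs_pos d) as Hdp.
    assert (Hr1 : Rabs r1 <= C1 * Rabs d).
    { replace r1 with (xs / K * (exp ((q - K) * a t) * (exp (- K * d) - 1)) + - (ys * (1 - exp d))).
      - eapply Rle_trans; [apply Rabs_triang|]. rewrite Rabs_Ropp, !Rabs_mult.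
        rewrite (Rabs_pos_eq (xs / K)), (Rabs_pos_eq ys), (Rabs_pos_eq (exp ((q - K) * a t))) by lra.
        unfold C1. rewrite Rmult_plus_distr_r. apply Rplus_le_compat.
        + rewrite !Rmult_assoc. apply Rmult_le_compat_l; [lra|].
          apply Rmult_le_compat; [lra|apply Rabs_pos|lra|lra].
        + rewrite Rmult_assoc. apply Rmult_le_compat_l; lra.
      - unfold r1, f, phi.
        replace (q * a t - K * b t) with ((q - K) * a t + - K * d) by (unfold d; ring).
        rewrite exp_plus. ring. }
    assert (Hr2 : Rabs r2 <= C2 * Rabs d).
    { unfold r2, C2. rewrite !Rabs_mult.
      rewrite (Rabs_pos_eq (q - K)), (Rabs_pos_eq ys), (Rabs_pos_eq (exp ((q - K) * a t))) by lra.
      rewrite !Rmult_assoc. apply Rmult_le_compat_l; [lra|].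
      apply Rmult_le_compat; [lra| |lra|].
      - apply Rmult_le_pos; [lra|apply Rabs_pos].
      - apply Rmult_le_compat_l; lra. }
    replace (xs / K * (1 * exp (q * a t - K * b t) - 1) - ys * (1 - exp d)) with (r1 + xs / K * f)
      by (unfold r1; ring).
    set (g := xs / K) in *.
    assert (Hfr : - (f * r1) <= g / 2 * f ^ 2 + C1 ^ 2 / (2 * g) * d ^ 2).
    { apply Rle_trans with (Rabs f * (C1 * Rabs d)).
      - apply Rle_trans with (Rabs (f * r1)).
        + rewrite <- Rabs_Ropp. apply Rle_abs.
        + rewrite Rabs_mult. apply Rmult_le_compat_l; [apply Rabs_pos|exact Hr1].
      - rewrite <- (pow2_abs f), <- (pow2_abs d).
        apply Rmult_le_reg_l with (2 * g); [lra|].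
        replace (2 * g * (g / 2 * Rabs f ^ 2 + C1 ^ 2 / (2 * g) * Rabs d ^ 2))
          with ((g * Rabs f) ^ 2 + (C1 * Rabs d) ^ 2) by (field; lra).
        pose proof (pow2_ge_0 (g * Rabs f - C1 * Rabs d)). nra. }
    assert (Hdr : - (d * r2) <= C2 * d ^ 2).
    { apply Rle_trans with (Rabs (d * r2)).
      - rewrite <- Rabs_Ropp. apply Rle_abs.
      - rewrite Rabs_mult, <- (pow2_abs d).
        replace (C2 * Rabs d ^ 2) with (Rabs d * (C2 * Rabs d)) by ring.
        apply Rmult_le_compat_l; lra. }
    fold r2.
    set (diss := (xs - ys) * ys * ((exp (a t) - exp (b t)) * (exp (K * a t) - exp (K * b t)))) in *.
    pose proof (Rmin_l (c0 / 2) (eta * g / 2)) as Hm1.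
    pose proof (Rmin_r (c0 / 2) (eta * g / 2)) as Hm2.
    set (c := Rmin (c0 / 2) (eta * g / 2)) in *.
    unfold C3 in Heta2.
    pose proof (pow2_ge_0 d) as Hd2. pose proof (pow2_ge_0 f) as Hf2.
    replace (xs * 0 * exp ((q + 1) * a t) / (q + 1)) with 0 by (unfold Rdiv; ring).
    assert (E1 : eta * - (f * r1) <= eta * (g / 2 * f ^ 2 + C1 ^ 2 / (2 * g) * d ^ 2))
      by (apply Rmult_le_compat_l; lra).
    assert (E2 : eta * - (d * r2) <= eta * (C2 * d ^ 2)) by (apply Rmult_le_compat_l; lra).
    assert (E3 : eta * (C1 ^ 2 / (2 * g) + C2) * d ^ 2 = c0 / 2 * d ^ 2) by (rewrite Heta2; ring).
    assert (E4 : c * d ^ 2 <= c0 / 2 * d ^ 2) by (apply Rmult_le_compat_r; lra).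
    assert (E5 : c * f ^ 2 <= eta * g / 2 * f ^ 2) by (apply Rmult_le_compat_r; lra).
    set (CC := C1 ^ 2 / (2 * g)) in *.
    replace (- c * (d ^ 2 + f ^ 2)) with (- (c * d ^ 2) - c * f ^ 2) by ring.
    replace (0 - diss + - (eta * ((r1 + g * f) * f + d * r2)))
      with (- diss + eta * - (f * r1) + eta * - (d * r2) - eta * g * f ^ 2) by ring.
    lra.
Qed.

Variables a b : R -> R.
Hypothesis Horb : orbit (fun _ => 1) (fun _ => True) a b.
Hypothesis Hva : vanishing a.
Hypothesis Hvb : vanishing b.
Variable X0 : R.
Hypothesis HX0 : forall t, exp (q * a t - K * b t) <= X0.

(** Otherwise nothing is dissipated, which forces [a = b] at all times. *)
Lemma energy_negative_somewhere : exists s, energy 1 (a s) (b s) < 0.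
Proof.
  apply Classical_Prop.NNPP; intro Hno.
  assert (Hz : forall t, energy 1 (a t) (b t) = 0).
  { intros t. apply Rle_antisym.
    - apply (energy_nonpos _ _ weight_one _ a b t Horb Hva Hvb); trivial.
    - apply Rnot_lt_le; intro Hl. apply Hno. exists t; exact Hl. }
  assert (Hab : forall t, exp (b t - a t) = 1).
  { intros t.
    pose proof (energy_derive _ _ weight_one _ a b t Horb I) as HV.
    cbv beta in HV.
    apply (is_derive_ext _ (fun _ => 0)) in HV; [|exact Hz].
    apply is_derive_unique in HV. rewrite Derive_const in HV.
    assert (Hc : (exp (a t) - exp (b t)) * (exp (K * a t) - exp (K * b t)) = 0).
    { assert (0 < (xs - ys) * ys) by nra.
      replace (xs * 0 * exp ((q + 1) * a t) / (q + 1)) with 0 in HV by (unfold Rdiv; ring).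
      nra. }
    assert (a t = b t).
    { destruct (Rtotal_order (a t) (b t)) as [H|[H|H]]; [exfalso|exact H|exfalso].
      - pose proof (exp_increasing _ _ H).
        assert (exp (K * a t) < exp (K * b t)) by (apply exp_increasing; nra). nra.
      - pose proof (exp_increasing _ _ H).
        assert (exp (K * b t) < exp (K * a t)) by (apply exp_increasing; nra). nra. }
    replace (b t - a t) with 0 by lra. apply exp_0. }
  (* then a is constant, which contradicts its decay at -oo *)
  assert (Hcst : forall t, t <= 0 -> a t = a 0).
  { intros t Ht. apply Rle_antisym.
    - apply (nondecreasing_of_derive a _ t 0 Ht (fun x _ => proj1 (Horb x I))).
      intros x _. rewrite Hab. lra.
    - apply (nonincreasing_of_derive a _ t 0 Ht (fun x _ => proj1 (Horb x I))).
      intros x _. rewrite Hab. lra. }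
  pose proof (exp_pos (a 0)) as He.
  destruct (Hva (exp (a 0) / 2) ltac:(lra)) as [T HT].
  specialize (HT (Rmin T 0) (Rmin_l _ _)).
  rewrite (Hcst (Rmin T 0) (Rmin_r _ _)) in HT. lra.
Qed.

(** A negative energy keeps the amplitude away from [-oo], where [well] tends to 0;
    the other bounds come from [amplitude_bounded], [slope_bounded] and [HX0]. *)
Lemma eventually_bounded :
  exists B s0, 0 <= B /\ forall s, s0 <= s -> Rabs (a s) <= B /\ Rabs (b s - a s) <= B.
Proof.
  destruct energy_negative_somewhere as [s0 Hs0].
  set (v := - energy 1 (a s0) (b s0)).
  assert (Hv : 0 < v) by (unfold v; lra).
  pose proof (exp_pos (q * a 0 - K * b 0)) as HX. pose proof (HX0 0) as HX'.
  set (A := (q + 1) / (K + 1)). set (E := v * (K + 1) / xs).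
  assert (HA : 0 < A) by (apply Rdiv_lt_0_compat; lra).
  assert (HE : 0 < E) by (apply Rdiv_lt_0_compat; nra).
  set (Y := slope_bound).
  assert (HY : 0 < Y).
  { unfold Y, slope_bound. apply Rmult_lt_0_compat; [apply Rdiv_lt_0_compat; lra|].
    assert (0 < (xs - ys) / ((K + 1) * ys)) by (apply Rdiv_lt_0_compat; nra). lra. }
  set (B0 := Rabs (ln A) / (q - K) + Rabs (ln E) / (K + 1)).
  assert (HB1 : 0 <= Rabs (ln A) / (q - K)).
  { apply Rmult_le_pos; [apply Rabs_pos|left; apply Rinv_0_lt_compat; lra]. }
  assert (HB2 : 0 <= Rabs (ln E) / (K + 1)).
  { apply Rmult_le_pos; [apply Rabs_pos|left; apply Rinv_0_lt_compat; lra]. }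
  set (B1 := Rabs (ln Y) + Rabs (ln X0) + (q - K) * B0).
  assert (HB0 : 0 <= B0) by (unfold B0; lra).
  pose proof (Rabs_pos (ln Y)). pose proof (Rabs_pos (ln X0)).
  assert (HB1' : 0 <= B1) by (unfold B1; nra).
  exists (B0 + B1), s0. split; [lra|].
  intros s Hs.
  pose proof (energy_nonincreasing _ _ weight_one _ a b s0 s Horb Hs (fun _ _ => I)) as Hdec.
  cbv beta in Hdec.
  assert (HVs : energy 1 (a s) (b s) <= - v) by (unfold v; lra).
  assert (HVs0 : energy 1 (a s) (b s) <= 0) by lra.
  pose proof (amplitude_bounded 1 (a s) (b s) Rlt_0_1 HVs0) as Ham.
  rewrite Rmult_1_r in Ham. fold A in Ham.
  pose proof (slope_bounded 1 (a s) (b s) Rlt_0_1 HVs0) as Hsl.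
  fold Y in Hsl.
  assert (Hlow : E <= exp ((K + 1) * a s)).
  { rewrite energy_split in HVs by assumption.
    pose proof (exp_pos ((K + 1) * a s)). pose proof (exp_pos ((q + 1) * a s)).
    assert (0 <= ys * exp ((K + 1) * a s) * gap (b s - a s)).
    { apply Rmult_le_pos; [nra|apply gap_nonneg; assumption]. }
    assert (0 < 1 * exp ((q + 1) * a s) / (q + 1)) by (apply Rdiv_lt_0_compat; lra).
    assert (v <= xs * (exp ((K + 1) * a s) / (K + 1))) by (unfold well in HVs; nra).
    unfold E. apply Rmult_le_reg_r with (xs / (K + 1)); [apply Rdiv_lt_0_compat; lra|].
    replace (v * (K + 1) / xs * (xs / (K + 1))) with v by (field; lra). lra. }
  assert (La : (q - K) * a s <= ln A).
  { rewrite <- (ln_exp ((q - K) * a s)). apply ln_le; [apply exp_pos|exact Ham]. }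
  assert (Lb : ln E <= (K + 1) * a s).
  { rewrite <- (ln_exp ((K + 1) * a s)). apply ln_le; [exact HE|exact Hlow]. }
  assert (Lc : b s - a s <= ln Y).
  { rewrite <- (ln_exp (b s - a s)). apply ln_le; [apply exp_pos|exact Hsl]. }
  assert (Ld : q * a s - K * b s <= ln X0).
  { rewrite <- (ln_exp (q * a s - K * b s)). apply ln_le; [apply exp_pos|apply HX0]. }
  pose proof (Rle_abs (ln A)). pose proof (Rle_abs (- ln E)) as HlE. rewrite Rabs_Ropp in HlE.
  pose proof (Rle_abs (ln Y)). pose proof (Rle_abs (ln X0)).
  assert (Ha1 : a s <= Rabs (ln A) / (q - K)).
  { apply Rmult_le_reg_r with (q - K); [lra|]. unfold Rdiv.
    rewrite Rmult_assoc, Rinv_l, Rmult_1_r; lra. }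
  assert (Ha2 : - (Rabs (ln E) / (K + 1)) <= a s).
  { apply Rmult_le_reg_r with (K + 1); [lra|].
    replace (- (Rabs (ln E) / (K + 1)) * (K + 1)) with (- Rabs (ln E)) by (field; lra). lra. }
  assert (Ha : Rabs (a s) <= B0) by (unfold B0; apply Rabs_le; lra).
  split; [lra|]. apply Rabs_le_between in Ha.
  assert (Hd : - B1 <= b s - a s).
  { assert ((q - K) * a s - K * (b s - a s) <= ln X0) by lra.
    assert (- ((q - K) * B0) <= (q - K) * a s) by nra.
    assert (- B1 <= K * (b s - a s)) by (unfold B1; lra).
    destruct (Rle_dec 0 (b s - a s)); [lra|nra]. }
  assert (Hd2 : b s - a s <= B1) by (unfold B1; nra).
  apply Rabs_le; lra.
Qed.

(** The strict Lyapunov function would be unbounded below on the bounded orbit if the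
    orbit stayed away from the equilibrium. *)
Lemma energy_reaches_minimum (eta0 : R) :
  0 < eta0 -> exists s, energy 1 (a s) (b s) < energy_min + eta0.
Proof.
  intros He0.
  destruct eventually_bounded as [B [s0 [HB Hbox]]].
  destruct (strict_lyapunov B HB) as [eta [c [Heta [Hc Hlyap]]]].
  set (p := q - K). assert (Hp : 0 < p) by (unfold p; lra).
  set (c1 := xs * (exp ((q + 1) * B) + exp ((K + 1) * B)) * (exp (p * B) / p)).
  set (c2 := ys * exp ((K + 1) * B) * (K * exp ((K + 1) * B) + K * exp (K * B))).
  pose proof (exp_pos ((q + 1) * B)). pose proof (exp_pos ((K + 1) * B)).
  pose proof (exp_pos (K * B)). pose proof (exp_pos (p * B)).
  assert (HpB : 0 < exp (p * B) / p) by (apply Rdiv_lt_0_compat; lra).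
  assert (Hc1 : 0 < c1) by (unfold c1; repeat first [assumption | apply Rmult_lt_0_compat]; lra).
  assert (Hc2 : 0 < c2) by (unfold c2; repeat first [assumption | apply Rmult_lt_0_compat]; nra).
  assert (Hexc : forall s, s0 <= s ->
    energy 1 (a s) (b s) - energy_min <= c1 * Rabs (phi (a s)) + c2 * Rabs (b s - a s)).
  { intros s Hs. destruct (Hbox s Hs) as [Ha Hd].
    rewrite energy_split by assumption. unfold energy_min.
    set (d := b s - a s) in *. set (x := a s) in *.
    assert (Hphi : Rabs x <= exp (p * B) / p * Rabs (phi x)).
    { apply Rmult_le_reg_l with (p * exp (- (p * B))).
      { apply Rmult_lt_0_compat; [lra|apply exp_pos]. }
      replace (p * exp (- (p * B)) * (exp (p * B) / p * Rabs (phi x)))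
        with (exp (- (p * B)) * exp (p * B) * Rabs (phi x)) by (field; lra).
      rewrite <- exp_plus, Rplus_opp_l, exp_0, Rmult_1_l.
      apply Rsqr_incr_0_var; [|apply Rabs_pos].
      rewrite !Rsqr_pow2, Rpow_mult_distr, !pow2_abs.
      assert (Hpx : Rabs (p * x) <= p * B).
      { rewrite Rabs_mult, Rabs_pos_eq by lra. apply Rmult_le_compat_l; lra. }
      pose proof (exp_minus_one_expansive (p * B) (p * x) Hpx) as Hex.
      unfold phi. fold p. rewrite Rpow_mult_distr in *. lra. }
    assert (Hw : well 1 x - well 1 0 <= (exp ((q + 1) * B) + exp ((K + 1) * B)) * Rabs x).
    { pose proof (exp_minus_one_lipschitz (q + 1) B x ltac:(lra) HB Ha) as L1.
      pose proof (exp_minus_one_lipschitz (K + 1) B x ltac:(lra) HB Ha) as L2.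
      unfold well. rewrite !Rmult_0_r, exp_0.
      replace (1 * exp ((q + 1) * x) / (q + 1) - exp ((K + 1) * x) / (K + 1) - (1 * 1 / (q + 1) - 1 / (K + 1)))
        with ((exp ((q + 1) * x) - 1) / (q + 1) + - (exp ((K + 1) * x) - 1) / (K + 1)) by (field; lra).
      rewrite (Rmult_plus_distr_r (exp ((q + 1) * B))). apply Rplus_le_compat.
      - apply Rmult_le_reg_r with (q + 1); [lra|].
        pose proof (Rle_abs (exp ((q + 1) * x) - 1)).
        unfold Rdiv. rewrite Rmult_assoc, Rinv_l; lra.
      - apply Rmult_le_reg_r with (K + 1); [lra|].
        pose proof (Rle_abs (- (exp ((K + 1) * x) - 1))) as L3. rewrite Rabs_Ropp in L3.
        unfold Rdiv. rewrite Rmult_assoc, Rinv_l; lra. }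
    assert (Hg : gap d <= (K * exp ((K + 1) * B) + K * exp (K * B)) * Rabs d).
    { pose proof (exp_minus_one_lipschitz (K + 1) B d ltac:(lra) HB Hd) as L1.
      pose proof (exp_minus_one_lipschitz K B d ltac:(lra) HB Hd) as L2.
      unfold gap.
      replace ((K * exp ((K + 1) * d) + 1) / (K + 1) - exp (K * d))
        with (K * (exp ((K + 1) * d) - 1) / (K + 1) + - (exp (K * d) - 1)) by (field; lra).
      rewrite (Rmult_plus_distr_r (K * exp ((K + 1) * B))). apply Rplus_le_compat.
      - apply Rmult_le_reg_r with (K + 1); [lra|].
        pose proof (Rle_abs (exp ((K + 1) * d) - 1)).
        unfold Rdiv. rewrite Rmult_assoc, Rinv_l, Rmult_1_r by lra. nra.
      - pose proof (Rle_abs (- (exp (K * d) - 1))) as L3. rewrite Rabs_Ropp in L3. lra. }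
    assert (Hex : exp ((K + 1) * x) <= exp ((K + 1) * B)).
    { apply Rabs_le_between in Ha. apply exp_le_compat. nra. }
    pose proof (exp_pos ((K + 1) * x)). pose proof (gap_nonneg d) as Hg0.
    pose proof (Rabs_pos x). pose proof (Rabs_pos d). pose proof (Rabs_pos (phi x)).
    assert (P1 : xs * (well 1 x - well 1 0) <= c1 * Rabs (phi x)).
    { unfold c1. rewrite !Rmult_assoc. apply Rmult_le_compat_l; [lra|].
      eapply Rle_trans; [exact Hw|]. apply Rmult_le_compat_l; [lra|exact Hphi]. }
    assert (P2 : ys * exp ((K + 1) * x) * gap d <= c2 * Rabs d).
    { unfold c2. rewrite !Rmult_assoc. apply Rmult_le_compat_l; [lra|].
      apply Rmult_le_compat; lra. }
    lra. }
  apply Classical_Prop.NNPP; intro Hno.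
  set (e := eta0 / (c1 + c2)).
  assert (He : 0 < e) by (apply Rdiv_lt_0_compat; lra).
  assert (Haway : forall s, s0 <= s -> e ^ 2 / 4 <= (b s - a s) ^ 2 + phi (a s) ^ 2).
  { intros s Hs. apply Rnot_lt_le; intro Hl.
    rewrite <- (pow2_abs (b s - a s)), <- (pow2_abs (phi (a s))) in Hl.
    pose proof (Rabs_pos (b s - a s)). pose proof (Rabs_pos (phi (a s))).
    assert (Rabs (b s - a s) < e / 2) by nra. assert (Rabs (phi (a s)) < e / 2) by nra.
    apply Hno. exists s. specialize (Hexc s Hs).
    assert (c1 * Rabs (phi (a s)) + c2 * Rabs (b s - a s) <= (c1 + c2) * e / 2) by nra.
    replace ((c1 + c2) * e / 2) with (eta0 / 2) in * by (unfold e; field; lra). lra. }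
  set (L := fun t => energy 1 (a t) (b t) - eta * ((b t - a t) * phi (a t))).
  set (m := energy_min - eta * (B * (exp (p * B) + 1))).
  assert (Hlow : forall s, s0 <= s -> m <= L s).
  { intros s Hs. destruct (Hbox s Hs) as [Ha Hd]. unfold L, m.
    assert (energy_min <= energy 1 (a s) (b s)).
    { apply Rnot_lt_le; intro Hl. apply Hno. exists s. lra. }
    assert (Hf : Rabs (phi (a s)) <= exp (p * B) + 1).
    { unfold phi. fold p. apply Rabs_le_between in Ha.
      assert (exp (p * a s) <= exp (p * B)) by (apply exp_le_compat; nra).
      pose proof (exp_pos (p * a s)). apply Rabs_le; lra. }
    assert (Hdf : (b s - a s) * phi (a s) <= B * (exp (p * B) + 1)).
    { eapply Rle_trans; [apply Rle_abs|]. rewrite Rabs_mult.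
      apply Rmult_le_compat; try apply Rabs_pos; assumption. }
    nra. }
  set (rate := c * (e ^ 2 / 4)).
  assert (Hrate : 0 < rate) by (unfold rate; apply Rmult_lt_0_compat; [lra|nra]).
  assert (Hdec : forall s, s0 <= s -> L s <= L s0 - rate * (s - s0)).
  { intros s Hs.
    assert (Hd : forall x, s0 <= x <= s -> exists l, is_derive L x l /\ l <= - rate).
    { intros x Hx. destruct (Hbox x (proj1 Hx)) as [Ha Hd].
      destruct (Hlyap _ a b x Horb I Ha Hd) as [l [Hl1 Hl2]].
      exists l. split; [exact Hl1|]. pose proof (Haway x (proj1 Hx)). unfold rate.
      assert (c * (e ^ 2 / 4) <= c * ((b x - a x) ^ 2 + phi (a x) ^ 2)) by (apply Rmult_le_compat_l; lra).
      lra. }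
    assert (Hd' : forall x, s0 <= x <= s -> is_derive (fun x => L x + rate * (x - s0)) x (Derive L x + rate)).
    { intros x Hx. destruct (Hd x Hx) as [l [Hl1 _]].
      apply (is_derive_plus (V := R_NormedModule) L).
      - rewrite (is_derive_unique _ _ _ Hl1). exact Hl1.
      - auto_derive; [trivial|ring]. }
    assert (H9 : L s + rate * (s - s0) <= L s0 + rate * (s0 - s0)); [|lra].
    apply (nonincreasing_of_derive (fun x => L x + rate * (x - s0)) _ s0 s Hs Hd').
    intros x Hx. destruct (Hd x Hx) as [l [Hl1 Hl2]].
    rewrite (is_derive_unique _ _ _ Hl1). lra. }
  set (s := s0 + (Rabs (L s0 - m) + 1) / rate).
  assert (Hs : s0 <= s).
  { unfold s. pose proof (Rabs_pos (L s0 - m)).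
    assert (0 < (Rabs (L s0 - m) + 1) / rate) by (apply Rdiv_lt_0_compat; lra). lra. }
  specialize (Hdec s Hs). specialize (Hlow s Hs).
  replace (rate * (s - s0)) with (Rabs (L s0 - m) + 1) in Hdec by (unfold s; field; lra).
  pose proof (Rle_abs (L s0 - m)). lra.
Qed.

End Autonomous.

(** * Differences of orbits *)

Hypothesis Hspiral : (xs - ys) ^ 2 < 4 * xs * ys * (q - K) / K.

(** With [A] the linearisation at the equilibrium this is [det (D, A D)] for the
    vector [D = (al, be)]. By the Cayley-Hamilton theorem its derivative along
    [D' = A D] is [tr A] times itself, and it is definite exactly when the eigenvalues
    are not real. *)
Definition quad (al be : R) : R :=
  q * xs / K * al ^ 2 - (xs + ys) * (al * be) + ys * be ^ 2.

Lemma quad_definite :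
  exists c, 0 < c /\ forall al be, c * (al ^ 2 + be ^ 2) <= quad al be.
Proof.
  set (A := q * xs / K).
  assert (HA : 0 < A) by (unfold A; apply Rdiv_lt_0_compat; nra).
  assert (Hdisc : 0 < A * ys - (xs + ys) ^ 2 / 4).
  { unfold A.
    replace (q * xs / K * ys) with (xs * ys * (q - K) / K + xs * ys) by (field; lra).
    replace (4 * xs * ys * (q - K) / K) with (4 * (xs * ys * (q - K) / K)) in Hspiral by (field; lra).
    nra. }
  set (c := (A * ys - (xs + ys) ^ 2 / 4) / (A + ys)).
  assert (Hc : 0 < c) by (apply Rdiv_lt_0_compat; lra).
  assert (Hc1 : c * (A + ys) = A * ys - (xs + ys) ^ 2 / 4) by (unfold c; field; lra).
  assert (HcA : 0 < A - c) by nra.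
  exists c. split; [exact Hc|]. intros al be. unfold quad. fold A.
  apply Rminus_le_0.
  apply Rmult_le_reg_l with (A - c); [exact HcA|].
  replace ((A - c) * (A * al ^ 2 - (xs + ys) * (al * be) + ys * be ^ 2 - c * (al ^ 2 + be ^ 2)))
    with (((A - c) * al - (xs + ys) / 2 * be) ^ 2
          + (A * ys - c * (A + ys) + c ^ 2 - (xs + ys) ^ 2 / 4) * be ^ 2) by field.
  rewrite Hc1, Rmult_0_r.
  pose proof (pow2_ge_0 ((A - c) * al - (xs + ys) / 2 * be)).
  pose proof (pow2_ge_0 be). pose proof (pow2_ge_0 c). nra.
Qed.

Lemma quad_controls_norm :
  exists c, 0 < c /\ forall al be, (Rabs al + Rabs be) ^ 2 <= c * quad al be.
Proof.
  destruct quad_definite as [c [Hc H]].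
  exists (2 / c). split; [apply Rdiv_lt_0_compat; lra|].
  intros al be. specialize (H al be).
  apply Rmult_le_reg_l with c; [exact Hc|].
  replace (c * (2 / c * quad al be)) with (2 * quad al be) by (field; lra).
  rewrite <- (pow2_abs al), <- (pow2_abs be) in H.
  pose proof (pow2_ge_0 (Rabs al - Rabs be)). nra.
Qed.

Lemma quad_nonneg (al be : R) : 0 <= quad al be.
Proof.
  destruct quad_definite as [c [Hc H]]. specialize (H al be).
  pose proof (pow2_ge_0 al). pose proof (pow2_ge_0 be). nra.
Qed.

Lemma quad_slope (a1 b1 a2 b2 : R -> R) (t la lb : R) :
  is_derive (fun t => a1 t - a2 t) t la -> is_derive (fun t => b1 t - b2 t) t lb ->
  is_derive (fun t => quad (a1 t - a2 t) (b1 t - b2 t)) t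
    ((2 * (q * xs / K) * (a1 t - a2 t) - (xs + ys) * (b1 t - b2 t)) * la
     + (2 * ys * (b1 t - b2 t) - (xs + ys) * (a1 t - a2 t)) * lb).
Proof.
  intros Ha Hb.
  set (al := fun t => a1 t - a2 t). set (be := fun t => b1 t - b2 t).
  change (is_derive al t la) in Ha. change (is_derive be t lb) in Hb.
  change (is_derive (fun t => quad (al t) (be t)) t
    ((2 * (q * xs / K) * al t - (xs + ys) * be t) * la
     + (2 * ys * be t - (xs + ys) * al t) * lb)).
  clearbody al be. unfold quad. auto_derive.
  - repeat split; first [eexists; exact Ha | eexists; exact Hb].
  - rewrite_derive Ha. rewrite_derive Hb. ring.
Qed.

Section Pair.

Variables (Th : R -> R) (D : R -> Prop) (a1 b1 a2 b2 : R -> R).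
Hypothesis HTh : forall t, 0 < Th t <= 1.
Hypothesis Ho1 : orbit Th D a1 b1.
Hypothesis Ho2 : orbit Th D a2 b2.

Lemma difference_slopes (t : R) : D t ->
  is_derive (fun t => a1 t - a2 t) t (- ys * (exp (b1 t - a1 t) - exp (b2 t - a2 t))) /\
  is_derive (fun t => b1 t - b2 t) t
    (xs / K * (Th t * (exp (q * a1 t - K * b1 t) - exp (q * a2 t - K * b2 t)))).
Proof.
  intros Ht. destruct (Ho1 t Ht) as [Ha1 Hb1]. destruct (Ho2 t Ht) as [Ha2 Hb2].
  split.
  - replace (- ys * (exp (b1 t - a1 t) - exp (b2 t - a2 t)))
      with (ys * (1 - exp (b1 t - a1 t)) - ys * (1 - exp (b2 t - a2 t))) by ring.
    apply (is_derive_minus (V := R_NormedModule) a1 a2); assumption.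
  - replace (xs / K * (Th t * (exp (q * a1 t - K * b1 t) - exp (q * a2 t - K * b2 t))))
      with (xs / K * (Th t * exp (q * a1 t - K * b1 t) - 1)
            - xs / K * (Th t * exp (q * a2 t - K * b2 t) - 1)) by ring.
    apply (is_derive_minus (V := R_NormedModule) b1 b2); assumption.
Qed.

End Pair.

Lemma xK_pos : 0 < xs / K.
Proof. apply Rdiv_lt_0_compat; lra. Qed.

Lemma linear_form_bound (A B al be : R) :
  0 <= A -> 0 <= B -> Rabs (A * al - B * be) <= (A + B) * (Rabs al + Rabs be).
Proof.
  intros HA HB. eapply Rle_trans; [apply (Rabs_triang (A * al) (- (B * be)))|].
  rewrite Rabs_Ropp, !Rabs_mult, (Rabs_pos_eq A), (Rabs_pos_eq B) by assumption.
  pose proof (Rabs_pos al). pose proof (Rabs_pos be). nra.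
Qed.

(** Near the equilibrium the difference of two orbits follows the linearisation up to
    a small relative error, so [quad] decays at almost the rate [- tr A = xs - ys]. *)
Lemma quad_slope_near (nu : R) :
  0 < nu -> exists eps, 0 < eps /\
  forall (Th : R -> R) (D : R -> Prop) (a1 b1 a2 b2 : R -> R) (t : R),
    (forall t, 0 < Th t <= 1) ->
    orbit Th D a1 b1 -> orbit Th D a2 b2 -> D t ->
    1 - Th t <= eps ->
    Rabs (a1 t) <= eps -> Rabs (b1 t - a1 t) <= eps ->
    Rabs (a2 t) <= eps -> Rabs (b2 t - a2 t) <= eps ->
    exists l, is_derive (fun t => quad (a1 t - a2 t) (b1 t - b2 t)) t l /\
      Rabs (l + (xs - ys) * quad (a1 t - a2 t) (b1 t - b2 t))
        <= nu * quad (a1 t - a2 t) (b1 t - b2 t).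
Proof.
  intros Hnu. destruct quad_controls_norm as [c [Hc Hnorm]].
  pose proof xK_pos as HxK.
  set (A := q * xs / K). assert (HA : 0 < A) by (unfold A; apply Rdiv_lt_0_compat; nra).
  pose proof (exp_pos 1). pose proof (exp_pos q).
  set (D0 := (2 * A + (xs + ys)) * ys * exp 1
     + (2 * ys + (xs + ys)) * (xs / K) * (q * exp q * q + exp q * q)).
  assert (HD0 : 0 < D0).
  { unfold D0. apply Rplus_lt_0_compat; repeat first [assumption | apply Rmult_lt_0_compat]; nra. }
  set (eps := Rmin 1 (nu / (D0 * c))).
  assert (Heps : 0 < eps).
  { apply Rmin_pos; [lra|]. apply Rdiv_lt_0_compat; [lra|]. apply Rmult_lt_0_compat; lra. }
  assert (Heps1 : eps <= 1) by apply Rmin_l.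
  assert (Heps2 : eps * D0 * c <= nu).
  { rewrite Rmult_assoc. apply Rle_trans with (nu / (D0 * c) * (D0 * c)).
    - apply Rmult_le_compat_r; [|apply Rmin_r]. left. apply Rmult_lt_0_compat; lra.
    - right. field. split; lra. }
  exists eps. split; [exact Heps|].
  intros Th D a1 b1 a2 b2 t HTh Ho1 Ho2 Ht Hth Ha1 Hd1 Ha2 Hd2.
  destruct (difference_slopes Th D a1 b1 a2 b2 Ho1 Ho2 t Ht) as [Hal Hbe].
  pose proof (quad_slope _ _ _ _ _ _ _ Hal Hbe) as HQ.
  eexists. split; [exact HQ|].
  destruct (HTh t) as [Hth0 Hth1].
  set (al := a1 t - a2 t). set (be := b1 t - b2 t).
  set (d1 := b1 t - a1 t) in *. set (d2 := b2 t - a2 t) in *.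
  set (w1 := q * a1 t - K * b1 t). set (w2 := q * a2 t - K * b2 t).
  set (s := Rabs al + Rabs be).
  assert (Hs : 0 <= s) by (unfold s; pose proof (Rabs_pos al); pose proof (Rabs_pos be); lra).
  assert (Hw1 : Rabs w1 <= q * eps).
  { replace w1 with ((q - K) * a1 t - K * d1) by (unfold w1, d1; ring).
    apply Rabs_le_between in Ha1. apply Rabs_le_between in Hd1.
    apply Rabs_le. split; nra. }
  assert (Hw2 : Rabs w2 <= q * eps).
  { replace w2 with ((q - K) * a2 t - K * d2) by (unfold w2, d2; ring).
    apply Rabs_le_between in Ha2. apply Rabs_le_between in Hd2.
    apply Rabs_le. split; nra. }
  assert (Hdd : Rabs (d1 - d2) <= s).
  { replace (d1 - d2) with (be - al) by (unfold d1, d2, al, be; ring).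
    unfold s. eapply Rle_trans; [apply (Rabs_triang be (- al))|]. rewrite Rabs_Ropp. lra. }
  assert (Hww : Rabs (w1 - w2) <= q * s).
  { replace (w1 - w2) with (q * al - K * be) by (unfold w1, w2, al, be; ring).
    unfold s. eapply Rle_trans; [apply (Rabs_triang (q * al) (- (K * be)))|].
    rewrite Rabs_Ropp, !Rabs_mult, (Rabs_pos_eq q), (Rabs_pos_eq K) by lra.
    pose proof (Rabs_pos be). nra. }
  assert (HE1 : exp eps - 1 <= eps * exp 1).
  { eapply Rle_trans; [apply exp_minus_one_le|]. apply Rmult_le_compat_l; [lra|].
    apply exp_le_compat; lra. }
  assert (HEq : exp (q * eps) <= exp q) by (apply exp_le_compat; nra).
  assert (HE2 : exp (q * eps) - 1 <= eps * (q * exp q)).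
  { eapply Rle_trans; [apply exp_minus_one_le|].
    replace (eps * (q * exp q)) with (q * eps * exp q) by ring.
    apply Rmult_le_compat_l; [nra|lra]. }
  set (e := exp d1 - exp d2 - (d1 - d2)).
  set (f := Th t * (exp w1 - exp w2) - (w1 - w2)).
  assert (He : Rabs e <= eps * exp 1 * s).
  { eapply Rle_trans; [apply (exp_diff_near_zero d1 d2 eps Hd1 Hd2)|].
    apply Rmult_le_compat; try apply Rabs_pos; try lra.
    assert (1 <= exp eps) by (rewrite <- exp_0; apply exp_le_compat; lra). lra. }
  assert (Hf : Rabs f <= eps * (q * exp q * q + exp q * q) * s).
  { replace f with ((exp w1 - exp w2 - (w1 - w2)) + - ((1 - Th t) * (exp w1 - exp w2)))
      by (unfold f; ring).
    eapply Rle_trans; [apply Rabs_triang|].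
    replace (eps * (q * exp q * q + exp q * q) * s)
      with (eps * (q * exp q) * (q * s) + eps * (exp q * (q * s))) by ring.
    apply Rplus_le_compat.
    - eapply Rle_trans; [apply (exp_diff_near_zero w1 w2 (q * eps) Hw1 Hw2)|].
      apply Rmult_le_compat; try apply Rabs_pos; try lra.
      assert (1 <= exp (q * eps)) by (rewrite <- exp_0; apply exp_le_compat; nra). lra.
    - rewrite Rabs_Ropp, Rabs_mult, (Rabs_pos_eq (1 - Th t)) by lra.
      apply Rmult_le_compat; try apply Rabs_pos; try lra.
      apply Rle_trans with (exp q * Rabs (w1 - w2)).
      + apply exp_diff_bound; apply Rle_trans with (exp (q * eps)); auto;
          apply exp_le_compat; apply Rle_trans with (1 := Rle_abs _); assumption.
      + apply Rmult_le_compat_l; lra. }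
  match goal with |- Rabs (?L + _) <= _ => replace (L + (xs - ys) * quad al be)
    with (- (ys * ((2 * A * al - (xs + ys) * be) * e)) + xs / K * ((2 * ys * be - (xs + ys) * al) * f)) end.
  2:{ unfold e, f, quad, A. unfold w1, w2, d1, d2, al, be. field. lra. }
  eapply Rle_trans; [apply Rabs_triang|]. rewrite Rabs_Ropp, !Rabs_mult.
  rewrite (Rabs_pos_eq ys), (Rabs_pos_eq (xs / K)) by lra.
  pose proof (linear_form_bound (2 * A) (xs + ys) al be ltac:(lra) ltac:(lra)) as HL1.
  pose proof (linear_form_bound (2 * ys) (xs + ys) be al ltac:(lra) ltac:(lra)) as HL2.
  fold s in HL1. rewrite (Rplus_comm (Rabs be)) in HL2. fold s in HL2.
  apply Rle_trans with (eps * D0 * s ^ 2).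
  - unfold D0.
    replace (eps * ((2 * A + (xs + ys)) * ys * exp 1 +
       (2 * ys + (xs + ys)) * (xs / K) * (q * exp q * q + exp q * q)) * s ^ 2)
      with (ys * ((2 * A + (xs + ys)) * s * (eps * exp 1 * s))
        + xs / K * ((2 * ys + (xs + ys)) * s * (eps * (q * exp q * q + exp q * q) * s))) by ring.
    apply Rplus_le_compat; apply Rmult_le_compat_l; try lra;
      apply Rmult_le_compat; try apply Rabs_pos; assumption.
  - apply Rle_trans with (eps * D0 * (c * quad al be)).
    + apply Rmult_le_compat_l; [nra|apply Hnorm].
    + rewrite <- Rmult_assoc. apply Rmult_le_compat_r; [apply quad_nonneg|exact Heps2].
Qed.

(** Some two-sided exponential rate holds everywhere. It suffices for the bounded time
    spent away from the equilibrium and for backward uniqueness. *)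
Lemma quad_slope_bounded (X Y : R) :
  exists C, 0 < C /\
  forall (Th : R -> R) (D : R -> Prop) (a1 b1 a2 b2 : R -> R) (t : R),
    (forall t, 0 < Th t <= 1) ->
    orbit Th D a1 b1 -> orbit Th D a2 b2 -> D t ->
    Th t * exp (q * a1 t - K * b1 t) <= X -> Th t * exp (q * a2 t - K * b2 t) <= X ->
    exp (b1 t - a1 t) <= Y -> exp (b2 t - a2 t) <= Y ->
    exists l, is_derive (fun t => quad (a1 t - a2 t) (b1 t - b2 t)) t l /\
      Rabs l <= C * quad (a1 t - a2 t) (b1 t - b2 t).
Proof.
  destruct quad_controls_norm as [c [Hc Hnorm]].
  pose proof xK_pos as HxK.
  set (A := q * xs / K). assert (HA : 0 < A) by (unfold A; apply Rdiv_lt_0_compat; nra).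
  set (D0 := (2 * A + (xs + ys)) * (ys * Rabs Y) + (2 * ys + (xs + ys)) * (xs / K * (Rabs X * q))).
  pose proof (Rabs_pos X) as HX. pose proof (Rabs_pos Y) as HY.
  assert (HD0 : 0 <= D0).
  { unfold D0. apply Rplus_le_le_0_compat; repeat first [lra | apply Rmult_le_pos]. }
  exists (D0 * c + 1). split; [nra|].
  intros Th D a1 b1 a2 b2 t HTh Ho1 Ho2 Ht HX1 HX2 HY1 HY2.
  destruct (difference_slopes Th D a1 b1 a2 b2 Ho1 Ho2 t Ht) as [Hal Hbe].
  pose proof (quad_slope _ _ _ _ _ _ _ Hal Hbe) as HQ.
  eexists. split; [exact HQ|].
  destruct (HTh t) as [Hth0 Hth1].
  set (al := a1 t - a2 t). set (be := b1 t - b2 t).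
  set (d1 := b1 t - a1 t) in *. set (d2 := b2 t - a2 t) in *.
  set (w1 := q * a1 t - K * b1 t) in *. set (w2 := q * a2 t - K * b2 t) in *.
  set (s := Rabs al + Rabs be).
  assert (Hs : 0 <= s) by (unfold s; pose proof (Rabs_pos al); pose proof (Rabs_pos be); lra).
  assert (Hdd : Rabs (d1 - d2) <= s).
  { replace (d1 - d2) with (be - al) by (unfold d1, d2, al, be; ring).
    unfold s. eapply Rle_trans; [apply (Rabs_triang be (- al))|]. rewrite Rabs_Ropp. lra. }
  assert (Hww : Rabs (w1 - w2) <= q * s).
  { replace (w1 - w2) with (q * al - K * be) by (unfold w1, w2, al, be; ring).
    unfold s. eapply Rle_trans; [apply (Rabs_triang (q * al) (- (K * be)))|].
    rewrite Rabs_Ropp, !Rabs_mult, (Rabs_pos_eq q), (Rabs_pos_eq K) by lra.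
    pose proof (Rabs_pos be). nra. }
  set (e := exp d1 - exp d2). set (f := Th t * (exp w1 - exp w2)).
  assert (He : Rabs e <= Rabs Y * s).
  { eapply Rle_trans; [apply (exp_diff_bound d1 d2 (Rabs Y))|].
    - eapply Rle_trans; [exact HY1|apply Rle_abs].
    - eapply Rle_trans; [exact HY2|apply Rle_abs].
    - apply Rmult_le_compat_l; lra. }
  assert (Hf : Rabs f <= Rabs X * q * s).
  { unfold f. rewrite Rabs_mult, (Rabs_pos_eq (Th t)) by lra.
    assert (Hb : Rabs (exp w1 - exp w2) <= Rabs X / Th t * Rabs (w1 - w2)).
    { apply exp_diff_bound; apply Rmult_le_reg_l with (Th t); try lra;
      (replace (Th t * (Rabs X / Th t)) with (Rabs X) by (field; lra));
      (eapply Rle_trans; [|apply Rle_abs]); assumption. }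
    apply Rle_trans with (Th t * (Rabs X / Th t * Rabs (w1 - w2))).
    - apply Rmult_le_compat_l; lra.
    - replace (Th t * (Rabs X / Th t * Rabs (w1 - w2))) with (Rabs X * Rabs (w1 - w2)) by (field; lra).
      rewrite Rmult_assoc. apply Rmult_le_compat_l; lra. }
  pose proof (linear_form_bound (2 * A) (xs + ys) al be ltac:(lra) ltac:(lra)) as HL1.
  pose proof (linear_form_bound (2 * ys) (xs + ys) be al ltac:(lra) ltac:(lra)) as HL2.
  fold s in HL1. rewrite (Rplus_comm (Rabs be)) in HL2. fold s in HL2.
  apply Rle_trans with (D0 * s ^ 2).
  - fold A. eapply Rle_trans; [apply Rabs_triang|]. rewrite !Rabs_mult.
    rewrite (Rabs_Ropp ys), (Rabs_pos_eq ys), (Rabs_pos_eq (xs / K)) by lra.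
    unfold D0.
    replace (((2 * A + (xs + ys)) * (ys * Rabs Y) + (2 * ys + (xs + ys)) * (xs / K * (Rabs X * q))) * s ^ 2)
      with ((2 * A + (xs + ys)) * s * (ys * (Rabs Y * s))
            + (2 * ys + (xs + ys)) * s * (xs / K * (Rabs X * q * s))) by ring.
    assert (0 <= ys * Rabs e) by (apply Rmult_le_pos; [lra|apply Rabs_pos]).
    assert (0 <= xs / K * Rabs f) by (apply Rmult_le_pos; [lra|apply Rabs_pos]).
    apply Rplus_le_compat; apply Rmult_le_compat; try apply Rabs_pos; try assumption.
    + apply Rmult_le_compat_l; lra.
    + apply Rmult_le_compat_l; lra.
  - apply Rle_trans with (D0 * (c * quad al be)).
    + apply Rmult_le_compat_l; [exact HD0|apply Hnorm].
    + pose proof (quad_nonneg al be). lra.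
Qed.

Definition wedge (x1 y1 x2 y2 : R) : R := x1 * y2 - x2 * y1.

(** By Liouville's formula the determinant of two solutions of the system linearised
    along the third orbit becomes constant when it is divided by the exponential of the
    integrated trace. Up to a constant, the reciprocal of that exponential is
    [exp ((xs - ys) t + a3 + K b3)], so that only cubic terms remain here. *)
Lemma wedge_slope (X Y : R) :
  exists C, 0 < C /\
  forall (Th : R -> R) (D : R -> Prop) (a1 b1 a2 b2 a3 b3 : R -> R) (t : R),
    (forall t, 0 < Th t <= 1) ->
    orbit Th D a1 b1 -> orbit Th D a2 b2 -> orbit Th D a3 b3 -> D t ->
    Th t * exp (q * a1 t - K * b1 t) <= X -> Th t * exp (q * a2 t - K * b2 t) <= X ->
    Th t * exp (q * a3 t - K * b3 t) <= X ->
    exp (b1 t - a1 t) <= Y -> exp (b2 t - a2 t) <= Y -> exp (b3 t - a3 t) <= Y ->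
    exists l,
      is_derive (fun t => wedge (a1 t - a3 t) (b1 t - b3 t) (a2 t - a3 t) (b2 t - b3 t)
                          * exp ((xs - ys) * t + a3 t + K * b3 t)) t l /\
      (forall s, Rabs (a1 t - a3 t) + Rabs (b1 t - b3 t) <= s ->
                 Rabs (a2 t - a3 t) + Rabs (b2 t - b3 t) <= s ->
                 Rabs l <= C * exp ((xs - ys) * t + a3 t + K * b3 t) * s ^ 3).
Proof.
  pose proof xK_pos as HxK.
  pose proof (Rabs_pos X) as HX. pose proof (Rabs_pos Y) as HY.
  set (C0 := 2 * (ys * Rabs Y) + 2 * (xs / K * (Rabs X * q ^ 2))).
  assert (HC0 : 0 <= C0).
  { unfold C0. assert (0 <= ys * Rabs Y) by (apply Rmult_le_pos; lra).
    assert (0 <= xs / K * (Rabs X * q ^ 2)).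
    { apply Rmult_le_pos; [lra|]. apply Rmult_le_pos; [lra|nra]. }
    lra. }
  exists (C0 + 1). split; [lra|].
  intros Th D a1 b1 a2 b2 a3 b3 t HTh Ho1 Ho2 Ho3 Ht HX1 HX2 HX3 HY1 HY2 HY3.
  destruct (difference_slopes Th D a1 b1 a3 b3 Ho1 Ho3 t Ht) as [Hal1 Hbe1].
  destruct (difference_slopes Th D a2 b2 a3 b3 Ho2 Ho3 t Ht) as [Hal2 Hbe2].
  destruct (Ho3 t Ht) as [Ha3 Hb3]. destruct (HTh t) as [Hth0 Hth1].
  set (E := exp ((xs - ys) * t + a3 t + K * b3 t)).
  assert (HE : 0 < E) by apply exp_pos.
  set (d1 := b1 t - a1 t) in *. set (d2 := b2 t - a2 t) in *. set (d3 := b3 t - a3 t) in *.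
  set (w1 := q * a1 t - K * b1 t) in *. set (w2 := q * a2 t - K * b2 t) in *.
  set (w3 := q * a3 t - K * b3 t) in *.
  set (r1 := exp d1 - exp d3 - exp d3 * (d1 - d3)).
  set (r2 := exp d2 - exp d3 - exp d3 * (d2 - d3)).
  set (p1 := Th t * (exp w1 - exp w3 - exp w3 * (w1 - w3))).
  set (p2 := Th t * (exp w2 - exp w3 - exp w3 * (w2 - w3))).
  exists (E * (- ys * (r1 * (b2 t - b3 t)) + ys * (r2 * (b1 t - b3 t))
          + xs / K * (p2 * (a1 t - a3 t)) + - (xs / K) * (p1 * (a2 t - a3 t)))).
  split.
  - set (al1 := fun t => a1 t - a3 t). set (be1 := fun t => b1 t - b3 t).
    set (al2 := fun t => a2 t - a3 t). set (be2 := fun t => b2 t - b3 t).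
    match type of Hal1 with is_derive _ t ?l => change (is_derive al1 t l) in Hal1 end.
    match type of Hbe1 with is_derive _ t ?l => change (is_derive be1 t l) in Hbe1 end.
    match type of Hal2 with is_derive _ t ?l => change (is_derive al2 t l) in Hal2 end.
    match type of Hbe2 with is_derive _ t ?l => change (is_derive be2 t l) in Hbe2 end.
    assert (Hder : is_derive (fun t => wedge (al1 t) (be1 t) (al2 t) (be2 t) * exp ((xs - ys) * t + a3 t + K * b3 t)) t
      (E * (- ys * (exp d1 - exp d3) * be2 t + al1 t * (xs / K * (Th t * (exp w2 - exp w3)))
        - - ys * (exp d2 - exp d3) * be1 t - al2 t * (xs / K * (Th t * (exp w1 - exp w3)))
        + wedge (al1 t) (be1 t) (al2 t) (be2 t)
          * (xs - ys + ys * (1 - exp d3) + K * (xs / K * (Th t * exp w3 - 1)))))).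
    { unfold wedge. clearbody al1 be1 al2 be2. auto_derive.
      - repeat split; first [eexists; exact Hal1 | eexists; exact Hbe1 | eexists; exact Hal2
          | eexists; exact Hbe2 | eexists; exact Ha3 | eexists; exact Hb3].
      - rewrite_derive Hal1. rewrite_derive Hbe1. rewrite_derive Hal2. rewrite_derive Hbe2.
        rewrite_derive Ha3. rewrite_derive Hb3.
        fold E. ring. }
    evar_last; [exact Hder|].
    unfold al1, be1, al2, be2, wedge, r1, r2, p1, p2, w1, w2, d1, d2.
    replace (q * a1 t - K * b1 t - w3) with (q * (a1 t - a3 t) - K * (b1 t - b3 t)) by (unfold w3; ring).
    replace (q * a2 t - K * b2 t - w3) with (q * (a2 t - a3 t) - K * (b2 t - b3 t)) by (unfold w3; ring).
    replace (b1 t - a1 t - d3) with ((b1 t - b3 t) - (a1 t - a3 t)) by (unfold d3; ring).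
    replace (b2 t - a2 t - d3) with ((b2 t - b3 t) - (a2 t - a3 t)) by (unfold d3; ring).
    field. lra.
  - intros s Hs1 Hs2.
    assert (Habs : forall x y, Rabs x + Rabs y <= s -> Rabs x <= s /\ Rabs y <= s /\ 0 <= s).
    { intros x y H. pose proof (Rabs_pos x). pose proof (Rabs_pos y). lra. }
    destruct (Habs _ _ Hs1) as [Ha1s [Hb1s Hs0]]. destruct (Habs _ _ Hs2) as [Ha2s [Hb2s _]].
    assert (Hr : forall d ai bi, exp d <= Y -> d - d3 = bi - ai -> Rabs ai + Rabs bi <= s ->
       Rabs (exp d - exp d3 - exp d3 * (d - d3)) <= Rabs Y * s ^ 2).
    { intros d ai bi Hd Heq Hsi. eapply Rle_trans; [apply (exp_taylor_bound d d3 (Rabs Y))|].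
      - eapply Rle_trans; [exact Hd|apply Rle_abs].
      - eapply Rle_trans; [exact HY3|apply Rle_abs].
      - apply Rmult_le_compat_l; [lra|]. rewrite Heq, <- pow2_abs. apply pow_incr.
        split; [apply Rabs_pos|]. eapply Rle_trans; [apply (Rabs_triang bi (- ai))|].
        rewrite Rabs_Ropp. lra. }
    assert (Hp : forall w ai bi, Th t * exp w <= X -> w - w3 = q * ai - K * bi -> Rabs ai + Rabs bi <= s ->
       Rabs (Th t * (exp w - exp w3 - exp w3 * (w - w3))) <= Rabs X * q ^ 2 * s ^ 2).
    { intros w ai bi Hw Heq Hsi. rewrite Rabs_mult, (Rabs_pos_eq (Th t)) by lra.
      assert (Hb : Rabs (exp w - exp w3 - exp w3 * (w - w3)) <= Rabs X / Th t * (w - w3) ^ 2).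
      { apply exp_taylor_bound; apply Rmult_le_reg_l with (Th t); try lra;
        (replace (Th t * (Rabs X / Th t)) with (Rabs X) by (field; lra));
        (eapply Rle_trans; [|apply Rle_abs]); assumption. }
      apply Rle_trans with (Th t * (Rabs X / Th t * (w - w3) ^ 2)).
      - apply Rmult_le_compat_l; lra.
      - replace (Th t * (Rabs X / Th t * (w - w3) ^ 2)) with (Rabs X * (w - w3) ^ 2) by (field; lra).
        rewrite Rmult_assoc. apply Rmult_le_compat_l; [lra|].
        rewrite <- Rpow_mult_distr, <- (pow2_abs (w - w3)). apply pow_incr.
        split; [apply Rabs_pos|]. rewrite Heq.
        eapply Rle_trans; [apply (Rabs_triang (q * ai) (- (K * bi)))|].
        rewrite Rabs_Ropp, !Rabs_mult, (Rabs_pos_eq q), (Rabs_pos_eq K) by lra.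
        pose proof (Rabs_pos bi). pose proof (Rabs_pos ai). nra. }
    assert (R1 : Rabs r1 <= Rabs Y * s ^ 2)
      by (apply (Hr d1 (a1 t - a3 t) (b1 t - b3 t) HY1); [unfold d1, d3; ring|exact Hs1]).
    assert (R2 : Rabs r2 <= Rabs Y * s ^ 2)
      by (apply (Hr d2 (a2 t - a3 t) (b2 t - b3 t) HY2); [unfold d2, d3; ring|exact Hs2]).
    assert (P1 : Rabs p1 <= Rabs X * q ^ 2 * s ^ 2)
      by (apply (Hp w1 (a1 t - a3 t) (b1 t - b3 t) HX1); [unfold w1, w3; ring|exact Hs1]).
    assert (P2 : Rabs p2 <= Rabs X * q ^ 2 * s ^ 2)
      by (apply (Hp w2 (a2 t - a3 t) (b2 t - b3 t) HX2); [unfold w2, w3; ring|exact Hs2]).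
    rewrite Rabs_mult, (Rabs_pos_eq E) by lra.
    replace ((C0 + 1) * E * s ^ 3) with (E * (C0 * s ^ 3 + s ^ 3)) by ring.
    apply Rmult_le_compat_l; [lra|].
    assert (0 <= s ^ 3) by (apply pow_le; exact Hs0).
    apply Rle_trans with (C0 * s ^ 3); [|lra].
    assert (HT : forall u v w x y : R, 0 <= u -> Rabs v <= w * s ^ 2 -> Rabs y <= s ->
       Rabs x = u -> Rabs (x * (v * y)) <= u * (w * s ^ 3)).
    { intros u v w x y Hu Hv Hy Hx. rewrite !Rabs_mult, Hx. apply Rmult_le_compat_l; [exact Hu|].
      replace (w * s ^ 3) with (w * s ^ 2 * s) by ring.
      apply Rmult_le_compat; try apply Rabs_pos; assumption. }
    assert (Hys0 : 0 <= ys) by lra. assert (HxK0 : 0 <= xs / K) by lra.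
    assert (Eys : Rabs (- ys) = ys) by (rewrite Rabs_Ropp; apply Rabs_pos_eq; lra).
    assert (ExK : Rabs (- (xs / K)) = xs / K) by (rewrite Rabs_Ropp; apply Rabs_pos_eq; lra).
    pose proof (HT ys r1 (Rabs Y) (- ys) (b2 t - b3 t) Hys0 R1 Hb2s Eys) as T1.
    pose proof (HT ys r2 (Rabs Y) ys (b1 t - b3 t) Hys0 R2 Hb1s (Rabs_pos_eq _ Hys0)) as T2.
    pose proof (HT (xs / K) p2 (Rabs X * q ^ 2) (xs / K) (a1 t - a3 t) HxK0 P2 Ha1s (Rabs_pos_eq _ HxK0)) as T3.
    pose proof (HT (xs / K) p1 (Rabs X * q ^ 2) (- (xs / K)) (a2 t - a3 t) HxK0 P1 Ha2s ExK) as T4.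
    eapply Rle_trans; [apply Rabs_triang|]. eapply Rle_trans; [apply Rplus_le_compat_r, Rabs_triang|].
    eapply Rle_trans; [apply Rplus_le_compat_r, Rplus_le_compat_r, Rabs_triang|].
    unfold C0. lra.
Qed.

(** * Rotation of autonomous orbits around the equilibrium *)

Section Rotation.

Let a0 := (xs - ys) / 2.
Let delta := xs * ys * (q - K) / K.
Let b0 := sqrt (delta - a0 ^ 2).

Lemma frequency_pos : 0 < b0.
Proof.
  apply sqrt_lt_R0. unfold delta, a0.
  replace (4 * xs * ys * (q - K) / K) with (4 * (xs * ys * (q - K) / K)) in Hspiral by (field; lra).
  lra.
Qed.

Lemma frequency_square : b0 ^ 2 = delta - a0 ^ 2.
Proof.
  unfold b0. apply pow2_sqrt. unfold delta, a0.
  replace (4 * xs * ys * (q - K) / K) with (4 * (xs * ys * (q - K) / K)) in Hspiral by (field; lra).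
  lra.
Qed.

Lemma equilibrium_orbit : orbit (fun _ => 1) (fun _ => True) (fun _ => 0) (fun _ => 0).
Proof.
  intros t _. split.
  - replace (ys * (1 - exp (0 - 0))) with 0 by (rewrite Rminus_0_r, exp_0; ring).
    apply (is_derive_const (V := R_NormedModule) 0 t).
  - replace (xs / K * (1 * exp (q * 0 - K * 0) - 1)) with 0
      by (rewrite !Rmult_0_r, Rminus_0_r, exp_0; ring).
    apply (is_derive_const (V := R_NormedModule) 0 t).
Qed.

Lemma quad_slope_autonomous (nu : R) :
  0 < nu -> exists eps, 0 < eps /\
  forall (a b : R -> R) (t : R),
    orbit (fun _ => 1) (fun _ => True) a b ->
    Rabs (a t) <= eps -> Rabs (b t - a t) <= eps ->
    exists l, is_derive (fun t => quad (a t) (b t)) t l /\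
      Rabs (l + (xs - ys) * quad (a t) (b t)) <= nu * quad (a t) (b t).
Proof.
  intros Hnu.
  destruct (quad_slope_near nu Hnu) as [eps [He H]].
  exists eps. split; [exact He|]. intros a b t Ho Ha Hd.
  destruct (H (fun _ => 1) (fun _ => True) a b (fun _ => 0) (fun _ => 0) t) as [l [Hl1 Hl2]];
    try assumption; try exact I; try (rewrite ?Rminus_0_r, ?Rminus_diag, ?Rabs_R0; lra).
  - intros _; lra.
  - exact equilibrium_orbit.
  - rewrite !Rminus_0_r in Hl2. exists l. split; [|exact Hl2].
    eapply is_derive_ext; [|exact Hl1]. intros x. cbv beta. rewrite !Rminus_0_r. reflexivity.
Qed.

Section Orbit.

Variables a b : R -> R.
Hypothesis Horb : orbit (fun _ => 1) (fun _ => True) a b.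

(** Variation of constants for [det (u, (a, b))], which satisfies
    [f'' + 2 a0 f' + delta f = 0] up to quadratic terms. *)
Lemma rotation_formula (eps r S h : R) :
  0 <= h -> 0 < r -> eps <= 1 ->
  (forall t, S <= t -> Rabs (a t) <= eps /\ Rabs (b t - a t) <= eps /\
     (Rabs (a t) + Rabs (b t)) ^ 2 <= r) ->
  Rabs (b0 * exp (a0 * h) * wedge (a S) (b S) (a (S + h)) (b (S + h))
        - quad (a S) (b S) * sin (b0 * h))
  <= (Rabs (a S) + Rabs (b S)) * r * h * exp (a0 * h)
     * (4 * (2 * ys + q * xs / K + xs + a0 + b0) * (ys * exp 1 * 1 + xs / K * exp q * q ^ 2)).
Proof.
  intros Hh Hr Heps Hnear.
  pose proof frequency_pos as Hb0.
  assert (Ha0 : 0 < a0) by (unfold a0; lra).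
  pose proof (xK_pos) as HxK.
  set (u1 := a S). set (u2 := b S).
  set (U := Rabs u1 + Rabs u2).
  assert (HU1 : Rabs u1 <= U) by (unfold U; pose proof (Rabs_pos u2); lra).
  assert (HU2 : Rabs u2 <= U) by (unfold U; pose proof (Rabs_pos u1); lra).
  assert (HU : 0 <= U) by (pose proof (Rabs_pos u1); lra).
  set (M0 := ys * exp 1 * 1 + xs / K * exp q * q ^ 2).
  set (C1 := 2 * ys + q * xs / K + xs + a0 + b0).
  pose proof (exp_pos 1). pose proof (exp_pos q).
  assert (HM1 : 0 <= ys * exp 1 * 1) by (apply Rmult_le_pos; [apply Rmult_le_pos|]; lra).
  assert (HM2 : 0 <= xs / K * exp q * q ^ 2).
  { apply Rmult_le_pos; [apply Rmult_le_pos; lra|apply pow2_ge_0]. }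
  assert (HM0 : 0 <= M0) by (unfold M0; lra).
  assert (HqxK : 0 < q * xs / K) by (apply Rdiv_lt_0_compat; nra).
  (* the vector field minus its linearisation is quadratic in the distance to 0 *)
  set (ra := fun t => - ys * (exp (b t - a t) - 1 - (b t - a t))).
  set (rb := fun t => xs / K * (exp (q * a t - K * b t) - 1 - (q * a t - K * b t))).
  assert (Hra : forall t, S <= t -> Rabs (ra t) <= M0 * r).
  { intros t Ht. destruct (Hnear t Ht) as [Ha [Hd Hn]].
    unfold ra. rewrite Rabs_mult, Rabs_Ropp, (Rabs_pos_eq ys) by lra.
    assert (Hz : Rabs (exp (b t - a t) - 1 - (b t - a t)) <= exp 1 * r).
    { apply Rle_trans with (exp 1 * (b t - a t) ^ 2).
      - pose proof (exp_taylor_bound (b t - a t) 0 (exp 1)) as HT.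
        rewrite exp_0, Rmult_1_l, Rminus_0_r in HT. apply HT.
        + apply exp_le_compat. apply Rabs_le_between in Hd. lra.
        + pose proof (exp_ineq1_le 1). lra.
      - apply Rmult_le_compat_l; [lra|]. eapply Rle_trans; [|exact Hn].
        rewrite <- pow2_abs. apply pow_incr. split; [apply Rabs_pos|].
        eapply Rle_trans; [apply (Rabs_triang (b t) (- a t))|]. rewrite Rabs_Ropp. lra. }
    apply Rle_trans with (ys * (exp 1 * r)); [apply Rmult_le_compat_l; lra|].
    unfold M0. assert (0 <= xs / K * exp q * q ^ 2 * r) by (apply Rmult_le_pos; lra). lra. }
  assert (Hrb : forall t, S <= t -> Rabs (rb t) <= M0 * r).
  { intros t Ht. destruct (Hnear t Ht) as [Ha [Hd Hn]].
    unfold rb. rewrite Rabs_mult, (Rabs_pos_eq (xs / K)) by lra.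
    assert (Hz : Rabs (exp (q * a t - K * b t) - 1 - (q * a t - K * b t)) <= exp q * (q ^ 2 * r)).
    { apply Rle_trans with (exp q * (q * a t - K * b t) ^ 2).
      - pose proof (exp_taylor_bound (q * a t - K * b t) 0 (exp q)) as HT.
        rewrite exp_0, Rmult_1_l, Rminus_0_r in HT. apply HT.
        + apply exp_le_compat. apply Rabs_le_between in Hd. apply Rabs_le_between in Ha.
          replace (q * a t - K * b t) with ((q - K) * a t + K * - (b t - a t)) by ring. nra.
        + pose proof (exp_ineq1_le q). lra.
      - apply Rmult_le_compat_l; [lra|].
        apply Rle_trans with (q ^ 2 * (Rabs (a t) + Rabs (b t)) ^ 2).
        + rewrite <- Rpow_mult_distr, <- (pow2_abs (q * a t - K * b t)). apply pow_incr.
          split; [apply Rabs_pos|]. eapply Rle_trans; [apply (Rabs_triang (q * a t) (- (K * b t)))|].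
          rewrite Rabs_Ropp, !Rabs_mult, (Rabs_pos_eq q), (Rabs_pos_eq K) by lra.
          pose proof (Rabs_pos (b t)). nra.
        + apply Rmult_le_compat_l; [apply pow2_ge_0|exact Hn]. }
    apply Rle_trans with (xs / K * (exp q * (q ^ 2 * r))); [apply Rmult_le_compat_l; lra|].
    unfold M0. assert (0 <= ys * exp 1 * 1 * r) by (apply Rmult_le_pos; lra). lra. }
  (* f is the determinant of u with the orbit, g that of u with A applied to the orbit *)
  set (f := fun h => wedge u1 u2 (a (S + h)) (b (S + h))).
  set (g := fun h => wedge u1 u2 (ys * a (S + h) - ys * b (S + h)) (q * xs / K * a (S + h) - xs * b (S + h))).
  set (ef := fun h => wedge u1 u2 (ra (S + h)) (rb (S + h))).
  set (eg := fun h => wedge u1 u2 (ys * ra (S + h) - ys * rb (S + h)) (q * xs / K * ra (S + h) - xs * rb (S + h))).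
  assert (Hsl : forall h, is_derive (fun h => a (S + h)) h (ys * a (S + h) - ys * b (S + h) + ra (S + h)) /\
                          is_derive (fun h => b (S + h)) h (q * xs / K * a (S + h) - xs * b (S + h) + rb (S + h))).
  { intros x. destruct (Horb (S + x) I) as [Hda Hdb]. split.
    - evar_last.
      + apply (is_derive_comp a (fun h => S + h)); [exact Hda|].
        auto_derive; [trivial|reflexivity].
      + unfold scal; simpl. unfold mult; simpl. unfold ra. ring.
    - evar_last.
      + apply (is_derive_comp b (fun h => S + h)); [exact Hdb|].
        auto_derive; [trivial|reflexivity].
      + unfold scal; simpl. unfold mult; simpl. unfold rb. field. lra. }
  assert (Hdf : forall h, is_derive f h (g h + ef h)).
  { intros x. destruct (Hsl x) as [Hda Hdb].
    unfold f, g, ef, wedge.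
    set (A := fun h => a (S + h)) in *. set (Bb := fun h => b (S + h)) in *.
    match type of Hda with is_derive _ x ?l => change (is_derive A x l) in Hda end.
    match type of Hdb with is_derive _ x ?l => change (is_derive Bb x l) in Hdb end.
    change (is_derive (fun h => u1 * Bb h - A h * u2) x
      (u1 * (q * xs / K * A x - xs * Bb x) - (ys * A x - ys * Bb x) * u2 + (u1 * rb (S + x) - ra (S + x) * u2))).
    change (a (S + x)) with (A x) in *. change (b (S + x)) with (Bb x) in *.
    clearbody A Bb. auto_derive.
    - split; [eexists; exact Hdb|split; [eexists; exact Hda|trivial]].
    - rewrite_derive Hda. rewrite_derive Hdb. ring. }
  assert (Hdg : forall h, is_derive g h (- (xs - ys) * g h - delta * f h + eg h)).
  { intros x. destruct (Hsl x) as [Hda Hdb].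
    unfold f, g, eg, wedge, delta.
    set (A := fun h => a (S + h)) in *. set (Bb := fun h => b (S + h)) in *.
    match type of Hda with is_derive _ x ?l => change (is_derive A x l) in Hda end.
    match type of Hdb with is_derive _ x ?l => change (is_derive Bb x l) in Hdb end.
    change (a (S + x)) with (A x) in *. change (b (S + x)) with (Bb x) in *.
    assert (Hder : is_derive (fun h => u1 * (q * xs / K * A h - xs * Bb h) - (ys * A h - ys * Bb h) * u2) x
      (u1 * (q * xs / K * (ys * A x - ys * Bb x + ra (S + x)) - xs * (q * xs / K * A x - xs * Bb x + rb (S + x)))
       - (ys * (ys * A x - ys * Bb x + ra (S + x)) - ys * (q * xs / K * A x - xs * Bb x + rb (S + x))) * u2)).
    { clearbody A Bb. auto_derive.
      - repeat split; first [eexists; exact Hda | eexists; exact Hdb].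
      - rewrite_derive Hda. rewrite_derive Hdb. unfold Rdiv. ring. }
    evar_last; [exact Hder|]. field. lra. }
  clear Hsl.
  pose proof frequency_square as Hfreq.
  (* the combinations that are constant for the linear system *)
  set (F1 := fun h => exp (a0 * h) * ((g h + a0 * f h) * cos (b0 * h) + b0 * f h * sin (b0 * h))).
  set (F2 := fun h => exp (a0 * h) * (- (g h + a0 * f h) * sin (b0 * h) + b0 * f h * cos (b0 * h))).
  set (e1 := fun h => exp (a0 * h) * ((eg h + a0 * ef h) * cos (b0 * h) + b0 * ef h * sin (b0 * h))).
  set (e2 := fun h => exp (a0 * h) * (- (eg h + a0 * ef h) * sin (b0 * h) + b0 * ef h * cos (b0 * h))).
  assert (Hdelta : delta = b0 ^ 2 + a0 ^ 2) by lra.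
  assert (Hsig : xs - ys = 2 * a0) by (unfold a0; lra).
  assert (HdF1 : forall h, is_derive F1 h (e1 h)).
  { intros x. specialize (Hdf x). specialize (Hdg x). unfold F1, e1.
    rewrite Hdelta, Hsig in Hdg.
    clearbody f g ef eg a0 b0. auto_derive.
    - repeat split; first [eexists; exact Hdf | eexists; exact Hdg].
    - rewrite_derive Hdf. rewrite_derive Hdg. ring. }
  assert (HdF2 : forall h, is_derive F2 h (e2 h)).
  { intros x. specialize (Hdf x). specialize (Hdg x). unfold F2, e2.
    rewrite Hdelta, Hsig in Hdg.
    clearbody f g ef eg a0 b0. auto_derive.
    - repeat split; first [eexists; exact Hdf | eexists; exact Hdg].
    - rewrite_derive Hdf. rewrite_derive Hdg. ring. }
  (* each error is a determinant of u with a remainder, hence a multiple of Z *)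
  set (Z := U * (M0 * r)).
  assert (HMr : 0 <= M0 * r) by (apply Rmult_le_pos; lra).
  assert (HZ : 0 <= Z) by (unfold Z; apply Rmult_le_pos; lra).
  assert (Hwb : forall x y c d, 0 <= c -> 0 <= d -> Rabs x <= c * (M0 * r) -> Rabs y <= d * (M0 * r) ->
     Rabs (wedge u1 u2 x y) <= (c + d) * Z).
  { intros x y c d Hc0 Hd0 Hx Hy. unfold wedge.
    eapply Rle_trans; [apply (Rabs_triang (u1 * y) (- (x * u2)))|].
    rewrite Rabs_Ropp, !Rabs_mult. unfold Z.
    pose proof (Rabs_pos x). pose proof (Rabs_pos y). pose proof (Rabs_pos u1). pose proof (Rabs_pos u2).
    assert (Rabs u1 * Rabs y <= U * (d * (M0 * r))) by (apply Rmult_le_compat; lra).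
    assert (Rabs x * Rabs u2 <= c * (M0 * r) * U) by (apply Rmult_le_compat; lra).
    nra. }
  assert (Hlin : forall p1 p2 x y, 0 <= p1 -> 0 <= p2 -> Rabs x <= M0 * r -> Rabs y <= M0 * r ->
     Rabs (p1 * x - p2 * y) <= (p1 + p2) * (M0 * r)).
  { intros p1 p2 x y Hp1 Hp2 Hx Hy.
    eapply Rle_trans; [apply (Rabs_triang (p1 * x) (- (p2 * y)))|].
    rewrite Rabs_Ropp, !Rabs_mult, (Rabs_pos_eq p1), (Rabs_pos_eq p2) by assumption.
    rewrite Rmult_plus_distr_r. apply Rplus_le_compat; apply Rmult_le_compat_l; assumption. }
  assert (Hef : forall x, 0 <= x -> Rabs (ef x) <= 2 * Z).
  { intros x Hx. unfold ef. replace 2 with (1 + 1) by ring.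
    apply Hwb; rewrite ?Rmult_1_l; try lra; [apply Hra|apply Hrb]; lra. }
  assert (Heg : forall x, 0 <= x -> Rabs (eg x) <= (2 * ys + q * xs / K + xs) * Z).
  { intros x Hx. unfold eg. replace (2 * ys + q * xs / K + xs) with ((ys + ys) + (q * xs / K + xs)) by ring.
    apply Hwb; try lra; apply Hlin; try lra; try (apply Hra; lra); apply Hrb; lra. }
  assert (Hcs : forall x y c s, Rabs c <= 1 -> Rabs s <= 1 -> Rabs (x * c + y * s) <= Rabs x + Rabs y).
  { intros x y c s Hc Hs. eapply Rle_trans; [apply Rabs_triang|]. rewrite !Rabs_mult.
    pose proof (Rabs_pos x). pose proof (Rabs_pos y).
    pose proof (Rabs_pos c). pose proof (Rabs_pos s). nra. }
  assert (Hcos : forall x, Rabs (cos x) <= 1) by (intros x; apply Rabs_le, COS_bound).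
  assert (Hsin : forall x, Rabs (sin x) <= 1) by (intros x; apply Rabs_le, SIN_bound).
  assert (Hsum : forall x, 0 <= x -> Rabs (eg x + a0 * ef x) + Rabs (b0 * ef x) <= 2 * C1 * Z).
  { intros x Hx. specialize (Hef x Hx). specialize (Heg x Hx).
    pose proof (Rabs_triang (eg x) (a0 * ef x)) as HT.
    rewrite Rabs_mult, (Rabs_pos_eq a0) in HT by lra.
    rewrite (Rabs_mult b0), (Rabs_pos_eq b0) by lra.
    assert (a0 * Rabs (ef x) <= a0 * (2 * Z)) by (apply Rmult_le_compat_l; lra).
    assert (b0 * Rabs (ef x) <= b0 * (2 * Z)) by (apply Rmult_le_compat_l; lra).
    assert (0 <= (2 * ys + q * xs / K + xs) * Z) by (apply Rmult_le_pos; lra).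
    unfold C1. nra. }
  assert (He12 : forall e, (e = e1 \/ e = e2) -> forall x, 0 <= x <= h -> Rabs (e x) <= exp (a0 * h) * (2 * C1 * Z)).
  { intros e He x Hx.
    assert (Hexp : exp (a0 * x) <= exp (a0 * h)) by (apply exp_le_compat; nra).
    pose proof (exp_pos (a0 * x)).
    destruct He as [-> | ->].
    - unfold e1. rewrite Rabs_mult, (Rabs_pos_eq (exp (a0 * x))) by lra.
      apply Rmult_le_compat; [lra|apply Rabs_pos|lra|].
      eapply Rle_trans; [apply Hcs; auto|]. apply Hsum; lra.
    - unfold e2. rewrite Rabs_mult, (Rabs_pos_eq (exp (a0 * x))) by lra.
      apply Rmult_le_compat; [lra|apply Rabs_pos|lra|].
      eapply Rle_trans; [apply Hcs; auto|]. rewrite Rabs_Ropp. apply Hsum; lra. }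
  pose proof (lipschitz_of_derive F1 e1 _ 0 h Hh (fun x _ => HdF1 x) (He12 e1 (or_introl eq_refl))) as L1.
  pose proof (lipschitz_of_derive F2 e2 _ 0 h Hh (fun x _ => HdF2 x) (He12 e2 (or_intror eq_refl))) as L2.
  assert (Hf0 : f 0 = 0) by (unfold f, wedge, u1, u2; rewrite Rplus_0_r; ring).
  assert (Hg0 : g 0 = quad u1 u2).
  { unfold g, wedge, quad, u1, u2. rewrite Rplus_0_r. field. lra. }
  assert (HF10 : F1 0 = quad u1 u2).
  { unfold F1. rewrite Hf0, Hg0, !Rmult_0_r, exp_0, cos_0. ring. }
  assert (HF20 : F2 0 = 0).
  { unfold F2. rewrite Hf0, Hg0, !Rmult_0_r, sin_0. ring. }
  rewrite HF10 in L1. rewrite HF20 in L2.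
  assert (Hid : b0 * exp (a0 * h) * f h = F1 h * sin (b0 * h) + F2 h * cos (b0 * h)).
  { unfold F1, F2. pose proof (sin2_cos2 (b0 * h)) as Hsc. rewrite !Rsqr_pow2 in Hsc.
    replace (b0 * exp (a0 * h) * f h)
      with (b0 * exp (a0 * h) * f h * (sin (b0 * h) ^ 2 + cos (b0 * h) ^ 2)) by (rewrite Hsc; ring).
    ring. }
  fold (f h). rewrite Hid.
  replace (F1 h * sin (b0 * h) + F2 h * cos (b0 * h) - quad u1 u2 * sin (b0 * h))
    with ((F1 h - quad u1 u2) * sin (b0 * h) + (F2 h - 0) * cos (b0 * h)) by ring.
  eapply Rle_trans; [apply Hcs; auto|].
  eapply Rle_trans; [apply Rplus_le_compat; [exact L1|exact L2]|].
  fold C1 M0. right. unfold Z. ring.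
Qed.

End Orbit.
End Rotation.

Section Spiral.

Variables a b : R -> R.
Hypothesis Horb : orbit (fun _ => 1) (fun _ => True) a b.
Hypothesis Hva : vanishing a.
Hypothesis Hvb : vanishing b.
Variable X0 : R.
Hypothesis HX0 : forall t, exp (q * a t - K * b t) <= X0.

Lemma autonomous_convergence (eps : R) :
  0 < eps -> exists S, forall t, S <= t -> Rabs (a t) <= eps /\ Rabs (b t - a t) <= eps.
Proof.
  intros He.
  destruct (sublevel_small eps He) as [eta [Heta Hsub]].
  destruct (energy_reaches_minimum a b Horb Hva Hvb X0 HX0 eta Heta) as [S HS].
  exists S. intros t Ht. apply Hsub. eapply Rle_lt_trans; [|exact HS].
  apply (energy_nonincreasing _ _ weight_one _ a b S t Horb Ht). trivial.
Qed.

(** Backward uniqueness: a regular orbit never reaches the equilibrium. *)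
Lemma autonomous_never_equilibrium (S : R) : 0 < quad (a S) (b S).
Proof.
  destruct (quad_nonneg (a S) (b S)) as [H|H]; [exact H|exfalso].
  destruct (quad_slope_bounded
    (Rmax X0 1) (Rmax (slope_bound) 1)) as [C [HC Hsl]].
  assert (Hz : forall s, s <= S -> a s = 0).
  { intros s Hs.
    assert (Hg : quad (a s) (b s) * exp (- C * (S - s)) <= quad (a S) (b S)).
    { apply (exp_growth_lower (fun t => quad (a t) (b t))); [exact Hs|].
      intros x Hx.
      destruct (Hsl (fun _ => 1) (fun _ => True) a b (fun _ => 0) (fun _ => 0) x) as [l [Hl1 Hl2]].
      - intros _; lra.
      - exact Horb.
      - apply equilibrium_orbit.
      - exact I.
      - rewrite Rmult_1_l. eapply Rle_trans; [apply HX0|apply Rmax_l].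
      - rewrite !Rmult_0_r, Rminus_0_r, exp_0. rewrite Rmult_1_l. apply Rmax_r.
      - eapply Rle_trans; [|apply Rmax_l].
        apply (slope_bounded 1); [lra|].
        apply (energy_nonpos _ _ weight_one _ a b x Horb Hva Hvb). trivial.
      - rewrite Rminus_0_r, exp_0. apply Rmax_r.
      - exists l. rewrite !Rminus_0_r in Hl2. split.
        + eapply is_derive_ext; [|exact Hl1]. intros y. cbv beta. rewrite !Rminus_0_r. reflexivity.
        + apply Rabs_le_between in Hl2. lra. }
    pose proof (exp_pos (- C * (S - s))) as He.
    rewrite <- H in Hg.
    assert (HQ0 : quad (a s) (b s) <= 0) by nra.
    destruct (quad_controls_norm) as [c [Hc Hn]].
    specialize (Hn (a s) (b s)).
    pose proof (Rabs_pos (a s)). pose proof (Rabs_pos (b s)).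
    assert (Rabs (a s) = 0) by nra.
    apply Rabs_eq_0; assumption. }
  destruct (Hva (1 / 2) ltac:(lra)) as [T HT].
  specialize (HT (Rmin T S) (Rmin_l _ _)). rewrite (Hz _ (Rmin_r _ _)), exp_0 in HT. lra.
Qed.

(** By [rotation_formula] the orbit turns with angular speed about [b0], so that three
    positions at time distance [2 pi / (3 b0)] surround the equilibrium. *)
Lemma autonomous_thirds_of_turn :
  exists H c S1, 0 < H /\ 0 < c /\ forall S, S1 <= S ->
    c * quad (a S) (b S) <= wedge (a S) (b S) (a (S + H)) (b (S + H)) /\
    c * quad (a S) (b S) <= wedge (a (S + H)) (b (S + H)) (a (S + 2 * H)) (b (S + 2 * H)) /\
    c * quad (a S) (b S) <= wedge (a (S + 2 * H)) (b (S + 2 * H)) (a S) (b S) /\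
    quad (a (S + H)) (b (S + H)) <= quad (a S) (b S) /\
    quad (a (S + 2 * H)) (b (S + 2 * H)) <= quad (a S) (b S).
Proof.
  set (a0 := (xs - ys) / 2).
  set (b0 := sqrt (xs * ys * (q - K) / K - a0 ^ 2)).
  assert (Hb0 : 0 < b0) by (apply frequency_pos).
  assert (Ha0 : 0 < a0) by (unfold a0; lra).
  set (H := 2 * PI / 3 / b0).
  pose proof PI_RGT_0 as Hpi.
  assert (HH : 0 < H) by (unfold H; apply Rdiv_lt_0_compat; [|exact Hb0]; lra).
  assert (HbH : b0 * H = 2 * PI / 3) by (unfold H; field; lra).
  assert (Hs1 : 0 < sin (b0 * H)) by (rewrite HbH; apply sin_gt_0; lra).
  assert (Hs2 : 0 < - sin (b0 * (2 * H))).
  { replace (b0 * (2 * H)) with (2 * (b0 * H)) by ring. rewrite HbH.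
    pose proof (sin_lt_0 (2 * (2 * PI / 3)) ltac:(lra) ltac:(lra)). lra. }
  set (s0 := Rmin (sin (b0 * H)) (- sin (b0 * (2 * H)))).
  assert (Hs0 : 0 < s0) by (apply Rmin_pos; assumption).
  assert (Hs01 : s0 <= sin (b0 * H)) by apply Rmin_l.
  assert (Hs02 : s0 <= - sin (b0 * (2 * H))) by apply Rmin_r.
  destruct (quad_controls_norm) as [cn [Hcn Hn]].
  destruct (quad_slope_autonomous a0 Ha0) as [eps1 [He1 Hsl]].

  pose proof (xK_pos) as HxK.
  pose proof (exp_pos 1). pose proof (exp_pos q).
  set (M := 4 * (2 * ys + q * xs / K + xs + a0 + b0) * (ys * exp 1 * 1 + xs / K * exp q * q ^ 2)).
  assert (HM : 0 < M).
  { assert (0 < q * xs / K) by (apply Rdiv_lt_0_compat; nra).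
    assert (0 < ys * exp 1) by (apply Rmult_lt_0_compat; lra).
    assert (0 < xs / K * exp q * q ^ 2).
    { apply Rmult_lt_0_compat; [apply Rmult_lt_0_compat; lra|]. apply pow_lt; lra. }
    unfold M. apply Rmult_lt_0_compat; lra. }
  set (E := exp (a0 * (2 * H))).
  assert (HE : 0 < E) by apply exp_pos.
  set (M' := cn * (2 * H) * E * M).
  assert (HM' : 0 < M') by (unfold M'; repeat first [assumption | lra | apply Rmult_lt_0_compat]).
  set (eps := Rmin (Rmin 1 eps1) (s0 / 2 / (3 * M'))).
  assert (Heps : 0 < eps).
  { unfold eps. apply Rmin_pos; [apply Rmin_pos; lra|]. apply Rdiv_lt_0_compat; lra. }
  assert (Heps1 : eps <= 1) by (eapply Rle_trans; [apply Rmin_l|apply Rmin_l]).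
  assert (Heps2 : eps <= eps1) by (eapply Rle_trans; [apply Rmin_l|apply Rmin_r]).
  assert (Heps3 : 3 * eps * M' <= s0 / 2).
  { apply Rle_trans with (3 * (s0 / 2 / (3 * M')) * M').
    - apply Rmult_le_compat_r; [lra|]. apply Rmult_le_compat_l; [lra|]. apply Rmin_r.
    - right. field. lra. }
  destruct (autonomous_convergence eps Heps) as [S1 HS1].
  set (c1 := s0 / 2 / (b0 * E)).
  assert (Hc1 : 0 < c1).
  { unfold c1. apply Rdiv_lt_0_compat; [lra|]. apply Rmult_lt_0_compat; lra. }
  set (c := c1 * Rmin 1 (exp (- (3 * a0) * H))).
  assert (Hmin : 0 < Rmin 1 (exp (- (3 * a0) * H))) by (apply Rmin_pos; [lra|apply exp_pos]).
  exists H, c, S1. split; [exact HH|]. split; [unfold c; apply Rmult_lt_0_compat; lra|].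
  (* the logarithmic slope of quad is within a0 of - (xs - ys) = - 2 a0 *)
  assert (Hmono : forall s t, S1 <= s -> s <= t -> quad (a t) (b t) <= quad (a s) (b s)).
  { intros s t Hs Hst.
    pose proof (exp_growth_upper (fun t => quad (a t) (b t)) 0 s t Hst) as Hg.
    rewrite Rmult_0_l, exp_0, Rmult_1_r in Hg. apply Hg.
    intros x Hx. destruct (HS1 x ltac:(lra)) as [Ha Hd].
    destruct (Hsl a b x Horb ltac:(lra) ltac:(lra)) as [l [Hl1 Hl2]].
    exists l. split; [exact Hl1|]. apply Rabs_le_between in Hl2.
    pose proof (autonomous_never_equilibrium x).
    assert (xs - ys = 2 * a0) by (unfold a0; lra). nra. }
  assert (Hlow : forall s, S1 <= s -> quad (a s) (b s) * exp (- (3 * a0) * H) <= quad (a (s + H)) (b (s + H))).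
  { intros s Hs.
    replace H with ((s + H) - s) at 1 by ring.
    apply (exp_growth_lower (fun t => quad (a t) (b t)) (- (3 * a0)) s (s + H)); [lra|].
    intros x Hx. destruct (HS1 x ltac:(lra)) as [Ha Hd].
    destruct (Hsl a b x Horb ltac:(lra) ltac:(lra)) as [l [Hl1 Hl2]].
    exists l. split; [exact Hl1|]. apply Rabs_le_between in Hl2.
    assert (Hx2 : xs - ys = 2 * a0) by (unfold a0; lra). rewrite Hx2 in Hl2. lra. }
  assert (Hrot : forall s h, S1 <= s -> 0 <= h <= 2 * H ->
    Rabs (b0 * exp (a0 * h) * wedge (a s) (b s) (a (s + h)) (b (s + h)) - quad (a s) (b s) * sin (b0 * h))
      <= s0 / 2 * quad (a s) (b s)).
  { intros s h Hs Hh.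
    pose proof (autonomous_never_equilibrium s) as Hpos.
    eapply Rle_trans.
    - apply (rotation_formula a b Horb eps (cn * quad (a s) (b s)) s h); try lra.
      + apply Rmult_lt_0_compat; lra.
      + intros t Ht. destruct (HS1 t ltac:(lra)) as [Ha Hd]. split; [exact Ha|]. split; [exact Hd|].
        eapply Rle_trans; [apply Hn|]. apply Rmult_le_compat_l; [lra|]. apply Hmono; lra.
    - fold a0 b0 M.
      destruct (HS1 s Hs) as [Ha Hd].
      assert (HU : Rabs (a s) + Rabs (b s) <= 3 * eps).
      { assert (Hb : Rabs (b s) <= Rabs (b s - a s) + Rabs (a s)).
        { replace (b s) with ((b s - a s) + a s) at 1 by ring. apply Rabs_triang. }
        lra. }
      pose proof (Rabs_pos (a s)). pose proof (Rabs_pos (b s)).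
      assert (He : exp (a0 * h) <= E) by (apply exp_le_compat; nra).
      pose proof (exp_pos (a0 * h)).
      assert (Hprod : h * exp (a0 * h) <= 2 * H * E) by (apply Rmult_le_compat; lra).
      assert (0 <= h * exp (a0 * h)) by (apply Rmult_le_pos; lra).
      replace ((Rabs (a s) + Rabs (b s)) * (cn * quad (a s) (b s)) * h * exp (a0 * h) * M)
        with ((Rabs (a s) + Rabs (b s)) * (h * exp (a0 * h)) * (cn * M * quad (a s) (b s))) by ring.
      apply Rle_trans with (3 * eps * (2 * H * E) * (cn * M * quad (a s) (b s))).
      + apply Rmult_le_compat_r; [apply Rmult_le_pos; [apply Rmult_le_pos|]; lra|].
        apply Rmult_le_compat; lra.
      + replace (3 * eps * (2 * H * E) * (cn * M * quad (a s) (b s))) with (3 * eps * M' * quad (a s) (b s))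
          by (unfold M'; ring).
        apply Rmult_le_compat_r; lra. }
  assert (Hquot : forall h x z, 0 <= h <= 2 * H -> 0 <= x -> s0 / 2 * x <= b0 * exp (a0 * h) * z -> c1 * x <= z).
  { intros h x z Hh Hx Hz.
    assert (He : exp (a0 * h) <= E) by (apply exp_le_compat; nra).
    pose proof (exp_pos (a0 * h)) as Hep.
    assert (Hz0 : 0 <= z).
    { apply Rmult_le_reg_l with (b0 * exp (a0 * h)); [apply Rmult_lt_0_compat; lra|].
      rewrite Rmult_0_r. eapply Rle_trans; [|exact Hz]. apply Rmult_le_pos; lra. }
    apply Rmult_le_reg_l with (b0 * E); [apply Rmult_lt_0_compat; lra|].
    replace (b0 * E * (c1 * x)) with (s0 / 2 * x) by (unfold c1; field; lra).
    eapply Rle_trans; [exact Hz|]. apply Rmult_le_compat_r; [exact Hz0|].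
    apply Rmult_le_compat_l; lra. }
  assert (Hfirst : forall s, S1 <= s -> c1 * quad (a s) (b s) <= wedge (a s) (b s) (a (s + H)) (b (s + H))).
  { intros s Hs. pose proof (Hrot s H Hs ltac:(lra)) as Hr. apply Rabs_le_between in Hr.
    pose proof (autonomous_never_equilibrium s).
    apply (Hquot H); try lra. nra. }
  assert (Hc1c : forall x, 0 <= x -> c * x <= c1 * x).
  { intros x Hx. apply Rmult_le_compat_r; [exact Hx|]. unfold c.
    pose proof (Rmin_l 1 (exp (- (3 * a0) * H))). nra. }
  intros S HS. pose proof (autonomous_never_equilibrium S) as Hpos.
  split; [|split; [|split; [|split]]].
  - eapply Rle_trans; [apply Hc1c; lra|]. apply Hfirst; exact HS.
  - replace (S + 2 * H) with ((S + H) + H) by ring.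
    eapply Rle_trans; [|apply Hfirst; lra].
    eapply Rle_trans; [|apply Rmult_le_compat_l; [lra|apply Hlow; exact HS]].
    unfold c. rewrite Rmult_assoc. apply Rmult_le_compat_l; [lra|].
    rewrite Rmult_comm. apply Rmult_le_compat_l; [lra|]. apply Rmin_r.
  - eapply Rle_trans; [apply Hc1c; lra|].
    pose proof (Hrot S (2 * H) HS ltac:(lra)) as Hr. apply Rabs_le_between in Hr.
    apply (Hquot (2 * H)); try lra.
    replace (wedge (a (S + 2 * H)) (b (S + 2 * H)) (a S) (b S))
      with (- wedge (a S) (b S) (a (S + 2 * H)) (b (S + 2 * H))) by (unfold wedge; ring).
    nra.
  - apply Hmono; lra.
  - apply Hmono; lra.
Qed.

End Spiral.

(** * Families of regular orbits *)

Lemma continuity_2d_pt_linear (x y A B : R) : continuity_2d_pt (fun u v => A * u + B * v) x y.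
Proof.
  apply continuity_2d_pt_plus; apply continuity_2d_pt_mult;
    solve [apply continuity_2d_pt_const | apply continuity_2d_pt_id1 | apply continuity_2d_pt_id2].
Qed.

Lemma continuity_2d_pt_exp_linear (x y A B : R) :
  continuity_2d_pt (fun u v => exp (A * u + B * v)) x y.
Proof.
  apply (continuity_1d_2d_pt_comp exp (fun u v => A * u + B * v)).
  - apply derivable_continuous_pt, derivable_pt_exp.
  - apply continuity_2d_pt_linear.
Qed.

Lemma wedge_perturb (x1 y1 x2 y2 eps : R) :
  0 < eps -> exists rho, 0 < rho /\ forall x1' y1' x2' y2',
    Rabs (x1' - x1) <= rho -> Rabs (y1' - y1) <= rho ->
    Rabs (x2' - x2) <= rho -> Rabs (y2' - y2) <= rho ->
    Rabs (wedge x1' y1' x2' y2' - wedge x1 y1 x2 y2) <= eps.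
Proof.
  intros He.
  set (s := Rabs x1 + Rabs y1 + Rabs x2 + Rabs y2 + 2).
  pose proof (Rabs_pos x1) as P1. pose proof (Rabs_pos y1) as P2.
  pose proof (Rabs_pos x2) as P3. pose proof (Rabs_pos y2) as P4.
  assert (Hs : 0 < s) by (unfold s; lra).
  exists (Rmin 1 (eps / s)).
  assert (Hr : 0 < Rmin 1 (eps / s)) by (apply Rmin_pos; [lra|apply Rdiv_lt_0_compat; lra]).
  split; [exact Hr|].
  set (rho := Rmin 1 (eps / s)) in *.
  assert (Hr1 : rho <= 1) by apply Rmin_l.
  assert (Hr2 : rho * s <= eps).
  { apply Rle_trans with (eps / s * s); [apply Rmult_le_compat_r; [lra|apply Rmin_r]|right; field; lra]. }
  intros x1' y1' x2' y2' H1 H2 H3 H4.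
  assert (Hx1 : Rabs x1' <= Rabs x1 + 1).
  { replace x1' with ((x1' - x1) + x1) by ring. pose proof (Rabs_triang (x1' - x1) x1). lra. }
  assert (Hx2 : Rabs x2' <= Rabs x2 + 1).
  { replace x2' with ((x2' - x2) + x2) by ring. pose proof (Rabs_triang (x2' - x2) x2). lra. }
  replace (wedge x1' y1' x2' y2' - wedge x1 y1 x2 y2)
    with (x1' * (y2' - y2) + (x1' - x1) * y2 + - (x2' * (y1' - y1)) + - ((x2' - x2) * y1))
    by (unfold wedge; ring).
  assert (Hm : forall u v c, Rabs u <= c -> Rabs v <= rho -> Rabs (u * v) <= c * rho).
  { intros u v c Hu Hv. rewrite Rabs_mult. apply Rmult_le_compat; try apply Rabs_pos; assumption. }
  pose proof (Hm _ _ _ Hx1 H4) as M1. pose proof (Hm _ _ _ (Rle_refl (Rabs y2)) H1) as M2.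
  pose proof (Hm _ _ _ Hx2 H2) as M3. pose proof (Hm _ _ _ (Rle_refl (Rabs y1)) H3) as M4.
  rewrite (Rmult_comm y2) in M2. rewrite (Rmult_comm y1) in M4.
  eapply Rle_trans; [apply Rabs_triang|]. rewrite Rabs_Ropp.
  eapply Rle_trans; [apply Rplus_le_compat_r, Rabs_triang|]. rewrite Rabs_Ropp.
  eapply Rle_trans; [apply Rplus_le_compat_r, Rplus_le_compat_r, Rabs_triang|].
  unfold s in Hr2. lra.
Qed.

(** Three vectors in cyclic order span the plane positively, so that their first
    components take both signs. *)
Lemma cyclic_first_components (x0 y0 x1 y1 x2 y2 : R) :
  0 < wedge x0 y0 x1 y1 -> 0 < wedge x1 y1 x2 y2 -> 0 < wedge x2 y2 x0 y0 ->
  (0 < x0 \/ 0 < x1 \/ 0 < x2) /\ (x0 < 0 \/ x1 < 0 \/ x2 < 0).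
Proof.
  intros H01 H12 H20.
  assert (Hid : x0 * wedge x1 y1 x2 y2 + x1 * wedge x2 y2 x0 y0 + x2 * wedge x0 y0 x1 y1 = 0)
    by (unfold wedge; ring).
  set (w01 := wedge x0 y0 x1 y1) in *. set (w12 := wedge x1 y1 x2 y2) in *.
  set (w20 := wedge x2 y2 x0 y0) in *.
  assert (Hnz : ~ (x0 = 0 /\ x1 = 0 /\ x2 = 0)).
  { intros [-> [-> _]]. unfold w01, wedge in H01. lra. }
  split; apply NNPP; intro Hno; apply Hnz.
  - assert (x0 <= 0 /\ x1 <= 0 /\ x2 <= 0) as [G0 [G1 G2]].
    { repeat split; apply Rnot_lt_le; tauto. }
    repeat split; nra.
  - assert (0 <= x0 /\ 0 <= x1 /\ 0 <= x2) as [G0 [G1 G2]].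
    { repeat split; apply Rnot_lt_le; tauto. }
    repeat split; nra.
Qed.

Section Family.

Let sigma := xs - ys.

Variables Th dTh : R -> R.
Hypothesis HTh : weight Th dTh.
Hypothesis HTh_lim : forall eps, 0 < eps -> exists T, forall t, t <= T -> 1 - Th t <= eps.

Variables A B : R -> R -> R.
Variable X0 : R.
Hypothesis Horb : forall tau, orbit Th (fun _ => True) (A tau) (B tau).
Hypothesis HvA : forall tau, vanishing (A tau).
Hypothesis HvB : forall tau, vanishing (B tau).
Hypothesis HX0 : forall tau t, Th t * exp (q * A tau t - K * B tau t) <= X0.

Variables a b : R -> R.
Hypothesis Horb0 : orbit (fun _ => 1) (fun _ => True) a b.
Hypothesis Hva : vanishing a.
Hypothesis Hvb : vanishing b.
Hypothesis HX00 : forall t, exp (q * a t - K * b t) <= X0.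

Hypothesis Hconv : forall s eps, 0 < eps -> exists T, forall tau, tau <= T ->
  Rabs (A tau (s + tau) - a s) <= eps /\ Rabs (B tau (s + tau) - b s) <= eps.

Lemma energy_continuous (x y : R) : continuity_2d_pt (fun u v => energy 1 u v) x y.
Proof.
  apply (continuity_2d_pt_ext (fun u v => xs / (q + 1) * exp ((q + 1) * u + 0 * v)
    + ys * K / (K + 1) * exp (0 * u + (K + 1) * v)
    - ys * exp (1 * u + K * v) - (xs - ys) / (K + 1) * exp ((K + 1) * u + 0 * v))).
  - intros u v. unfold energy. rewrite !Rmult_0_l, !Rplus_0_r, !Rplus_0_l, !Rmult_1_l.
    unfold Rdiv. ring.
  - repeat first [apply continuity_2d_pt_minus | apply continuity_2d_pt_plus];
      apply continuity_2d_pt_mult;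
      first [apply continuity_2d_pt_const | apply continuity_2d_pt_exp_linear].
Qed.

Lemma energy_weight_mono (th1 th2 x y : R) : th1 <= th2 -> energy th1 x y <= energy th2 x y.
Proof.
  intros H. unfold energy. pose proof (exp_pos ((q + 1) * x)).
  assert (xs * th1 * exp ((q + 1) * x) / (q + 1) <= xs * th2 * exp ((q + 1) * x) / (q + 1)); [|lra].
  apply Rmult_le_compat_r; [left; apply Rinv_0_lt_compat; lra|].
  apply Rmult_le_compat_r; [lra|]. apply Rmult_le_compat_l; lra.
Qed.

(** Once the limit orbit has come close to the equilibrium, the energy keeps the
    nearby orbits of the family there, as long as the weight is close to 1. *)
Lemma confinement (eps : R) :
  0 < eps -> exists S t1 T, forall tau t, tau <= T -> S + tau <= t -> t <= t1 ->
    Rabs (A tau t) <= eps /\ Rabs (B tau t - A tau t) <= eps.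
Proof.
  intros He.
  destruct (sublevel_small eps He) as [eta [Heta Hsub]].
  destruct (energy_reaches_minimum a b Horb0 Hva Hvb X0 HX00 (eta / 3) ltac:(lra))
    as [S HS].
  destruct (energy_continuous (a S) (b S) (mkposreal (eta / 3) ltac:(lra))) as [d Hd].
  destruct (Hconv S (d / 2) ltac:(destruct d; simpl; lra)) as [T HT].
  set (Amax := ln (2 * (q + 1) / (K + 1)) / (q - K)).
  set (M := xs * exp ((q + 1) * Amax) / (q + 1)).
  assert (HM : 0 < M).
  { unfold M. apply Rdiv_lt_0_compat; [|lra]. apply Rmult_lt_0_compat; [lra|apply exp_pos]. }
  destruct (HTh_lim (Rmin (1 / 2) (eta / 3 / M))) as [t1 Ht1].
  { apply Rmin_pos; [lra|]. apply Rdiv_lt_0_compat; lra. }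
  exists S, t1, T. intros tau t Htau Hst Ht. apply Hsub.
  destruct (HT tau Htau) as [HA HB].
  assert (Hd0 : d / 2 < d) by (destruct d; simpl; lra).
  specialize (Hd (A tau (S + tau)) (B tau (S + tau)) ltac:(lra) ltac:(lra)).
  simpl in Hd. apply Rabs_lt_between in Hd.
  pose proof (energy_nonincreasing Th dTh HTh _ _ _ (S + tau) t (Horb tau) Hst (fun _ _ => I)) as Hdec.

  pose proof (energy_weight_mono (Th (S + tau)) 1 (A tau (S + tau)) (B tau (S + tau)) (weight_le1 _ _ HTh _)).
  pose proof (energy_nonpos Th dTh HTh _ _ _ t (Horb tau) (HvA tau) (HvB tau) (fun _ _ => I)) as Hneg.
  pose proof (weight_pos _ _ HTh t) as Hth0.
  pose proof (weight_le1 _ _ HTh t) as Hth1.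
  specialize (Ht1 t Ht).
  assert (Hth2 : 1 - Th t <= 1 / 2) by (eapply Rle_trans; [exact Ht1|apply Rmin_l]).
  assert (Hth3 : (1 - Th t) * M <= eta / 3).
  { apply Rle_trans with (eta / 3 / M * M).
    - apply Rmult_le_compat_r; [lra|]. eapply Rle_trans; [exact Ht1|apply Rmin_r].
    - right. field. lra. }
  pose proof (amplitude_bounded (Th t) _ _ Hth0 Hneg) as Ham.
  assert (HAm : A tau t <= Amax).
  { unfold Amax. apply Rmult_le_reg_r with (q - K); [lra|].
    unfold Rdiv at 1. rewrite Rmult_assoc, Rinv_l, Rmult_1_r by lra.
    rewrite <- (ln_exp (A tau t * (q - K))). apply ln_le; [apply exp_pos|].
    rewrite (Rmult_comm (A tau t)). eapply Rle_trans; [exact Ham|].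
    replace (2 * (q + 1) / (K + 1)) with ((q + 1) / ((K + 1) * (1 / 2))) by (field; lra).
    apply Rmult_le_compat_l; [lra|]. apply Rinv_le_contravar; nra. }
  assert (Hexp : exp ((q + 1) * A tau t) <= exp ((q + 1) * Amax)) by (apply exp_le_compat; nra).
  assert (HV1 : energy 1 (A tau t) (B tau t) <= energy (Th t) (A tau t) (B tau t) + (1 - Th t) * M).
  { unfold energy, M.
    assert (xs * 1 * exp ((q + 1) * A tau t) / (q + 1)
      <= xs * Th t * exp ((q + 1) * A tau t) / (q + 1) + (1 - Th t) * (xs * exp ((q + 1) * Amax) / (q + 1))); [|lra].
    replace (xs * 1 * exp ((q + 1) * A tau t) / (q + 1)) with
      (xs * Th t * exp ((q + 1) * A tau t) / (q + 1) + (1 - Th t) * (xs * exp ((q + 1) * A tau t) / (q + 1)))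
      by (field; lra).
    apply Rplus_le_compat_l, Rmult_le_compat_l; [lra|].
    apply Rmult_le_compat_r; [left; apply Rinv_0_lt_compat; lra|]. apply Rmult_le_compat_l; lra. }
  lra.
Qed.

Lemma family_slope_bounded (tau t : R) : exp (B tau t - A tau t) <= slope_bound.
Proof.
  apply (slope_bounded (Th t)); [apply (weight_pos _ _ HTh)|].
  apply (energy_nonpos Th dTh HTh (fun _ => True));
    [apply Horb|apply HvA|apply HvB|trivial].
Qed.

Lemma weight_range (t : R) : 0 < Th t <= 1.
Proof. split; [apply (weight_pos _ _ HTh)|apply (weight_le1 _ _ HTh)]. Qed.

Let Qd (tau nu t : R) := quad (A tau t - A nu t) (B tau t - B nu t).

(** The differences decay like the linearisation until a fixed time [t1] and lose at most
    the factor [R0] afterwards. The rate [5 / 6 * sigma] is short of [sigma], but three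
    halves of it still exceed [sigma], as [wedge_persists] needs. *)
Lemma pair_decay :
  exists S t1 T R0, 0 < R0 /\ t1 <= 0 /\
  (forall tau t, tau <= T -> S + tau <= t -> t <= t1 ->
    Rabs (A tau t) <= 1 /\ Rabs (B tau t - A tau t) <= 1) /\
  (forall tau nu t0 t, tau <= T -> nu <= T -> S + tau <= t0 -> S + nu <= t0 -> t0 <= t1 ->
    t0 <= t <= 0 -> Qd tau nu t <= R0 * Qd tau nu t0 * exp (- (5 / 6 * sigma) * (t - t0))).
Proof.
  assert (Hsig : 0 < sigma) by (unfold sigma; lra).
  destruct (quad_slope_near (sigma / 6) ltac:(lra)) as [eps1 [He1 Hnear]].
  destruct (quad_slope_bounded X0 (slope_bound)) as [C [HC Hbd]].
  destruct (confinement (Rmin 1 eps1) ltac:(apply Rmin_pos; lra)) as [S [t1 [T Hconf]]].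
  destruct (HTh_lim eps1 He1) as [t2 Ht2].
  set (t3 := Rmin (Rmin t1 t2) 0).
  assert (Ht31 : t3 <= t1) by (eapply Rle_trans; [apply Rmin_l|apply Rmin_l]).
  assert (Ht32 : t3 <= t2) by (eapply Rle_trans; [apply Rmin_l|apply Rmin_r]).
  assert (Ht30 : t3 <= 0) by apply Rmin_r.
  exists S, t3, T, (exp ((C + 5 / 6 * sigma) * - t3)).
  split; [apply exp_pos|]. split; [exact Ht30|]. split.
  - intros tau t H1 H2 H3. destruct (Hconf tau t H1 H2 ltac:(lra)) as [Ha Hb].
    pose proof (Rmin_l 1 eps1). lra.
  - intros tau nu t0 t Htau Hnu Hst Hsn Ht0 [Ht Htz].
    assert (Hloc : forall u, t0 <= u <= t3 -> Qd tau nu u <= Qd tau nu t0 * exp (- (5 / 6 * sigma) * (u - t0))).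
    { intros u [Hu1 Hu2]. apply (exp_growth_upper (Qd tau nu) _ t0 u Hu1).
      intros x Hx.
      destruct (Hconf tau x Htau ltac:(lra) ltac:(lra)) as [Ha Hb].
      destruct (Hconf nu x Hnu ltac:(lra) ltac:(lra)) as [Ha' Hb'].
      pose proof (Rmin_r 1 eps1).
      destruct (Hnear Th (fun _ => True) (A tau) (B tau) (A nu) (B nu) x weight_range (Horb tau) (Horb nu) I)
        as [l [Hl1 Hl2]]; try lra.
      { apply Ht2. lra. }
      exists l. split; [exact Hl1|]. apply Rabs_le_between in Hl2. fold sigma in Hl2. unfold Qd. lra. }
    assert (HQ0 : 0 <= Qd tau nu t0) by (apply quad_nonneg; assumption).
    destruct (Rle_dec t t3) as [Hcase|Hcase].
    + eapply Rle_trans; [apply Hloc; lra|].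
      pose proof (exp_pos (- (5 / 6 * sigma) * (t - t0))) as He.
      assert (H1 : 1 <= exp ((C + 5 / 6 * sigma) * - t3)).
      { rewrite <- exp_0. apply exp_le_compat. apply Rmult_le_pos; lra. }
      rewrite Rmult_assoc. rewrite <- (Rmult_1_l (Qd tau nu t0 * _)) at 1.
      apply Rmult_le_compat_r; [apply Rmult_le_pos; lra|exact H1].
    + assert (Hg : Qd tau nu t <= Qd tau nu t3 * exp (C * (t - t3))).
      { apply (exp_growth_upper (Qd tau nu) C t3 t); [lra|]. intros x Hx.
        destruct (Hbd Th (fun _ => True) (A tau) (B tau) (A nu) (B nu) x weight_range (Horb tau) (Horb nu) I
          (HX0 tau x) (HX0 nu x) (family_slope_bounded tau x) (family_slope_bounded nu x)) as [l [Hl1 Hl2]].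
        exists l. split; [exact Hl1|]. apply Rabs_le_between in Hl2. unfold Qd. lra. }
      eapply Rle_trans; [exact Hg|].
      specialize (Hloc t3 ltac:(lra)).
      apply Rle_trans with (Qd tau nu t0 * exp (- (5 / 6 * sigma) * (t3 - t0)) * exp (C * (t - t3))).
      * apply Rmult_le_compat_r; [left; apply exp_pos|exact Hloc].
      * rewrite (Rmult_comm (exp ((C + 5 / 6 * sigma) * - t3))), !Rmult_assoc.
        apply Rmult_le_compat_l; [exact HQ0|]. rewrite <- !exp_plus. apply exp_le_compat. nra.
Qed.

(** If two orbits of the family start, at time [t0], in independent directions as
    seen from a third one, the determinant keeps its sign until time 0; the lower
    bound does not depend on the third orbit. By [wedge_slope] the weighted determinant
    changes only by cubic terms, which the decay of the differences makes small against
    the quadratic initial value. *)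
Lemma wedge_persists :
  exists S t1 T, t1 <= 0 /\
  forall m, 0 < m -> exists d0 kap, 0 < d0 /\ 0 < kap /\
  forall d tau1 tau2 nu t0, 0 < d -> d <= d0 ->
    tau1 <= T -> tau2 <= T -> nu <= T ->
    S + tau1 <= t0 -> S + tau2 <= t0 -> S + nu <= t0 -> t0 <= t1 ->
    Qd tau1 nu t0 <= d ^ 2 -> Qd tau2 nu t0 <= d ^ 2 ->
    m * d ^ 2 <= wedge (A tau1 t0 - A nu t0) (B tau1 t0 - B nu t0) (A tau2 t0 - A nu t0) (B tau2 t0 - B nu t0) ->
    kap * d ^ 2 * exp (sigma * t0) <=
      wedge (A tau1 0 - A nu 0) (B tau1 0 - B nu 0) (A tau2 0 - A nu 0) (B tau2 0 - B nu 0).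
Proof.
  assert (Hsig : 0 < sigma) by (unfold sigma; lra).
  destruct pair_decay as [S [t1 [T [R0 [HR0 [Ht1 [Hbox Hdecay]]]]]]].
  destruct (wedge_slope X0 (slope_bound)) as [Cw [HCw Hw]].
  destruct (quad_controls_norm) as [cn [Hcn Hn]].
  exists S, t1, T. split; [exact Ht1|].
  intros m Hm.
  set (L0 := 1 + 2 * K + (ys + xs * Rabs X0) * - t1).
  set (g := sqrt (cn * R0)).
  assert (Hg : 0 < g) by (apply sqrt_lt_R0; apply Rmult_lt_0_compat; lra).
  assert (Hg2 : g ^ 2 = cn * R0) by (unfold g; apply pow2_sqrt; apply Rmult_le_pos; lra).
  set (C4 := Cw * exp L0 * g ^ 3).
  assert (HC4 : 0 < C4).
  { unfold C4. apply Rmult_lt_0_compat; [|apply pow_lt; exact Hg]. apply Rmult_lt_0_compat; [lra|apply exp_pos]. }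
  set (el := exp (- (1 + 2 * K))).
  assert (Hel : 0 < el) by apply exp_pos.
  exists (m * el * sigma / (8 * C4)), (m / 2 * el * exp (- L0)).
  split.
  { apply Rdiv_lt_0_compat; [|lra]. repeat first [assumption | apply Rmult_lt_0_compat]. }
  split.
  { apply Rmult_lt_0_compat; [|apply exp_pos]. apply Rmult_lt_0_compat; lra. }
  intros d tau1 tau2 nu t0 Hd Hd0 HT1 HT2 HTn HS1 HS2 HSn Ht0 HQ1 HQ2 Hwedge.
  assert (Ht00 : t0 <= 0) by lra.
  set (W := fun t => wedge (A tau1 t - A nu t) (B tau1 t - B nu t) (A tau2 t - A nu t) (B tau2 t - B nu t)).
  fold (W t0) in Hwedge. fold (W 0).
  set (p := fun t => A nu t + K * B nu t).
  set (G := fun t => W t * exp (sigma * t + A nu t + K * B nu t)).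
  (* p is bounded by confinement until t1 and grows at most linearly afterwards *)
  assert (Hbox' : forall t, t0 <= t <= t1 -> Rabs (p t) <= 1 + 2 * K).
  { intros t Ht. destruct (Hbox nu t HTn ltac:(lra) ltac:(lra)) as [Ha Hb].
    apply Rabs_le_between in Ha. apply Rabs_le_between in Hb.
    replace (p t) with ((1 + K) * A nu t + K * (B nu t - A nu t)) by (unfold p; ring).
    apply Rabs_le. split; nra. }
  assert (HXn : 0 <= Rabs X0) by apply Rabs_pos.
  assert (HL0 : 1 + 2 * K <= L0).
  { unfold L0. assert (0 <= (ys + xs * Rabs X0) * - t1); [|lra]. apply Rmult_le_pos; [nra|lra]. }
  assert (Hp : forall t, t0 <= t <= 0 -> p t <= L0).
  { intros t Ht. destruct (Rle_dec t t1) as [Hc|Hc].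
    - specialize (Hbox' t ltac:(lra)). apply Rabs_le_between in Hbox'. lra.
    - specialize (Hbox' t1 ltac:(lra)). apply Rabs_le_between in Hbox'.
      assert (Hm2 : p t - (ys + xs * Rabs X0) * (t - t1) <= p t1 - (ys + xs * Rabs X0) * (t1 - t1)).
      { apply (nonincreasing_of_derive (fun t => p t - (ys + xs * Rabs X0) * (t - t1))
         (fun t => ys * (1 - exp (B nu t - A nu t)) + K * (xs / K * (Th t * exp (q * A nu t - K * B nu t) - 1))
                   - (ys + xs * Rabs X0))); [lra| |].
        - intros x Hx. destruct (Horb nu x I) as [Hda Hdb]. unfold p. auto_derive.
          + repeat split; first [eexists; exact Hda | eexists; exact Hdb].
          + rewrite_derive Hda. rewrite_derive Hdb. ring.
        - intros x Hx. pose proof (exp_pos (B nu x - A nu x)). pose proof (HX0 nu x).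
          pose proof (Rle_abs X0).
          replace (K * (xs / K * (Th x * exp (q * A nu x - K * B nu x) - 1)))
            with (xs * (Th x * exp (q * A nu x - K * B nu x) - 1)) by (field; lra).
          assert (0 <= ys * exp (B nu x - A nu x)) by (apply Rmult_le_pos; lra).
          assert (xs * (Th x * exp (q * A nu x - K * B nu x)) <= xs * Rabs X0) by (apply Rmult_le_compat_l; lra).
          lra. }
      assert ((ys + xs * Rabs X0) * (t - t1) <= (ys + xs * Rabs X0) * - t1).
      { apply Rmult_le_compat_l; [|lra]. assert (0 <= xs * Rabs X0) by (apply Rmult_le_pos; lra). lra. }
      unfold L0. lra. }
  (* s bounds the differences; its cube decays at the rate 5/4 sigma and thus outweighs
     the factor exp (sigma t) of G, so that the slope of G is integrable *)
  set (s := fun t => g * d * exp (- (5 / 12 * sigma) * (t - t0))).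
  assert (Hs : forall tau, tau <= T -> S + tau <= t0 -> Qd tau nu t0 <= d ^ 2 -> forall t, t0 <= t <= 0 ->
     Rabs (A tau t - A nu t) + Rabs (B tau t - B nu t) <= s t).
  { intros tau HTt HSt HQt t Ht.
    pose proof (Rabs_pos (A tau t - A nu t)). pose proof (Rabs_pos (B tau t - B nu t)).
    assert (Hs0 : 0 < s t).
    { unfold s. apply Rmult_lt_0_compat; [|apply exp_pos]. apply Rmult_lt_0_compat; lra. }
    apply Rsqr_incr_0_var; [|lra]. rewrite !Rsqr_pow2.
    eapply Rle_trans; [apply Hn|].
    pose proof (Hdecay tau nu t0 t HTt HTn HSt HSn Ht0 Ht) as Hdec. unfold Qd in Hdec at 1.
    apply Rle_trans with (cn * (R0 * d ^ 2 * exp (- (5 / 6 * sigma) * (t - t0)))).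
    - apply Rmult_le_compat_l; [lra|]. eapply Rle_trans; [exact Hdec|].
      apply Rmult_le_compat_r; [left; apply exp_pos|]. apply Rmult_le_compat_l; lra.
    - unfold s. rewrite !Rpow_mult_distr, Hg2.
      replace (exp (- (5 / 12 * sigma) * (t - t0)) ^ 2) with (exp (- (5 / 6 * sigma) * (t - t0))).
      + right. ring.
      + simpl. rewrite Rmult_1_r, <- exp_plus. f_equal. field. }
  set (C5 := C4 * d ^ 3 * exp (sigma * t0)).
  assert (HdG : forall t, t0 <= t <= 0 -> exists l, is_derive G t l /\
     Rabs l <= C5 * exp (- (sigma / 4) * (t - t0))).
  { intros t Ht.
    destruct (Hw Th (fun _ => True) (A tau1) (B tau1) (A tau2) (B tau2) (A nu) (B nu) t weight_range
      (Horb tau1) (Horb tau2) (Horb nu) I (HX0 _ _) (HX0 _ _) (HX0 _ _)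
      (family_slope_bounded _ _) (family_slope_bounded _ _) (family_slope_bounded _ _)) as [l [Hl1 Hl2]].
    exists l. split; [exact Hl1|].
    eapply Rle_trans; [apply (Hl2 (s t)); apply Hs; assumption|].
    replace (xs - ys) with sigma by reflexivity.
    replace (sigma * t + A nu t + K * B nu t) with (sigma * t + p t) by (unfold p; ring).
    unfold s. rewrite !Rpow_mult_distr, exp_plus.
    replace (exp (- (5 / 12 * sigma) * (t - t0)) ^ 3) with (exp (- (5 / 4 * sigma) * (t - t0)))
      by (simpl; rewrite Rmult_1_r, <- !exp_plus; f_equal; field).
    apply Rle_trans with (Cw * (exp (sigma * t) * exp L0) * (g ^ 3 * d ^ 3 * exp (- (5 / 4 * sigma) * (t - t0)))).
    - apply Rmult_le_compat_r.
      + apply Rmult_le_pos; [|left; apply exp_pos]. apply Rmult_le_pos; apply pow_le; lra.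
      + apply Rmult_le_compat_l; [lra|]. apply Rmult_le_compat_l; [left; apply exp_pos|].
        apply exp_le_compat, Hp, Ht.
    - right. unfold C5, C4.
      replace (exp (sigma * t)) with (exp (sigma * t0) * exp (sigma * (t - t0)))
        by (rewrite <- exp_plus; f_equal; ring).
      replace (exp (- (sigma / 4) * (t - t0))) with (exp (sigma * (t - t0)) * exp (- (5 / 4 * sigma) * (t - t0)))
        by (rewrite <- exp_plus; f_equal; field).
      ring. }
  assert (HC5 : 0 < C5).
  { unfold C5. apply Rmult_lt_0_compat; [|apply exp_pos]. apply Rmult_lt_0_compat; [lra|apply pow_lt; lra]. }
  assert (HG : G t0 - 4 * C5 / sigma * exp (- (sigma / 4) * (t0 - t0))
            <= G 0 - 4 * C5 / sigma * exp (- (sigma / 4) * (0 - t0))).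
  { apply (nondecreasing_of_derive (fun t => G t - 4 * C5 / sigma * exp (- (sigma / 4) * (t - t0)))
      (fun t => Derive G t + C5 * exp (- (sigma / 4) * (t - t0))) t0 0 Ht00).
    - intros x Hx. destruct (HdG x Hx) as [l [Hl1 _]].
      assert (HDG : is_derive G x (Derive G x)) by (rewrite (is_derive_unique _ _ _ Hl1); exact Hl1).
      evar_last.
      + apply (is_derive_minus (V := R_NormedModule) G); [exact HDG|].
        auto_derive; [trivial|reflexivity].
      + unfold minus, plus, opp; simpl. replace (x + - t0) with (x - t0) by ring. field. lra.
    - intros x Hx. destruct (HdG x Hx) as [l [Hl1 Hl2]]. rewrite (is_derive_unique _ _ _ Hl1).
      apply Rabs_le_between in Hl2. lra. }
  rewrite Rminus_diag, Rmult_0_r, exp_0, Rmult_1_r in HG.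
  assert (Hpos : 0 < 4 * C5 / sigma * exp (- (sigma / 4) * (0 - t0))).
  { apply Rmult_lt_0_compat; [|apply exp_pos]. apply Rdiv_lt_0_compat; lra. }
  set (E := exp (sigma * t0)) in *.
  assert (HE : 0 < E) by apply exp_pos.
  assert (Hd2 : 0 < d ^ 2) by (apply pow_lt; lra).
  assert (HGt0 : m * d ^ 2 * (E * el) <= G t0).
  { unfold G. apply Rmult_le_compat.
    - apply Rmult_le_pos; lra.
    - apply Rmult_le_pos; lra.
    - exact Hwedge.
    - unfold E, el. rewrite <- exp_plus. apply exp_le_compat.
      specialize (Hbox' t0 ltac:(lra)). apply Rabs_le_between in Hbox'. unfold p in Hbox'. lra. }
  assert (Hsmall : 4 * C5 / sigma <= m / 2 * d ^ 2 * (E * el)).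
  { unfold C5. fold E.
    replace (4 * (C4 * d ^ 3 * E) / sigma) with (d * (4 * C4 / sigma * (d ^ 2 * E))) by (field; lra).
    apply Rle_trans with (m * el * sigma / (8 * C4) * (4 * C4 / sigma * (d ^ 2 * E))).
    - apply Rmult_le_compat_r; [|exact Hd0].
      apply Rmult_le_pos; [left; apply Rdiv_lt_0_compat; lra|apply Rmult_le_pos; lra].
    - right. field. lra. }
  assert (HG0 : m / 2 * d ^ 2 * (E * el) <= G 0) by lra.
  assert (HW0 : W 0 = G 0 * exp (- p 0)).
  { unfold G. rewrite Rmult_assoc, <- exp_plus.
    replace (sigma * 0 + A nu 0 + K * B nu 0 + - p 0) with 0 by (unfold p; ring).
    rewrite exp_0. ring. }
  rewrite HW0.
  replace (m / 2 * el * exp (- L0) * d ^ 2 * E) with (m / 2 * d ^ 2 * (E * el) * exp (- L0)) by ring.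
  apply Rmult_le_compat; [|left; apply exp_pos|exact HG0|].
  - apply Rmult_le_pos; [apply Rmult_le_pos; lra|apply Rmult_le_pos; lra].
  - apply exp_le_compat. specialize (Hp 0 ltac:(lra)). lra.
Qed.

(** Two members of small scale have both spent a long time near the equilibrium before
    time 0, and their difference has decayed meanwhile. *)
Lemma endpoint_limit :
  exists al be, forall d, 0 < d -> exists N, forall nu, nu <= N ->
    Rabs (A nu 0 - al) < d /\ Rabs (B nu 0 - be) < d.
Proof.
  assert (Hsig : 0 < sigma) by (unfold sigma; lra).
  destruct pair_decay as [S [t1 [T [R0 [HR0 [Ht1 [Hbox Hdecay]]]]]]].
  destruct (quad_controls_norm) as [cn [Hcn Hn]].
  set (C := q * xs / K * 4 + (xs + ys) * 8 + ys * 16).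
  assert (HC : 0 < C).
  { unfold C. assert (0 < q * xs / K) by (apply Rdiv_lt_0_compat; nra). lra. }
  assert (Hclose : forall d, 0 < d -> exists N, forall nu1 nu2, nu1 <= N -> nu2 <= N ->
     Rabs (A nu1 0 - A nu2 0) < d /\ Rabs (B nu1 0 - B nu2 0) < d).
  { intros d Hd.
    set (M := cn * (R0 * C)).
    assert (HM : 0 < M) by (unfold M; repeat first [assumption | apply Rmult_lt_0_compat]).
    set (t0 := Rmin t1 (6 / (5 * sigma) * ln (d ^ 2 / 4 / M))).
    exists (Rmin T (t0 - S)). intros nu1 nu2 H1 H2.
    pose proof (Rmin_l T (t0 - S)). pose proof (Rmin_r T (t0 - S)).
    assert (Ht01 : t0 <= t1) by apply Rmin_l.
    pose proof (Hdecay nu1 nu2 t0 0 ltac:(lra) ltac:(lra) ltac:(lra) ltac:(lra) Ht01 ltac:(lra)) as Hdec.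
    destruct (Hbox nu1 t0 ltac:(lra) ltac:(lra) Ht01) as [Ha1 Hb1].
    destruct (Hbox nu2 t0 ltac:(lra) ltac:(lra) Ht01) as [Ha2 Hb2].
    assert (HQ : Qd nu1 nu2 t0 <= C).
    { apply Rabs_le_between in Ha1. apply Rabs_le_between in Ha2.
      apply Rabs_le_between in Hb1. apply Rabs_le_between in Hb2.
      unfold Qd, quad, C.
      set (x := A nu1 t0 - A nu2 t0). set (y := B nu1 t0 - B nu2 t0).
      assert (Hx : -2 <= x <= 2) by (unfold x; lra).
      assert (Hy : -4 <= y <= 4) by (unfold y; lra).
      assert (Hqx : 0 < q * xs / K) by (apply Rdiv_lt_0_compat; nra).
      assert (x ^ 2 <= 4) by nra. assert (y ^ 2 <= 16) by nra. assert (- (x * y) <= 8) by nra.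
      assert (q * xs / K * x ^ 2 <= q * xs / K * 4) by (apply Rmult_le_compat_l; lra).
      assert (ys * y ^ 2 <= ys * 16) by (apply Rmult_le_compat_l; lra).
      assert ((xs + ys) * - (x * y) <= (xs + ys) * 8) by (apply Rmult_le_compat_l; lra). lra. }
    assert (Hexp : exp (- (5 / 6 * sigma) * (0 - t0)) <= d ^ 2 / 4 / M).
    { assert (0 < d ^ 2 / 4 / M).
      { apply Rdiv_lt_0_compat; [|lra]. assert (0 < d ^ 2) by (apply pow_lt; lra). lra. }
      rewrite <- (exp_ln (d ^ 2 / 4 / M)) by assumption. apply exp_le_compat.
      assert (Ht0 : t0 <= 6 / (5 * sigma) * ln (d ^ 2 / 4 / M)) by apply Rmin_r.
      apply Rle_trans with (5 / 6 * sigma * (6 / (5 * sigma) * ln (d ^ 2 / 4 / M))).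
      - replace (- (5 / 6 * sigma) * (0 - t0)) with (5 / 6 * sigma * t0) by ring.
        apply Rmult_le_compat_l; [lra|exact Ht0].
      - right. field. lra. }
    assert (Hsq : (Rabs (A nu1 0 - A nu2 0) + Rabs (B nu1 0 - B nu2 0)) ^ 2 <= d ^ 2 / 4).
    { eapply Rle_trans; [apply Hn|].
      apply Rle_trans with (cn * (R0 * C * (d ^ 2 / 4 / M))).
      - apply Rmult_le_compat_l; [lra|]. eapply Rle_trans; [exact Hdec|].
        apply Rmult_le_compat; [|left; apply exp_pos| |exact Hexp].
        + apply Rmult_le_pos; [lra|]. apply quad_nonneg; assumption.
        + apply Rmult_le_compat_l; lra.
      - right. unfold M. field. repeat split; lra. }
    pose proof (Rabs_pos (A nu1 0 - A nu2 0)). pose proof (Rabs_pos (B nu1 0 - B nu2 0)).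
    nra. }
  assert (Hlim : forall f : R -> R, (forall d, 0 < d -> exists N, forall nu1 nu2, nu1 <= N -> nu2 <= N ->
     Rabs (f nu1 - f nu2) < d) -> exists l, forall d, 0 < d -> exists N, forall nu, nu <= N -> Rabs (f nu - l) < d).
  { intros f Hf.
    destruct (proj1 (filterlim_locally_cauchy (U := R_CompleteSpace) (F := Rbar_locally m_infty) f)) as [l Hl].
    - intros eps. destruct (Hf eps (cond_pos eps)) as [N HN].
      exists (fun x => x < N). split; [exists N; trivial|].
      intros u v Hu Hv. apply (HN v u); lra.
    - exists l. intros d Hd.
      destruct (proj1 (filterlim_locally (F := Rbar_locally m_infty) f l) Hl (mkposreal d Hd)) as [N HN].
      exists (N - 1). intros nu Hnu. apply HN. lra. }
  destruct (Hlim (fun nu => A nu 0)) as [al Hal].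
  { intros d Hd. destruct (Hclose d Hd) as [N HN]. exists N. intros. now apply HN. }
  destruct (Hlim (fun nu => B nu 0)) as [be Hbe].
  { intros d Hd. destruct (Hclose d Hd) as [N HN]. exists N. intros. now apply HN. }
  exists al, be. intros d Hd.
  destruct (Hal d Hd) as [N1 H1]. destruct (Hbe d Hd) as [N2 H2].
  exists (Rmin N1 N2). intros nu Hnu.
  pose proof (Rmin_l N1 N2). pose proof (Rmin_r N1 N2).
  split; [apply H1|apply H2]; lra.
Qed.

(** At the time [t0 = S + tau] the members [tau], [tau - H] and [tau - 2 H] are close to
    the positions of the limit orbit at [S], [S + H] and [S + 2 H], which surround the
    equilibrium. A member [nu] of much smaller scale is close to the equilibrium at [t0]
    and close to the limit endpoint at time 0. Hence [wedge_persists] carries the cyclic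
    order over to the three endpoints around the limit endpoint. *)
Lemma family_oscillates :
  exists al, forall M, (exists tau, tau <= M /\ al < A tau 0) /\ (exists tau, tau <= M /\ A tau 0 < al).
Proof.
  destruct endpoint_limit as [al [be Hlim]]. exists al. intros M.
  destruct wedge_persists as [S0 [t1 [T [Ht1 Hpersist]]]].
  destruct (autonomous_thirds_of_turn a b Horb0 Hva Hvb X0 HX00)
    as [H [c [S1 [HH [Hc Hturn]]]]].
  destruct (Hpersist (c / 8) ltac:(lra)) as [d0 [kap [Hd0 [Hkap Hw]]]].
  set (Cq := q * xs / K + (xs + ys) * 2 + ys * 4).
  assert (Hqx : 0 < q * xs / K) by (apply Rdiv_lt_0_compat; nra).
  assert (HCq : 0 < Cq) by (unfold Cq; lra).
  set (e := d0 / (2 * sqrt Cq)).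
  assert (HsC : 0 < sqrt Cq) by (apply sqrt_lt_R0; exact HCq).
  assert (He : 0 < e) by (unfold e; apply Rdiv_lt_0_compat; lra).
  assert (He2 : 4 * (Cq * e ^ 2) = d0 ^ 2).
  { unfold e. replace Cq with (sqrt Cq ^ 2) at 1 by (apply pow2_sqrt; lra). field. lra. }
  destruct (autonomous_convergence a b Horb0 Hva Hvb X0 HX00 e He) as [S2 HS2].
  set (S := Rmax (Rmax S0 S1) S2).
  assert (HSS0 : S0 <= S) by (unfold S; eapply Rle_trans; [apply Rmax_l|apply Rmax_l]).
  assert (HSS1 : S1 <= S) by (unfold S; eapply Rle_trans; [apply Rmax_r|apply Rmax_l]).
  assert (HSS2 : S2 <= S) by apply Rmax_r.
  set (Q0 := quad (a S) (b S)).
  assert (HQ0 : 0 < Q0)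
    by (apply (autonomous_never_equilibrium a b Horb0 Hva Hvb X0 HX00)).
  assert (HQ0d : 4 * Q0 <= d0 ^ 2).
  { rewrite <- He2. apply Rmult_le_compat_l; [lra|].
    destruct (HS2 S HSS2) as [Ha Hd]. apply Rabs_le_between in Ha. apply Rabs_le_between in Hd.
    unfold Q0, quad, Cq. set (x := a S) in *. set (y := b S) in *.
    assert (Hy : - (2 * e) <= y <= 2 * e) by lra.
    assert (x ^ 2 <= e ^ 2) by nra. assert (y ^ 2 <= 4 * e ^ 2) by nra. assert (- (x * y) <= 2 * e ^ 2) by nra.
    assert (q * xs / K * x ^ 2 <= q * xs / K * e ^ 2) by (apply Rmult_le_compat_l; lra).
    assert (ys * y ^ 2 <= ys * (4 * e ^ 2)) by (apply Rmult_le_compat_l; lra).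
    assert ((xs + ys) * - (x * y) <= (xs + ys) * (2 * e ^ 2)) by (apply Rmult_le_compat_l; lra). lra. }
  set (d := 2 * sqrt Q0).
  assert (HsQ : 0 < sqrt Q0) by (apply sqrt_lt_R0; exact HQ0).
  assert (Hd : 0 < d) by (unfold d; lra).
  assert (Hdsq : d ^ 2 = 4 * Q0).
  { unfold d. rewrite Rpow_mult_distr, pow2_sqrt by lra. ring. }
  assert (Hdd0 : d <= d0).
  { apply Rsqr_incr_0_var; [|lra]. rewrite !Rsqr_pow2. lra. }
  destruct (Hturn S HSS1) as [W01 [W12 [W20 [Q1 Q2]]]]. fold Q0 in W01, W12, W20, Q1, Q2.
  (* replacing the limit orbit by the three members and the equilibrium by the member nu
     costs a small perturbation of quad and of the determinants *)
  assert (Hquad : forall x y, quad x y <= Q0 -> exists rho, 0 < rho /\ forall x' y',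
     Rabs (x' - x) <= rho -> Rabs (y' - y) <= rho -> quad x' y' <= d ^ 2).
  { intros x y Hxy.
    assert (Hcont : continuity_2d_pt quad x y).
    { apply (continuity_2d_pt_ext (fun u v => q * xs / K * (u * u) - (xs + ys) * (u * v) + ys * (v * v))).
      { intros u v. unfold quad. ring. }
      repeat first [apply continuity_2d_pt_const | apply continuity_2d_pt_id1 | apply continuity_2d_pt_id2
        | apply continuity_2d_pt_minus | apply continuity_2d_pt_plus | apply continuity_2d_pt_mult]. }
    destruct (Hcont (mkposreal Q0 HQ0)) as [rho Hrho].
    exists (rho / 2). split; [destruct rho; simpl; lra|].
    intros x' y' Hx Hy. assert (rho / 2 < rho) by (destruct rho; simpl; lra).
    specialize (Hrho x' y' ltac:(lra) ltac:(lra)). simpl in Hrho. apply Rabs_lt_between in Hrho. lra. }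
  destruct (Hquad (a S) (b S) (Rle_refl _)) as [r0 [Hr0 Hq0]].
  destruct (Hquad _ _ Q1) as [r1 [Hr1 Hq1]].
  destruct (Hquad _ _ Q2) as [r2 [Hr2 Hq2]].
  assert (HcQ : 0 < c / 2 * Q0) by (apply Rmult_lt_0_compat; lra).
  destruct (wedge_perturb (a S) (b S) (a (S + H)) (b (S + H)) (c / 2 * Q0) HcQ) as [r3 [Hr3 Hw01]].
  destruct (wedge_perturb (a (S + H)) (b (S + H)) (a (S + 2 * H)) (b (S + 2 * H)) (c / 2 * Q0) HcQ) as [r4 [Hr4 Hw12]].
  destruct (wedge_perturb (a (S + 2 * H)) (b (S + 2 * H)) (a S) (b S) (c / 2 * Q0) HcQ) as [r5 [Hr5 Hw20]].
  set (rho := Rmin (Rmin (Rmin r0 r1) r2) (Rmin (Rmin r3 r4) r5)).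
  assert (Hrho : 0 < rho) by (unfold rho; repeat apply Rmin_pos; assumption).
  assert (Hrhos : rho <= r0 /\ rho <= r1 /\ rho <= r2 /\ rho <= r3 /\ rho <= r4 /\ rho <= r5).
  { unfold rho. pose proof (Rmin_l (Rmin (Rmin r0 r1) r2) (Rmin (Rmin r3 r4) r5)).
    pose proof (Rmin_r (Rmin (Rmin r0 r1) r2) (Rmin (Rmin r3 r4) r5)).
    pose proof (Rmin_l (Rmin r0 r1) r2). pose proof (Rmin_r (Rmin r0 r1) r2).
    pose proof (Rmin_l (Rmin r3 r4) r5). pose proof (Rmin_r (Rmin r3 r4) r5).
    pose proof (Rmin_l r0 r1). pose proof (Rmin_r r0 r1).
    pose proof (Rmin_l r3 r4). pose proof (Rmin_r r3 r4). lra. }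
  destruct Hrhos as [L0 [L1 [L2 [L3 [L4 L5]]]]].
  destruct (Hconv S (rho / 2) ltac:(lra)) as [T0 HT0].
  destruct (Hconv (S + H) (rho / 2) ltac:(lra)) as [T1 HT1].
  destruct (Hconv (S + 2 * H) (rho / 2) ltac:(lra)) as [T2 HT2].
  destruct (confinement (rho / 4) ltac:(lra)) as [S' [t1' [T' Hconf]]].
  set (tau := Rmin (Rmin (Rmin M T) (Rmin T0 T1)) (Rmin T2 (Rmin (t1 - S) (t1' - S)))).
  assert (Htaus : tau <= M /\ tau <= T /\ tau <= T0 /\ tau <= T1 /\ tau <= T2 /\ tau <= t1 - S /\ tau <= t1' - S).
  { unfold tau. pose proof (Rmin_l (Rmin (Rmin M T) (Rmin T0 T1)) (Rmin T2 (Rmin (t1 - S) (t1' - S)))).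
    pose proof (Rmin_r (Rmin (Rmin M T) (Rmin T0 T1)) (Rmin T2 (Rmin (t1 - S) (t1' - S)))).
    pose proof (Rmin_l (Rmin M T) (Rmin T0 T1)). pose proof (Rmin_r (Rmin M T) (Rmin T0 T1)).
    pose proof (Rmin_l M T). pose proof (Rmin_r M T).
    pose proof (Rmin_l T0 T1). pose proof (Rmin_r T0 T1).
    pose proof (Rmin_l T2 (Rmin (t1 - S) (t1' - S))). pose proof (Rmin_r T2 (Rmin (t1 - S) (t1' - S))).
    pose proof (Rmin_l (t1 - S) (t1' - S)). pose proof (Rmin_r (t1 - S) (t1' - S)). lra. }
  destruct Htaus as [LM [LT [LT0 [LT1 [LT2 [Lt1 Lt1']]]]]].
  set (t0 := S + tau).
  set (tau1 := tau - H). set (tau2 := tau - 2 * H).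
  destruct (HT0 tau LT0) as [PA0 PB0].
  destruct (HT1 tau1 ltac:(unfold tau1; lra)) as [PA1 PB1].
  destruct (HT2 tau2 ltac:(unfold tau2; lra)) as [PA2 PB2].
  replace (S + H + tau1) with t0 in PA1, PB1 by (unfold t0, tau1; ring).
  replace (S + 2 * H + tau2) with t0 in PA2, PB2 by (unfold t0, tau2; ring).
  fold t0 in PA0, PB0.
  set (eta := kap * d ^ 2 * exp (sigma * t0)).
  assert (Heta : 0 < eta).
  { unfold eta. apply Rmult_lt_0_compat; [|apply exp_pos]. apply Rmult_lt_0_compat; [lra|apply pow_lt; lra]. }
  assert (Hnu : forall nu, nu <= Rmin (Rmin T T') (Rmin (t0 - S') (t0 - S0)) ->
    eta <= wedge (A tau 0 - A nu 0) (B tau 0 - B nu 0) (A tau1 0 - A nu 0) (B tau1 0 - B nu 0) /\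
    eta <= wedge (A tau1 0 - A nu 0) (B tau1 0 - B nu 0) (A tau2 0 - A nu 0) (B tau2 0 - B nu 0) /\
    eta <= wedge (A tau2 0 - A nu 0) (B tau2 0 - B nu 0) (A tau 0 - A nu 0) (B tau 0 - B nu 0)).
  { intros nu Hnu.
    assert (Hns : nu <= T /\ nu <= T' /\ nu <= t0 - S' /\ nu <= t0 - S0).
    { pose proof (Rmin_l (Rmin T T') (Rmin (t0 - S') (t0 - S0))).
      pose proof (Rmin_r (Rmin T T') (Rmin (t0 - S') (t0 - S0))).
      pose proof (Rmin_l T T'). pose proof (Rmin_r T T').
      pose proof (Rmin_l (t0 - S') (t0 - S0)). pose proof (Rmin_r (t0 - S') (t0 - S0)). lra. }
    destruct Hns as [N1 [N2 [N3 N4]]].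
    destruct (Hconf nu t0 N2 ltac:(lra) ltac:(unfold t0; lra)) as [HAn HBn].
    apply Rabs_le_between in HAn. apply Rabs_le_between in HBn.
    assert (Hcl : forall x p, Rabs (x - p) <= rho / 2 -> Rabs (x - A nu t0 - p) <= rho /\ Rabs (x - B nu t0 - p) <= rho).
    { intros x p Hx. apply Rabs_le_between in Hx. split; apply Rabs_le; lra. }
    destruct (Hcl _ _ PA0) as [DA0 _]. destruct (Hcl _ _ PB0) as [_ DB0].
    destruct (Hcl _ _ PA1) as [DA1 _]. destruct (Hcl _ _ PB1) as [_ DB1].
    destruct (Hcl _ _ PA2) as [DA2 _]. destruct (Hcl _ _ PB2) as [_ DB2].
    assert (QD0 : Qd tau nu t0 <= d ^ 2) by (apply Hq0; lra).
    assert (QD1 : Qd tau1 nu t0 <= d ^ 2) by (apply Hq1; lra).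
    assert (QD2 : Qd tau2 nu t0 <= d ^ 2) by (apply Hq2; lra).
    pose proof (Hw01 (A tau t0 - A nu t0) (B tau t0 - B nu t0) (A tau1 t0 - A nu t0) (B tau1 t0 - B nu t0)
       ltac:(lra) ltac:(lra) ltac:(lra) ltac:(lra)) as V01.
    pose proof (Hw12 (A tau1 t0 - A nu t0) (B tau1 t0 - B nu t0) (A tau2 t0 - A nu t0) (B tau2 t0 - B nu t0)
       ltac:(lra) ltac:(lra) ltac:(lra) ltac:(lra)) as V12.
    pose proof (Hw20 (A tau2 t0 - A nu t0) (B tau2 t0 - B nu t0) (A tau t0 - A nu t0) (B tau t0 - B nu t0)
       ltac:(lra) ltac:(lra) ltac:(lra) ltac:(lra)) as V20.
    apply Rabs_le_between in V01. apply Rabs_le_between in V12. apply Rabs_le_between in V20.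
    assert (Hmd : c / 8 * d ^ 2 = c / 2 * Q0) by (rewrite Hdsq; field).
    assert (Htau1 : S0 + tau1 <= t0) by (unfold tau1, t0; lra).
    assert (Htau2 : S0 + tau2 <= t0) by (unfold tau2, t0; lra).
    assert (Htau0 : S0 + tau <= t0) by (unfold t0; lra).
    assert (Htau1T : tau1 <= T) by (unfold tau1; lra).
    assert (Htau2T : tau2 <= T) by (unfold tau2; lra).
    assert (Ht0t1 : t0 <= t1) by (unfold t0; lra).
    unfold eta. split; [|split]; apply (Hw d); try assumption; lra. }
  assert (Hpass : forall x y x' y', (forall nu, nu <= Rmin (Rmin T T') (Rmin (t0 - S') (t0 - S0)) ->
     eta <= wedge (x - A nu 0) (y - B nu 0) (x' - A nu 0) (y' - B nu 0)) ->
     0 < wedge (x - al) (y - be) (x' - al) (y' - be)).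
  { intros x y x' y' Hall.
    destruct (wedge_perturb (x - al) (y - be) (x' - al) (y' - be) (eta / 2) ltac:(lra)) as [r [Hr Hp]].
    destruct (Hlim r Hr) as [N HN].
    set (nu := Rmin N (Rmin (Rmin T T') (Rmin (t0 - S') (t0 - S0)))).
    destruct (HN nu (Rmin_l _ _)) as [HA HB]. specialize (Hall nu (Rmin_r _ _)).
    apply Rabs_lt_between in HA. apply Rabs_lt_between in HB.
    specialize (Hp (x - A nu 0) (y - B nu 0) (x' - A nu 0) (y' - B nu 0)
      ltac:(apply Rabs_le; lra) ltac:(apply Rabs_le; lra) ltac:(apply Rabs_le; lra) ltac:(apply Rabs_le; lra)).
    apply Rabs_le_between in Hp. lra. }
  pose proof (Hpass (A tau 0) (B tau 0) (A tau1 0) (B tau1 0) (fun nu Hn => proj1 (Hnu nu Hn))) as F01.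
  pose proof (Hpass (A tau1 0) (B tau1 0) (A tau2 0) (B tau2 0) (fun nu Hn => proj1 (proj2 (Hnu nu Hn)))) as F12.
  pose proof (Hpass (A tau2 0) (B tau2 0) (A tau 0) (B tau 0) (fun nu Hn => proj2 (proj2 (Hnu nu Hn)))) as F20.
  destruct (cyclic_first_components _ _ _ _ _ _ F01 F12 F20) as [Hp Hm].
  assert (Hle : tau1 <= M /\ tau2 <= M) by (unfold tau1, tau2; lra).
  split.
  - destruct Hp as [Hp|[Hp|Hp]]; [exists tau|exists tau1|exists tau2]; lra.
  - destruct Hm as [Hp'|[Hp'|Hp']]; [exists tau|exists tau1|exists tau2]; lra.
Qed.

End Family.

(** * Regular solutions as orbits *)

Local Opaque sol.

Section Regular.

Variables p e : R.
Hypothesis Hp : 0 < p.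
Hypothesis He : 0 <= e.
Hypothesis Hscaling : (q - K) * ys = K * (2 + e).
Hypothesis Hequil : xs = p - q * ys.

Variables th dth : R -> R.
Hypothesis th_cont : forall s, continuous th s.
Hypothesis th_range : forall s, 0 < th s <= 1.
Hypothesis th_zero : th 0 = 1.
Hypothesis th_derive : forall s, 0 < s -> is_derive th s (dth s).
Hypothesis th_slope : forall s, 0 < s -> dth s <= 0.

(** The normalisation of the equation for which the equilibrium is the origin. *)
Definition unit_speed : R := ys * Rpower (xs / p) (/ K).

Let c2 := unit_speed.
Let w (kap : R) : R -> R := sol p e (/ K) c2 q th kap.
Let M (kap : R) : R -> R := mean_source p q th kap (w kap).

Lemma th_mono : forall s t, 0 <= s <= t -> th t <= th s.
Proof.
  intros s t [Hs Hst]. destruct Hs as [Hs|<-].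
  - apply (nonincreasing_of_derive th dth s t Hst); intros x Hx; [apply th_derive|apply th_slope]; lra.
  - rewrite th_zero. apply th_range.
Qed.

Lemma unit_speed_pos : 0 < c2.
Proof. unfold c2, unit_speed. apply Rmult_lt_0_compat; [exact Hys|apply Rpower_pos]. Qed.

Lemma invK_range : 0 < / K <= 1.
Proof.
  split; [apply Rinv_0_lt_compat; lra|]. rewrite <- Rinv_1. apply Rinv_le_contravar; lra.
Qed.

Lemma q_ge1 : 1 <= q. Proof. lra. Qed.

Lemma w_admissible (kap : R) : 0 <= kap -> admissible c2 (w kap).
Proof.
  exact (sol_admissible p e (/ K) c2 q Hp He invK_range unit_speed_pos q_ge1 th th_cont th_range th_mono kap).
Qed.

Lemma w_derive (kap s : R) : 0 <= kap -> is_derive (w kap) s (- speed p e (/ K) c2 q th kap (w kap) s).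
Proof.
  exact (sol_derive p e (/ K) c2 q Hp He invK_range unit_speed_pos q_ge1 th th_cont th_range th_mono kap s).
Qed.

Lemma w_zero (kap : R) : w kap 0 = 1.
Proof. apply sol_zero. Qed.

Lemma w_continuous (kap s : R) : 0 <= kap -> continuous (w kap) s.
Proof. intros Hk. apply (adm_cont _ _ (w_admissible kap Hk)). Qed.

Lemma w_le1 (kap s : R) : 0 <= kap -> 0 <= s -> w kap s <= 1.
Proof. intros Hk. apply (adm_le1 _ _ (w_admissible kap Hk)). Qed.

Lemma w_nonincreasing (kap s t : R) : 0 <= kap -> 0 <= s <= t -> w kap t <= w kap s.
Proof.
  intros Hk [Hs Hst].
  apply (nonincreasing_of_derive (w kap) _ s t Hst (fun x _ => w_derive kap x Hk)).
  intros x Hx.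
  pose proof (speed_range p e (/ K) c2 q Hp He invK_range unit_speed_pos q_ge1 th th_cont th_range kap (w kap) x x
    (w_admissible kap Hk) ltac:(lra)). lra.
Qed.

Lemma M_pos (kap s : R) : 0 <= kap -> 0 <= s -> 0 < M kap s.
Proof.
  intros Hk Hs.
  destruct (mean_source_lower p (/ K) c2 q Hp invK_range unit_speed_pos q_ge1 th th_cont th_range th_mono s kap Hs Hk) as [m [Hm H]].
  eapply Rlt_le_trans; [exact Hm|].
  exact (H kap (w kap) s (conj Hk (Rle_refl _)) (w_admissible kap Hk) (conj Hs (Rle_refl _))).
Qed.

Lemma M_le1 (kap s : R) : 0 <= kap -> 0 <= s -> M kap s <= 1.
Proof.
  intros Hk Hs.
  apply (mean_source_range p (/ K) c2 q Hp invK_range q_ge1 th th_cont th_range kap (w kap) s (w_admissible kap Hk) Hs).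
Qed.

Lemma M_continuous (kap s : R) : 0 <= kap -> continuous (M kap) s.
Proof.
  intros Hk. apply (mean_source_continuous p q Hp q_ge1 th th_cont kap (w kap)).
  intros x. now apply w_continuous.
Qed.

Lemma M_derive (kap s : R) : 0 <= kap -> 0 < s ->
  is_derive (M kap) s (p * (source q th kap (w kap) s - M kap s) / s).
Proof.
  intros Hk Hs.
  set (h := fun z => source q th kap (w kap) (pw z (/ p))).
  assert (Hh : forall z, continuous h z).
  { apply (mean_source_integrand_continuous p q Hp q_ge1 th th_cont). intros x. now apply w_continuous. }
  pose proof (avg_derive h (pw s p) Hh (pw_gt0 s p Hs)) as Ha.
  pose proof (pw_derive s p Hs) as Hb.
  evar_last.
  - apply (is_derive_comp (avg h) (fun s => pw s p) s _ _ Ha Hb).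
  - unfold scal; simpl; unfold mult; simpl.
    unfold h at 1. rewrite pw_inverse by lra.
    change (avg h (pw s p)) with (M kap s).
    replace (pw s (p - 1)) with (pw s p / s).
    + pose proof (pw_gt0 s p Hs). field. split; lra.
    + rewrite !pw_pos_eq by assumption. unfold Rminus. rewrite Rpower_plus, Rpower_Ropp, Rpower_1 by assumption.
      reflexivity.
Qed.

(** The mean of a nonincreasing source dominates its endpoint value. *)
Lemma source_le_mean (kap s : R) : 0 <= kap -> 0 <= s ->
  source q th kap (w kap) s <= M kap s.
Proof.
  intros Hk Hs. apply (mean_source_ge p q Hp q_ge1 th th_cont kap (w kap) s (source q th kap (w kap) s)).
  - intros x. now apply w_continuous.
  - exact Hs.
  - intros x Hx. unfold source. apply Rmult_le_compat.
    + left. apply th_range.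
    + apply pw_ge0.
    + apply th_mono. split; [apply Rmult_le_pos; lra|]. apply Rmult_le_compat_l; lra.
    + apply pw_mono; [lra|]. apply w_nonincreasing; lra.
Qed.

(** In these variables [ys * exp (flux - amplitude)] is the logarithmic slope
    [- s w' / w], by [speed_ratio]. *)
Definition amplitude (kap t : R) : R := ln (w kap (exp t)) + ys * t.
Definition flux (kap t : R) : R := / K * (ln (xs / p) + ln (M kap (exp t)) + q * ys * t).

Let Thk (kap t : R) : R := th (kap * exp t).

Lemma speed_ratio (kap t : R) : 0 <= kap -> 0 < w kap (exp t) ->
  exp t * speed p e (/ K) c2 q th kap (w kap) (exp t)
  = ys * exp (flux kap t - amplitude kap t) * w kap (exp t).
Proof.
  intros Hk Hw. pose proof (exp_pos t) as Ht.
  pose proof (M_pos kap (exp t) Hk ltac:(lra)) as HM.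
  unfold speed. fold (M kap (exp t)).
  rewrite (pw_pos_eq (M kap (exp t))), (pw_pos_eq (exp t)) by assumption.
  unfold c2, unit_speed, Rpower. rewrite ln_exp.
  unfold flux, amplitude, Rminus. rewrite exp_plus, exp_Ropp, (exp_plus (ln _)), exp_ln by assumption.
  replace (/ K * (ln (xs / p) + ln (M kap (exp t)) + q * ys * t))
    with (/ K * ln (xs / p) + / K * ln (M kap (exp t)) + (ys * t + (t + t + e * t))).
  - rewrite !exp_plus. field.
    split; [apply Rgt_not_eq, exp_pos|lra].
  - replace (ys * t + (t + t + e * t)) with ((ys + (2 + e)) * t) by ring.
    replace (ys + (2 + e)) with (/ K * (q * ys)); [ring|].
    replace (q * ys) with (K * ys + K * (2 + e)) by lra. field. lra.
Qed.

Lemma exp_source_ratio (kap t : R) : 0 <= kap -> 0 < w kap (exp t) ->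
  exp (q * amplitude kap t - K * flux kap t) = p / xs * (pw (w kap (exp t)) q / M kap (exp t)).
Proof.
  intros Hk Hw. pose proof (exp_pos t) as Ht.
  pose proof (M_pos kap (exp t) Hk ltac:(lra)) as HM.
  rewrite pw_pos_eq by exact Hw. unfold Rpower, amplitude, flux.
  replace (q * (ln (w kap (exp t)) + ys * t) - K * (/ K * (ln (xs / p) + ln (M kap (exp t)) + q * ys * t)))
    with (q * ln (w kap (exp t)) + - (ln (xs / p) + ln (M kap (exp t)))) by (field; lra).
  rewrite exp_plus, exp_Ropp, exp_plus, !exp_ln; try assumption.
  - field. repeat split; lra.
  - apply Rdiv_lt_0_compat; lra.
Qed.

Lemma orbit_equations (kap t : R) : 0 <= kap -> 0 < w kap (exp t) ->
  is_derive (amplitude kap) t (ys * (1 - exp (flux kap t - amplitude kap t))) /\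
  is_derive (flux kap) t (xs / K * (Thk kap t * exp (q * amplitude kap t - K * flux kap t) - 1)).
Proof.
  intros Hk Hw. pose proof (exp_pos t) as Ht.
  pose proof (M_pos kap (exp t) Hk ltac:(lra)) as HM.
  pose proof (w_derive kap (exp t) Hk) as Hdw.
  pose proof (M_derive kap (exp t) Hk Ht) as HdM.
  pose proof (speed_ratio kap t Hk Hw) as Hsp.
  split.
  - unfold amplitude at 1.
    assert (Hder : is_derive (fun t => ln (w kap (exp t)) + ys * t) t
      (exp t * - speed p e (/ K) c2 q th kap (w kap) (exp t) / w kap (exp t) + ys)).
    { set (W := w kap) in *. clearbody W. auto_derive.
      - split; [eexists; exact Hdw|]. split; [exact Hw|trivial].
      - rewrite_derive Hdw. field. lra. }
    evar_last; [exact Hder|].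
    replace (exp t * - speed p e (/ K) c2 q th kap (w kap) (exp t) / w kap (exp t))
      with (- (exp t * speed p e (/ K) c2 q th kap (w kap) (exp t)) / w kap (exp t)) by (field; lra).
    rewrite Hsp. field. lra.
  - unfold flux at 1.
    assert (Hder : is_derive (fun t => / K * (ln (xs / p) + ln (M kap (exp t)) + q * ys * t)) t
      (/ K * (p * (source q th kap (w kap) (exp t) - M kap (exp t)) / M kap (exp t) + q * ys))).
    { set (MM := M kap) in *. clearbody MM. auto_derive.
      - split; [eexists; exact HdM|]. split; [exact HM|trivial].
      - rewrite_derive HdM. field. repeat split; lra. }
    evar_last; [exact Hder|].
    rewrite (exp_source_ratio kap t Hk Hw). unfold source. fold (Thk kap t). rewrite Hequil. field. repeat split; lra.
Qed.

Lemma Thk_weight (kap : R) : 0 <= kap ->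
  weight (Thk kap) (fun t => if Rlt_dec 0 kap then dth (kap * exp t) * (kap * exp t) else 0).
Proof.
  intros Hk. split.
  - intros t. apply th_range.
  - intros t. apply th_range.
  - intros t. destruct (Rlt_dec 0 kap) as [Hk0|Hk0].
    + pose proof (exp_pos t) as Ht.
      pose proof (th_derive (kap * exp t) ltac:(apply Rmult_lt_0_compat; lra)) as Hd.
      evar_last.
      * apply (is_derive_comp th (fun t => kap * exp t)); [exact Hd|].
        auto_derive; [trivial|reflexivity].
      * unfold scal; simpl; unfold mult; simpl. ring.
    + assert (kap = 0) as -> by lra. apply (is_derive_ext (fun _ => 1)).
      * intros x. unfold Thk. rewrite Rmult_0_l. symmetry. exact th_zero.
      * apply (is_derive_const (V := R_NormedModule)).
  - intros t. destruct (Rlt_dec 0 kap) as [Hk0|Hk0]; [|lra].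
    pose proof (exp_pos t).
    assert (Hx : 0 < kap * exp t) by (apply Rmult_lt_0_compat; lra).
    pose proof (th_slope (kap * exp t) Hx). nra.
Qed.

Lemma ln_nonpos (x : R) : x <= 1 -> ln x <= 0.
Proof.
  intros H. destruct (Rle_dec x 0).
  - unfold ln. destruct (Rlt_dec 0 x); [exfalso; lra|apply Rle_refl].
  - rewrite <- ln_1. apply ln_le; lra.
Qed.

Lemma vanishing_of_linear_bound (f : R -> R) (c : R) :
  0 < c -> (forall t, f t <= c * t) -> vanishing f.
Proof.
  intros Hc Hf eps Heps. exists (ln eps / c). intros t Ht.
  rewrite <- (exp_ln eps Heps). apply exp_le_compat.
  eapply Rle_trans; [apply Hf|].
  apply Rle_trans with (c * (ln eps / c)); [apply Rmult_le_compat_l; lra|right; field; lra].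
Qed.

Lemma amplitude_vanishing (kap : R) : 0 <= kap -> vanishing (amplitude kap).
Proof.
  intros Hk. apply (vanishing_of_linear_bound _ ys Hys). intros t. unfold amplitude.
  pose proof (exp_pos t). pose proof (ln_nonpos _ (w_le1 kap (exp t) Hk ltac:(lra))). lra.
Qed.

Lemma flux_vanishing (kap : R) : 0 <= kap -> vanishing (flux kap).
Proof.
  intros Hk. apply (vanishing_of_linear_bound _ (/ K * (q * ys))).
  { apply Rmult_lt_0_compat; [apply invK_range|]. nra. }
  intros t. unfold flux.
  pose proof (exp_pos t). pose proof (ln_nonpos _ (M_le1 kap (exp t) Hk ltac:(lra))).
  assert (ln (xs / p) <= 0).
  { apply ln_nonpos. apply Rmult_le_reg_r with p; [exact Hp|].
    unfold Rdiv. rewrite Rmult_assoc, Rinv_l by lra. nra. }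
  rewrite (Rmult_assoc (/ K)). apply Rmult_le_compat_l; [left; apply invK_range|]. lra.
Qed.

(** A zero of [w] is impossible: up to it the energy bounds the logarithmic slope. *)
Lemma w_pos (kap s : R) : 0 <= kap -> 0 <= s -> 0 < w kap s.
Proof.
  intros Hk Hs. apply Rnot_le_lt; intro Hneg.
  set (E := fun x => 0 <= x /\ 0 < w kap x).
  destruct (completeness E) as [z [Hz1 Hz2]].
  - exists s. intros x [Hx0 Hx]. apply Rnot_lt_le; intro Hl.
    pose proof (w_nonincreasing kap s x Hk ltac:(lra)). lra.
  - exists 0. split; [lra|]. rewrite w_zero. lra.
  - assert (Hbefore : forall y, 0 <= y -> y < z -> 0 < w kap y).
    { intros y Hy Hyz. apply Rnot_le_lt; intro Hl.
      assert (z <= y); [|lra]. apply Hz2. intros x [Hx0 Hx]. apply Rnot_lt_le; intro Hl2.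
      pose proof (w_nonincreasing kap y x Hk ltac:(lra)). lra. }
    assert (Hnbhd : forall y, 0 < w kap y -> exists d, 0 < d /\ forall x, Rabs (x - y) < d -> 0 < w kap x).
    { intros y Hy.
      destruct (proj1 (filterlim_locally (w kap) (w kap y)) (w_continuous kap y Hk) (mkposreal _ Hy)) as [d Hd].
      exists d. split; [apply cond_pos|]. intros x Hx. specialize (Hd x Hx).
      unfold_ball_in Hd.
      apply Rabs_lt_between in Hd. lra. }
    assert (Hz0 : 0 < z).
    { destruct (Hnbhd 0) as [d [Hd H]]; [rewrite w_zero; lra|].
      apply Rlt_le_trans with (d / 2); [lra|]. apply Hz1. split; [lra|]. apply H.
      rewrite Rminus_0_r, Rabs_pos_eq; lra. }
    assert (Hwz : w kap z <= 0).
    { apply Rnot_lt_le; intro Hl. destruct (Hnbhd z Hl) as [d [Hd H]].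
      assert (z + d / 2 <= z); [|lra]. apply Hz1. split; [lra|]. apply H.
      replace (z + d / 2 - z) with (d / 2) by ring. rewrite Rabs_pos_eq; lra. }
    set (D := fun t => t < ln z).
    assert (HD : forall t, D t -> 0 < w kap (exp t)).
    { intros t Ht. apply Hbefore; [left; apply exp_pos|].
      rewrite <- (exp_ln z Hz0). apply exp_increasing. exact Ht. }
    assert (Horb : orbit (Thk kap) D (amplitude kap) (flux kap)).
    { intros t Ht. apply orbit_equations; [exact Hk|now apply HD]. }
    set (Y := slope_bound).
    assert (Hslope : forall t, D t -> exp (flux kap t - amplitude kap t) <= Y).
    { intros t Ht. apply (slope_bounded (Thk kap t)); [apply th_range|].
      apply (energy_nonpos _ _ (Thk_weight kap Hk) D _ _ t Horb
        (amplitude_vanishing kap Hk) (flux_vanishing kap Hk)).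
      intros x Hx. unfold D in *. lra. }
    set (t0 := ln z - 1).
    set (c := amplitude kap t0 - ys * Rabs Y - ys * Rabs (ln z) - ys).
    assert (Hlow : forall t, t0 <= t < ln z -> c <= ln (w kap (exp t))).
    { intros t Ht.
      assert (Ha : amplitude kap t0 + ys * Y * t0 <= amplitude kap t + ys * Y * t).
      { apply (nondecreasing_of_derive (fun t => amplitude kap t + ys * Y * t)
          (fun t => ys * (1 - exp (flux kap t - amplitude kap t)) + ys * Y)); [lra| |].
        - intros x Hx. destruct (Horb x ltac:(unfold D; lra)) as [Hda _].
          apply (is_derive_plus (V := R_NormedModule) (amplitude kap)); [exact Hda|].
          auto_derive; [trivial|ring].
        - intros x Hx. pose proof (Hslope x ltac:(unfold D; lra)). nra. }
      unfold amplitude in Ha at 2. unfold c.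
      pose proof (Rle_abs Y). pose proof (Rle_abs (ln z)). pose proof (Rabs_pos Y). pose proof (Rabs_pos (ln z)).
      assert (ys * Y * (t - t0) <= ys * Rabs Y).
      { unfold t0 in *. assert (ys * Y <= ys * Rabs Y) by (apply Rmult_le_compat_l; lra).
        assert (0 <= ys * Rabs Y) by (apply Rmult_le_pos; lra).
        apply Rle_trans with (ys * Rabs Y * (t - (ln z - 1))); [apply Rmult_le_compat_r; lra|]. nra. }
      assert (ys * t <= ys * Rabs (ln z)) by (apply Rmult_le_compat_l; lra).
      lra. }
    assert (Hexpc : 0 < exp c) by apply exp_pos.
    destruct (proj1 (filterlim_locally (w kap) (w kap z)) (w_continuous kap z Hk) (mkposreal _ Hexpc)) as [d Hd].
    set (t := ln (Rmax (exp t0) (z - d / 2))).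
    assert (Hdp : 0 < d) by apply cond_pos.
    assert (Hexpt : exp t = Rmax (exp t0) (z - d / 2)).
    { apply exp_ln. eapply Rlt_le_trans; [apply exp_pos|apply Rmax_l]. }
    assert (Ht0z : exp t0 < z).
    { rewrite <- (exp_ln z Hz0). apply exp_increasing. unfold t0. lra. }
    assert (Hmax : Rmax (exp t0) (z - d / 2) < z) by (apply Rmax_lub_lt; lra).
    assert (Ht : t0 <= t < ln z).
    { split.
      - rewrite <- (ln_exp t0). apply ln_le; [apply exp_pos|apply Rmax_l].
      - apply ln_increasing; [|exact Hmax]. rewrite <- Hexpt. apply exp_pos. }
    specialize (Hlow t Ht).
    pose proof (HD t (proj2 Ht)) as Hwt.
    apply exp_le_compat in Hlow. rewrite (exp_ln _ Hwt) in Hlow.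
    pose proof (Rmax_r (exp t0) (z - d / 2)).
    specialize (Hd (exp t)).
    unfold_ball_in Hd.
    assert (Hdist : Rabs (exp t + - z) < d) by (rewrite Hexpt; apply Rabs_lt_between; lra).
    specialize (Hd Hdist). apply Rabs_lt_between in Hd. lra.
Qed.

Lemma regular_orbit (kap : R) : 0 <= kap ->
  orbit (Thk kap) (fun _ => True) (amplitude kap) (flux kap).
Proof.
  intros Hk t _. apply orbit_equations; [exact Hk|].
  apply w_pos; [exact Hk|left; apply exp_pos].
Qed.

Lemma regular_source_bound (kap t : R) : 0 <= kap ->
  Thk kap t * exp (q * amplitude kap t - K * flux kap t) <= p / xs.
Proof.
  intros Hk. pose proof (exp_pos t) as Ht.
  pose proof (w_pos kap (exp t) Hk ltac:(lra)) as Hw.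
  pose proof (M_pos kap (exp t) Hk ltac:(lra)) as HM.
  rewrite (exp_source_ratio kap t Hk Hw).
  pose proof (source_le_mean kap (exp t) Hk ltac:(lra)) as Hs. unfold source in Hs. fold (Thk kap t) in Hs.
  replace (Thk kap t * (p / xs * (pw (w kap (exp t)) q / M kap (exp t))))
    with (p / xs * (Thk kap t * pw (w kap (exp t)) q / M kap (exp t))) by (field; lra).
  rewrite <- (Rmult_1_r (p / xs)) at 2. apply Rmult_le_compat_l; [left; apply Rdiv_lt_0_compat; lra|].
  apply Rmult_le_reg_r with (M kap (exp t)); [exact HM|].
  unfold Rdiv. rewrite Rmult_assoc, Rinv_l; lra.
Qed.

(** ** Dependence on the scale *)

Lemma th_uniform (km S : R) (eps : posreal) : 0 <= km -> 0 <= S -> exists d, 0 < d /\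
  forall k1 k2, 0 <= k1 <= km -> 0 <= k2 <= km -> Rabs (k1 - k2) < d ->
  forall x, 0 <= x <= S -> Rabs (th (k1 * x) - th (k2 * x)) <= eps.
Proof.
  intros Hkm HS.
  destruct (@Heine_cor2 th 0 (km * S) (fun x _ => proj2 (continuity_pt_filterlim th x) (th_cont x)) eps) as [d Hd].
  exists (d / (S + 1)). split; [apply Rdiv_lt_0_compat; [apply cond_pos|lra]|].
  intros k1 k2 Hk1 Hk2 Hk x Hx. left. apply Hd.
  - split; [apply Rmult_le_pos; lra|]. apply Rmult_le_compat; lra.
  - split; [apply Rmult_le_pos; lra|]. apply Rmult_le_compat; lra.
  - replace (k1 * x - k2 * x) with ((k1 - k2) * x) by ring.
    rewrite Rabs_mult, (Rabs_pos_eq x) by lra.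
    apply Rle_lt_trans with (Rabs (k1 - k2) * (S + 1)).
    + apply Rmult_le_compat_l; [apply Rabs_pos|lra].
    + apply Rlt_le_trans with (d / (S + 1) * (S + 1)); [apply Rmult_lt_compat_r; lra|right; field; lra].
Qed.

Lemma w_uniform (km S : R) (eps : R) : 0 <= km -> 0 <= S -> 0 < eps -> exists d, 0 < d /\
  forall k1 k2, 0 <= k1 <= km -> 0 <= k2 <= km -> Rabs (k1 - k2) < d ->
  forall x, 0 <= x <= S -> Rabs (w k1 x - w k2 x) <= eps.
Proof.
  intros Hkm HS Heps.
  destruct (sol_stability p e (/ K) c2 q Hp He invK_range unit_speed_pos q_ge1 th th_cont th_range th_mono S km HS Hkm)
    as [D [HD Hst]].
  assert (HeD : 0 < eps / D) by (apply Rdiv_lt_0_compat; lra).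
  destruct (th_uniform km S (mkposreal _ HeD) Hkm HS) as [d [Hd H]].
  exists d. split; [exact Hd|]. intros k1 k2 Hk1 Hk2 Hk x Hx.
  eapply Rle_trans; [apply (Hst k1 k2 (eps / D) Hk1 Hk2 ltac:(lra) (H k1 k2 Hk1 Hk2 Hk) x Hx)|].
  right. field. lra.
Qed.

Lemma M_uniform (km S : R) (eps : R) : 0 <= km -> 0 <= S -> 0 < eps -> exists d, 0 < d /\
  forall k1 k2, 0 <= k1 <= km -> 0 <= k2 <= km -> Rabs (k1 - k2) < d ->
  forall x, 0 <= x <= S -> Rabs (M k1 x - M k2 x) <= eps.
Proof.
  intros Hkm HS Heps.
  destruct (w_uniform km S (eps / (2 * q)) Hkm HS ltac:(apply Rdiv_lt_0_compat; lra)) as [d1 [Hd1 H1]].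
  destruct (th_uniform km S (mkposreal (eps / 2) ltac:(lra)) Hkm HS) as [d2 [Hd2 H2]].
  exists (Rmin d1 d2). split; [apply Rmin_pos; assumption|].
  intros k1 k2 Hk1 Hk2 Hk x Hx.
  pose proof (Rmin_l d1 d2). pose proof (Rmin_r d1 d2).
  pose proof (mean_source_diff p c2 q Hp q_ge1 th th_cont th_range k1 k2 (w k1) (w k2) x (eps / (2 * q)) 0 (eps / 2)
    (w_admissible k1 ltac:(lra)) (w_admissible k2 ltac:(lra)) ltac:(lra)) as Hm.
  rewrite Rmult_0_l, exp_0, Rmult_1_r in Hm.
  replace (q * (eps / (2 * q)) + eps / 2) with eps in Hm by (field; lra).
  apply Hm; try lra.
  - left. apply Rdiv_lt_0_compat; lra.
  - intros y Hy. rewrite Rmult_0_l, exp_0, Rmult_1_r. apply H1; try assumption; lra.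
  - intros y Hy. simpl in H2. apply H2; try assumption; lra.
Qed.

Lemma ln_near (x0 eps : R) : 0 < x0 -> 0 < eps -> exists d, 0 < d /\ forall x, Rabs (x - x0) <= d -> Rabs (ln x - ln x0) <= eps.
Proof.
  intros Hx He'.
  assert (Hc : continuous ln x0).
  { apply (continuous_of_ex_derive ln). auto_derive. exact Hx. }
  destruct (proj1 (filterlim_locally ln (ln x0)) Hc (mkposreal eps He')) as [d Hd].
  exists (d / 2). split; [destruct d; simpl; lra|].
  intros x Hxd. left. apply Hd.
  unfold_ball.
  unfold Rminus in Hxd. destruct d; simpl in *; lra.
Qed.

(** As the scale tends to 0, the orbits converge to the one of the pure power weight. *)
Lemma scale_limit (s eps : R) : 0 < eps -> exists T, forall tau, tau <= T ->
  Rabs (amplitude (exp tau) s - amplitude 0 s) <= eps /\ Rabs (flux (exp tau) s - flux 0 s) <= eps.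
Proof.
  intros Heps. pose proof (exp_pos s) as Hs.
  destruct (ln_near (w 0 (exp s)) eps (w_pos 0 (exp s) ltac:(lra) ltac:(lra)) Heps) as [e1 [He1 L1]].
  destruct (ln_near (M 0 (exp s)) eps (M_pos 0 (exp s) ltac:(lra) ltac:(lra)) Heps) as [e2 [He2 L2]].
  destruct (w_uniform 1 (exp s) e1 ltac:(lra) ltac:(lra) He1) as [d1 [Hd1 U1]].
  destruct (M_uniform 1 (exp s) e2 ltac:(lra) ltac:(lra) He2) as [d2 [Hd2 U2]].
  set (d := Rmin 1 (Rmin d1 d2)).
  assert (Hd : 0 < d) by (unfold d; repeat apply Rmin_pos; lra).
  exists (ln (d / 2)). intros tau Htau.
  assert (Hk : 0 < exp tau <= d / 2).
  { split; [apply exp_pos|]. rewrite <- (exp_ln (d / 2)) by lra. now apply exp_le_compat. }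
  assert (Hdd : d <= 1 /\ d <= d1 /\ d <= d2).
  { unfold d. pose proof (Rmin_l 1 (Rmin d1 d2)). pose proof (Rmin_r 1 (Rmin d1 d2)).
    pose proof (Rmin_l d1 d2). pose proof (Rmin_r d1 d2). lra. }
  assert (Habs : Rabs (exp tau - 0) < Rmin d1 d2).
  { rewrite Rminus_0_r, Rabs_pos_eq by lra. apply Rmin_glb_lt; lra. }
  pose proof (Rmin_l d1 d2). pose proof (Rmin_r d1 d2).
  split.
  - unfold amplitude.
    replace (ln (w (exp tau) (exp s)) + ys * s - (ln (w 0 (exp s)) + ys * s))
      with (ln (w (exp tau) (exp s)) - ln (w 0 (exp s))) by ring.
    apply L1, U1; lra.
  - unfold flux.
    replace (/ K * (ln (xs / p) + ln (M (exp tau) (exp s)) + q * ys * s) - / K * (ln (xs / p) + ln (M 0 (exp s)) + q * ys * s))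
      with (/ K * (ln (M (exp tau) (exp s)) - ln (M 0 (exp s)))) by ring.
    pose proof invK_range as HiK.
    rewrite Rabs_mult, (Rabs_pos_eq (/ K)) by lra.
    assert (Rabs (ln (M (exp tau) (exp s)) - ln (M 0 (exp s))) <= eps) by (apply L2, U2; lra).
    pose proof (Rabs_pos (ln (M (exp tau) (exp s)) - ln (M 0 (exp s)))). nra.
Qed.

Lemma endpoint_continuous (tau : R) : continuous (fun tau => amplitude (exp tau) (- tau)) tau.
Proof.
  apply filterlim_locally. intros eps.
  pose proof (exp_pos tau) as Hk. pose proof (exp_pos (- tau)) as Hs.
  set (x0 := w (exp tau) (exp (- tau))).
  assert (Hx0 : 0 < x0) by (apply w_pos; lra).
  destruct (ln_near x0 (eps / 4) Hx0 ltac:(destruct eps; simpl; lra)) as [e1 [He1 L1]].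
  set (S := exp (- tau + 1)). set (km := exp (tau + 1)).
  assert (HS : 0 < S) by apply exp_pos. assert (Hkm : 0 < km) by apply exp_pos.
  destruct (w_uniform km S (e1 / 2) ltac:(lra) ltac:(lra) ltac:(lra)) as [d1 [Hd1 U1]].
  assert (Hc1 : continuous (fun t => exp t) tau).
  { apply (continuous_of_ex_derive (fun t => exp t)). auto_derive. trivial. }
  assert (Hc2 : continuous (fun t => w (exp tau) (exp (- t))) tau).
  { apply (continuous_comp (fun t => exp (- t)) (w (exp tau))).
    - apply (continuous_of_ex_derive (fun t => exp (- t))). auto_derive. trivial.
    - apply w_continuous. lra. }
  destruct (proj1 (filterlim_locally _ _) Hc1 (mkposreal d1 Hd1)) as [d2 H2].
  destruct (proj1 (filterlim_locally _ _) Hc2 (mkposreal (e1 / 2) ltac:(lra))) as [d3 H3].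
  set (d := Rmin (Rmin 1 (eps / (4 * ys))) (Rmin d2 d3)).
  assert (Hd : 0 < d).
  { unfold d. repeat apply Rmin_pos; try apply cond_pos; try lra. apply Rdiv_lt_0_compat; [apply cond_pos|lra]. }
  exists (mkposreal d Hd). intros t Ht.
  unfold_ball_all.
  assert (Hdd : d <= 1 /\ d <= eps / (4 * ys) /\ d <= d2 /\ d <= d3).
  { unfold d. pose proof (Rmin_l (Rmin 1 (eps / (4 * ys))) (Rmin d2 d3)).
    pose proof (Rmin_r (Rmin 1 (eps / (4 * ys))) (Rmin d2 d3)).
    pose proof (Rmin_l 1 (eps / (4 * ys))). pose proof (Rmin_r 1 (eps / (4 * ys))).
    pose proof (Rmin_l d2 d3). pose proof (Rmin_r d2 d3). lra. }
  destruct Hdd as [D1 [D2 [D3 D4]]].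
  specialize (H2 t ltac:(lra)). specialize (H3 t ltac:(lra)).
  apply Rabs_lt_between in Ht.
  assert (Hw : Rabs (w (exp t) (exp (- t)) - x0) <= e1).
  { replace (w (exp t) (exp (- t)) - x0) with
      ((w (exp t) (exp (- t)) - w (exp tau) (exp (- t))) + (w (exp tau) (exp (- t)) - x0)) by ring.
    eapply Rle_trans; [apply Rabs_triang|].
    assert (Rabs (w (exp t) (exp (- t)) - w (exp tau) (exp (- t))) <= e1 / 2).
    { pose proof (exp_pos t). pose proof (exp_pos (- t)).
      apply U1.
      - split; [lra|]. apply exp_le_compat. lra.
      - split; [lra|]. apply exp_le_compat. lra.
      - exact H2.
      - split; [lra|]. apply exp_le_compat. lra. }
    unfold x0, Rminus in *. lra. }
  specialize (L1 _ Hw). unfold amplitude. fold x0.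
  replace (ln (w (exp t) (exp (- t))) + ys * - t + - (ln x0 + ys * - tau))
    with ((ln (w (exp t) (exp (- t))) - ln x0) + - (ys * (t + - tau))) by ring.
  eapply Rle_lt_trans; [apply Rabs_triang|].
  rewrite Rabs_Ropp, Rabs_mult, (Rabs_pos_eq ys) by lra.
  assert (ys * Rabs (t + - tau) <= ys * (eps / (4 * ys))).
  { apply Rmult_le_compat_l; [lra|]. apply Rabs_le; lra. }
  replace (ys * (eps / (4 * ys))) with (eps / 4) in * by (field; lra).
  destruct eps as [eps Heps']; simpl in *; lra.
Qed.

(** ** Second derivative *)

Let spd (kap : R) : R -> R := speed p e (/ K) c2 q th kap (w kap).

(** The derivative of [spd], written without division by [s], so that it is continuous
    up to the origin. *)
Definition accel (kap s : R) : R :=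
  c2 * (pw s e * ((1 + e) * pw (M kap s) (/ K)
    + p * / K * pw (M kap s) (/ K - 1) * (source q th kap (w kap) s - M kap s))).

Lemma speed_pos (kap s : R) : 0 <= kap -> 0 < s -> 0 < spd kap s.
Proof.
  intros Hk Hs. pose proof (M_pos kap s Hk ltac:(lra)) as HM.
  unfold spd, speed. apply Rmult_lt_0_compat; [apply unit_speed_pos|].
  apply Rmult_lt_0_compat; [apply Rmult_lt_0_compat; [exact Hs|now apply pw_gt0]|].
  apply pw_gt0. exact HM.
Qed.

Lemma M_zero (kap : R) : 0 <= kap -> M kap 0 = source q th kap (w kap) 0.
Proof.
  intros Hk. unfold M, mean_source. rewrite (pw_nonpos 0 p) by lra.
  unfold avg. destruct (Rlt_dec 0 0); [lra|].
  rewrite (pw_nonpos 0 (/ p)); [reflexivity|lra|now apply Rinv_0_lt_compat].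
Qed.

Lemma derive_id_mult_zero (f : R -> R) : continuous f 0 -> is_derive (fun x => x * f x) 0 (f 0).
Proof.
  intros Hf. apply is_derive_Reals. intros eps Heps.
  destruct (proj1 (filterlim_locally f (f 0)) Hf (mkposreal eps Heps)) as [d Hd].
  exists d. intros h Hh Hhd. rewrite Rplus_0_l, Rmult_0_l.
  replace ((h * f h - 0) / h - f 0) with (f h - f 0) by (field; exact Hh).
  apply Hd. unfold_ball.
  rewrite Ropp_0, Rplus_0_r. exact Hhd.
Qed.

Lemma speed_derive (kap s : R) : 0 <= kap -> 0 <= s -> is_derive (spd kap) s (accel kap s).
Proof.
  intros Hk [Hs|<-].
  - pose proof (M_pos kap s Hk ltac:(lra)) as HM.
    pose proof (M_derive kap s Hk Hs) as HdM.
    pose proof (pw_derive s e Hs) as Hde.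
    assert (HdMr : is_derive (fun s => pw (M kap s) (/ K)) s
      (p * (source q th kap (w kap) s - M kap s) / s * (/ K * pw (M kap s) (/ K - 1)))).
    { apply (is_derive_comp (fun x => pw x (/ K)) (M kap)); [now apply pw_derive|exact HdM]. }
    set (A := fun s => pw s e) in *. set (B := fun s => pw (M kap s) (/ K)) in *.
    assert (Hder : is_derive (fun s => c2 * (s * A s * B s)) s
      (c2 * ((A s + s * (e * pw s (e - 1))) * B s
        + s * A s * (p * (source q th kap (w kap) s - M kap s) / s * (/ K * pw (M kap s) (/ K - 1)))))).
    { match type of Hde with is_derive _ s ?l => change (is_derive A s l) in Hde end.
      match type of HdMr with is_derive _ s ?l => change (is_derive B s l) in HdMr end.
      set (a1 := e * pw s (e - 1)) in *.
      set (b1 := p * (source q th kap (w kap) s - M kap s) / s * (/ K * pw (M kap s) (/ K - 1))) in *.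
      clearbody A B a1 b1. auto_derive.
      - repeat split; first [eexists; exact Hde | eexists; exact HdMr].
      - rewrite_derive Hde. rewrite_derive HdMr. ring. }
    evar_last; [exact Hder|].
    unfold accel, A, B.
    replace (pw s (e - 1)) with (pw s e / s).
    + field. split; lra.
    + rewrite !pw_pos_eq by assumption. unfold Rminus.
      rewrite Rpower_plus, (Rpower_Ropp s 1), Rpower_1 by assumption. reflexivity.
  - apply (is_derive_ext (fun s => s * (c2 * (pw s e * pw (M kap s) (/ K))))).
    { intros s. unfold spd, speed. fold (M kap s).
      change (@eq R (s * (c2 * (pw s e * pw (M kap s) (/ K)))) (c2 * (s * pw s e * pw (M kap s) (/ K)))). ring. }
    replace (accel kap 0) with (c2 * (pw 0 e * pw (M kap 0) (/ K))).
    + apply (derive_id_mult_zero (fun s => c2 * (pw s e * pw (M kap s) (/ K)))).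
      apply (continuous_scal_r (V := R_NormedModule) c2 (fun s => pw s e * pw (M kap s) (/ K))).
      apply (continuous_mult (K := R_AbsRing) (fun s => pw s e)).
      * now apply pw_continuous.
      * apply (continuous_comp (M kap) (fun x => pw x (/ K))); [now apply M_continuous|].
        apply pw_continuous. left. apply invK_range.
    + unfold accel. rewrite <- (M_zero kap Hk), Rminus_diag, Rmult_0_r, Rplus_0_r.
      destruct He as [He0|He0].
      * rewrite (pw_nonpos 0 e) by lra. ring.
      * rewrite <- He0. ring.
Qed.

Lemma accel_continuous (kap s : R) : 0 <= kap -> 0 <= s -> continuous (accel kap) s.
Proof.
  intros Hk Hs. pose proof (M_pos kap s Hk Hs) as HM.
  apply (continuous_scal_r (V := R_NormedModule) c2 (fun s => pw s e * ((1 + e) * pw (M kap s) (/ K)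
    + p * / K * pw (M kap s) (/ K - 1) * (source q th kap (w kap) s - M kap s)))).
  apply (continuous_mult (K := R_AbsRing) (fun s => pw s e)); [now apply pw_continuous|].
  apply (continuous_plus (V := R_NormedModule) (fun s => (1 + e) * pw (M kap s) (/ K))).
  - apply (continuous_scal_r (V := R_NormedModule) (1 + e) (fun s => pw (M kap s) (/ K))).
    apply (continuous_comp (M kap) (fun x => pw x (/ K))); [now apply M_continuous|].
    apply pw_continuous. left. apply invK_range.
  - apply (continuous_mult (K := R_AbsRing) (fun s => p * / K * pw (M kap s) (/ K - 1))).
    + apply (continuous_scal_r (V := R_NormedModule) (p * / K) (fun s => pw (M kap s) (/ K - 1))).
      apply (continuous_comp (M kap) (fun x => pw x (/ K - 1))); [now apply M_continuous|].
      apply (continuous_of_ex_derive (fun x => pw x (/ K - 1))).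
      eexists. now apply pw_derive.
    + apply (continuous_minus (V := R_NormedModule) (source q th kap (w kap)) (M kap)).
      * apply (source_continuous q q_ge1 th th_cont). intros x. now apply w_continuous.
      * now apply M_continuous.
Qed.

Lemma accel_ratio (kap s : R) : 0 <= kap -> 0 < s ->
  s * accel kap s = spd kap s * ((1 + e) + p / K * (source q th kap (w kap) s / M kap s - 1)).
Proof.
  intros Hk Hs. pose proof (M_pos kap s Hk ltac:(lra)) as HM.
  unfold accel, spd, speed. fold (M kap s).
  replace (pw (M kap s) (/ K - 1)) with (pw (M kap s) (/ K) / M kap s).
  - field. split; lra.
  - rewrite !pw_pos_eq by assumption. unfold Rminus.
    rewrite Rpower_plus, (Rpower_Ropp (M kap s) 1), Rpower_1 by assumption. reflexivity.
Qed.

Lemma w_decreasing (kap s t : R) : 0 <= kap -> 0 <= s < t -> w kap t < w kap s.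
Proof.
  intros Hk [Hs Hst].
  destruct (MVT_cor2 (w kap) (fun x => - spd kap x) s t Hst) as [c [Hc Hin]].
  - intros x _. apply is_derive_Reals. now apply w_derive.
  - pose proof (speed_pos kap c Hk ltac:(lra)). nra.
Qed.

(** ** Solutions of the boundary value problem *)

Section Solutions.

Variables (k n : nat) (l d : R) (rho : R -> R).
Hypothesis Hk0 : (0 < k)%nat.
Hypothesis Hkn : (2 * k < n)%nat.
Hypothesis HKk : K = INR k.
Hypothesis Hpn : p = INR n + l.
Hypothesis Hel : K * e = l.
Hypothesis Hl : 0 <= l.
Hypothesis Hd : 0 < d.
Hypothesis Hth : forall r, 0 < r -> th r = Rpower r (- l) * rho r / d.

Definition solution (kap r : R) : R := 1 - w kap (r / kap) / w kap (/ kap).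

(** The value of the parameter at which the rescaled and normalised [w] solves the
    boundary value problem; it depends on the scale only through the amplitude at the
    boundary point. *)
Definition parameter (kap : R) : R :=
  c_nk n k * (xs * ys ^ k / d) * exp ((q - K) * amplitude kap (- ln kap)).

Section Scale.

Variable kap : R.
Hypothesis Hkap : 0 < kap.

Let w1 : R := w kap (/ kap).
Let du (r : R) : R := / (kap * w1) * spd kap (r / kap).
Let ddu (r : R) : R := / (kap * w1) * (/ kap * accel kap (r / kap)).

Lemma w1_pos : 0 < w1.
Proof. apply w_pos; [lra|]. left. now apply Rinv_0_lt_compat. Qed.

Lemma rescaling_derive (r : R) : is_derive (fun r => r / kap) r (/ kap).
Proof. auto_derive; [trivial|]. field. lra. Qed.

Lemma solution_derive (r : R) : is_derive (solution kap) r (du r).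
Proof.
  pose proof w1_pos as Hw1.
  apply (is_derive_ext (fun r => 1 - / w1 * w kap (r / kap))).
  { intros x. unfold solution. fold w1. change (@eq R (1 - / w1 * w kap (x / kap)) (1 - w kap (x / kap) / w1)).
    field. lra. }
  replace (du r) with (0 - / w1 * (/ kap * - spd kap (r / kap))) by (unfold du; field; lra).
  apply (is_derive_minus (V := R_NormedModule) (fun _ => 1)).
  - apply (is_derive_const (V := R_NormedModule)).
  - apply is_derive_scal.
    apply (is_derive_comp (w kap) (fun r => r / kap)); [apply w_derive; lra|apply rescaling_derive].
Qed.

Lemma rescaled_nonneg (r : R) : 0 <= r -> 0 <= r / kap.
Proof. intros Hr. apply Rmult_le_pos; [exact Hr|]. left. now apply Rinv_0_lt_compat. Qed.

Lemma slope_derive (r : R) : 0 <= r -> is_derive du r (ddu r).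
Proof.
  intros Hr. apply is_derive_scal.
  apply (is_derive_comp (spd kap) (fun r => r / kap)); [|apply rescaling_derive].
  apply speed_derive; [lra|now apply rescaled_nonneg].
Qed.

Lemma solution_C1 (D : R -> Prop) : (forall r, D r -> 0 <= r) -> C_on 1 D (solution kap).
Proof.
  intros HD. exists du. split.
  - intros r Hr. apply is_derive_on_of_is_derive; [exact Hr|apply solution_derive].
  - apply continuous_on_of_continuous. intros r Hr.
    apply (continuous_of_ex_derive du).
    eexists. apply slope_derive. now apply HD.
Qed.

Lemma solution_C2 (D : R -> Prop) : (forall r, D r -> 0 <= r) -> C_on 2 D (solution kap).
Proof.
  intros HD. exists du. split.
  - intros r Hr. apply is_derive_on_of_is_derive; [exact Hr|apply solution_derive].
  - exists ddu. split.
    + intros r Hr. apply is_derive_on_of_is_derive; [exact Hr|]. apply slope_derive. now apply HD.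
    + apply continuous_on_of_continuous. intros r Hr.
      apply (continuous_scal_r (V := R_NormedModule) (/ (kap * w1)) (fun r => / kap * accel kap (r / kap))).
      apply (continuous_scal_r (V := R_NormedModule) (/ kap) (fun r => accel kap (r / kap))).
      apply (continuous_comp (fun r => r / kap) (accel kap)).
      * apply (continuous_of_ex_derive (fun r => r / kap)).
        eexists. apply rescaling_derive.
      * apply accel_continuous; [lra|]. apply rescaled_nonneg. now apply HD.
Qed.

Lemma Derive_solution (r : R) : Derive (solution kap) r = du r.
Proof. apply is_derive_unique, solution_derive. Qed.

Lemma slope_pos (r : R) : 0 < r -> 0 < du r.
Proof.
  intros Hr. pose proof w1_pos. unfold du.
  apply Rmult_lt_0_compat.
  - apply Rinv_0_lt_compat. now apply Rmult_lt_0_compat.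
  - apply speed_pos; [lra|]. now apply Rdiv_lt_0_compat.
Qed.

(** The value of [r u'' / u']. *)
Let ratio (r : R) : R :=
  (1 + e) + p / K * (source q th kap (w kap) (r / kap) / M kap (r / kap) - 1).

Lemma hessian_derive (i : nat) (r : R) : 0 < r ->
  is_derive (fun s => s ^ (n - i) * Derive (solution kap) s ^ i) r
    (r ^ (n - i) * du r ^ i / r * (INR (n - i) + INR i * ratio r)).
Proof.
  intros Hr.
  apply (is_derive_ext (fun s => s ^ (n - i) * du s ^ i)).
  { intros s. rewrite Derive_solution. reflexivity. }
  pose proof (slope_derive r ltac:(lra)) as Hdu.
  pose proof (slope_pos r Hr) as Hpos.
  assert (Hratio : r * ddu r = du r * ratio r).
  { pose proof (accel_ratio kap (r / kap) ltac:(lra) ltac:(now apply Rdiv_lt_0_compat)) as Ha.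
    fold (ratio r) in Ha. unfold ddu, du.
    replace (r * (/ (kap * w1) * (/ kap * accel kap (r / kap)))) with (/ (kap * w1) * (r / kap * accel kap (r / kap)))
      by (unfold Rdiv; ring).
    rewrite Ha. ring. }
  assert (Hpow : forall (x : R) (m : nat), 0 < x -> INR m * x ^ pred m = INR m * x ^ m / x).
  { intros x [|m] Hx; simpl pred; [simpl; unfold Rdiv; ring|]. simpl pow. field. lra. }
  assert (Hd1 : is_derive (fun s => s ^ (n - i)) r (INR (n - i) * r ^ pred (n - i))).
  { auto_derive; [trivial|ring]. }
  assert (Hd2 : is_derive (fun s => du s ^ i) r (INR i * ddu r * du r ^ pred i)).
  { apply is_derive_pow. exact Hdu. }
  evar_last.
  - apply (is_derive_mult (fun s => s ^ (n - i)) (fun s => du s ^ i)); [exact Hd1|exact Hd2|].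
    intros x y. apply Rmult_comm.
  - unfold plus, mult; simpl. rewrite (Hpow r) by exact Hr.
    replace (INR i * ddu r * du r ^ pred i) with (ddu r * (INR i * du r ^ pred i)) by ring.
    rewrite (Hpow (du r)) by exact Hpos.
    replace (ddu r) with (du r * ratio r / r) by (rewrite <- Hratio; field; lra).
    field. lra.
Qed.

Lemma INR_k_bounds : 2 * K < INR n.
Proof.
  rewrite HKk. apply lt_INR in Hkn. rewrite mult_INR in Hkn. simpl in Hkn. lra.
Qed.

(** The source is positive, so [ratio >= 1 - n / k]; this makes the last factor in
    [hessian_derive] nonnegative for all [i <= k]. *)
Lemma solution_monotone (i : nat) (r : R) : (1 <= i <= k)%nat -> 0 < r ->
  0 <= Derive (fun s => s ^ (n - i) * Derive (solution kap) s ^ i) r.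
Proof.
  intros Hi Hr. pose proof (hessian_derive i r Hr) as Hhd. rewrite_derive Hhd.
  pose proof (slope_pos r Hr) as Hpos.
  apply Rmult_le_pos.
  - apply Rmult_le_pos; [apply Rmult_le_pos; apply pow_le; lra|left; now apply Rinv_0_lt_compat].
  - rewrite minus_INR by lia.
    assert (Hik : INR i <= K) by (rewrite HKk; apply le_INR; lia).
    assert (Hi0 : 0 <= INR i) by apply pos_INR.
    pose proof INR_k_bounds as Hn2.
    pose proof (M_pos kap (r / kap) ltac:(lra) (rescaled_nonneg r ltac:(lra))) as HM.
    assert (Hg : 0 <= source q th kap (w kap) (r / kap) / M kap (r / kap)).
    { apply Rmult_le_pos; [|left; now apply Rinv_0_lt_compat].
      unfold source. apply Rmult_le_pos; [left; apply th_range|apply pw_ge0]. }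
    assert (Hrat : 1 - INR n / K <= ratio r).
    { unfold ratio. replace (1 - INR n / K) with ((1 + e) + p / K * (0 - 1)).
      - assert (0 < p / K) by (apply Rdiv_lt_0_compat; lra). nra.
      - rewrite Hpn, <- Hel. field. lra. }
    apply Rle_trans with (INR n - INR i + INR i * (1 - INR n / K)).
    + replace (INR n - INR i + INR i * (1 - INR n / K)) with (INR n / K * (K - INR i)) by (field; lra).
      apply Rmult_le_pos; [left; apply Rdiv_lt_0_compat; lra|lra].
    + apply Rplus_le_compat_l, Rmult_le_compat_l; assumption.
Qed.

Lemma slope_power (r : R) : 0 < r ->
  du r ^ k = (/ (kap * w1)) ^ k * (ys ^ k * xs / p) * (r / kap) ^ k * Rpower (r / kap) l * M kap (r / kap).
Proof.
  intros Hr.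
  assert (Hs : 0 < r / kap) by now apply Rdiv_lt_0_compat.
  pose proof (M_pos kap (r / kap) ltac:(lra) ltac:(lra)) as HM.
  assert (Hroot : forall x : R, 0 < x -> Rpower x (/ K) ^ k = x).
  { intros x Hx. rewrite <- Rpower_pow by apply Rpower_pos. rewrite Rpower_mult, <- HKk, Rinv_l by lra.
    now apply Rpower_1. }
  unfold du, spd, speed. fold (M kap (r / kap)).
  rewrite (pw_pos_eq (r / kap)), (pw_pos_eq (M kap (r / kap))) by assumption.
  rewrite !Rpow_mult_distr, (Hroot _ HM). unfold c2, unit_speed.
  rewrite Rpow_mult_distr, Hroot by (apply Rdiv_lt_0_compat; lra).
  replace (Rpower (r / kap) e ^ k) with (Rpower (r / kap) l).
  - unfold Rdiv. ring.
  - rewrite <- Rpower_pow by apply Rpower_pos. rewrite Rpower_mult. f_equal. rewrite <- HKk, <- Hel. ring.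
Qed.

Lemma parameter_eq :
  exp ((q - K) * amplitude kap (- ln kap))
  = Rpower w1 q / w1 ^ k / (kap ^ k * kap ^ k * Rpower kap l).
Proof.
  pose proof w1_pos as Hw1.
  unfold amplitude. rewrite exp_Ropp, exp_ln by exact Hkap. fold w1.
  rewrite <- (Rpower_pow k w1 Hw1), <- (Rpower_pow k kap Hkap), <- HKk. unfold Rpower, Rdiv.
  rewrite <- !exp_plus, <- !exp_Ropp, <- !exp_plus. f_equal.
  replace ((q - K) * (ln w1 + ys * - ln kap)) with ((q - K) * ln w1 + - ((q - K) * ys * ln kap)) by ring.
  rewrite Hscaling, <- Hel. ring.
Qed.

Lemma solution_equation (r : R) : 0 < r < 1 ->
  c_nk n k * / r ^ (n - 1) * Derive (fun s => s ^ (n - k) * Derive (solution kap) s ^ k) r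
  = parameter kap * rho r * Rpower (1 - solution kap r) q.
Proof.
  intros [Hr _]. pose proof (hessian_derive k r Hr) as Hhd. rewrite_derive Hhd.
  assert (Hs : 0 < r / kap) by now apply Rdiv_lt_0_compat.
  pose proof (M_pos kap (r / kap) ltac:(lra) ltac:(lra)) as HM.
  pose proof (w_pos kap (r / kap) ltac:(lra) ltac:(lra)) as Hw.
  pose proof w1_pos as Hw1. pose proof INR_k_bounds as Hn2.
  set (g := source q th kap (w kap) (r / kap)).
  assert (Hrat : INR (n - k) + INR k * ratio r = p * (g / M kap (r / kap))).
  { rewrite minus_INR by lia. rewrite <- HKk. unfold ratio. fold g.
    replace (K * (1 + e + p / K * (g / M kap (r / kap) - 1))) with (K + K * e + p * (g / M kap (r / kap) - 1)) by (field; lra).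
    rewrite Hel, Hpn. ring. }
  rewrite Hrat, (slope_power r Hr). unfold parameter. rewrite parameter_eq.
  assert (Hg : g = Rpower r (- l) * rho r / d * Rpower (w kap (r / kap)) q).
  { unfold g, source. replace (kap * (r / kap)) with r by (field; lra).
    rewrite (Hth r Hr), pw_pos_eq by exact Hw. reflexivity. }
  rewrite Hg.
  assert (Hu : Rpower (1 - solution kap r) q = Rpower (w kap (r / kap)) q / Rpower w1 q).
  { unfold solution. fold w1. replace (1 - (1 - w kap (r / kap) / w1)) with (w kap (r / kap) * / w1) by (field; lra).
    rewrite <- Rpower_mult_distr by (try apply Rinv_0_lt_compat; assumption).
    unfold Rdiv. f_equal. unfold Rpower. rewrite ln_Rinv by exact Hw1. rewrite <- exp_Ropp. f_equal. ring. }
  rewrite Hu.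
  assert (Hrl : Rpower (r / kap) l * Rpower r (- l) = / Rpower kap l).
  { unfold Rpower, Rdiv. rewrite ln_mult, ln_Rinv by (try apply Rinv_0_lt_compat; assumption).
    rewrite <- exp_plus, <- exp_Ropp. f_equal. ring. }
  assert (Hrn : r ^ (n - k) * r ^ k = r ^ (n - 1) * r).
  { rewrite <- pow_add. replace (n - k + k)%nat with (S (n - 1))%nat by lia. simpl. ring. }
  pose proof (Rpower_pos w1 q) as P1. pose proof (Rpower_pos kap l) as P2.
  pose proof (pow_lt w1 k Hw1) as P3. pose proof (pow_lt kap k Hkap) as P4.
  pose proof (pow_lt r (n - 1) Hr) as P5.
  set (W := Rpower (w kap (r / kap)) q).
  transitivity (c_nk n k * / r ^ (n - 1) * ((r ^ (n - k) * r ^ k) / r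
     * ((/ (kap * w1)) ^ k * (ys ^ k * xs) / kap ^ k) * (Rpower (r / kap) l * Rpower r (- l)) * (rho r / d * W))).
  - unfold Rdiv at 3. rewrite (Rpow_mult_distr r (/ kap)), (pow_inv kap). field. repeat split; lra.
  - rewrite Hrl, Hrn, pow_inv, Rpow_mult_distr. field. repeat split; lra.
Qed.

Lemma solution_is_solution : is_solution n k q rho (parameter kap) (solution kap).
Proof.
  pose proof w1_pos as Hw1.
  assert (Hu1 : solution kap 1 = 0).
  { unfold solution. replace (1 / kap) with (/ kap) by (field; lra). fold w1. field. lra. }
  split; [|split; [|split]].
  - split; [|split; [|split; [|split]]].
    + apply solution_C2. intros r [Hr _]. lra.
    + apply solution_C1. intros r [Hr _]. exact Hr.
    + intros i Hi r [Hr _]. now apply solution_monotone.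
    + apply is_derive_on_of_is_derive; [split; lra|].
      replace 0 with (du 0) at 2; [apply solution_derive|].
      unfold du, spd, speed. unfold Rdiv. rewrite !Rmult_0_l. ring.
    + exact Hu1.
  - intros r Hr. now apply solution_equation.
  - intros r Hr. unfold solution. fold w1.
    assert (Hlt : w1 < w kap (r / kap)).
    { apply w_decreasing; [lra|]. split; [apply rescaled_nonneg; lra|].
      replace (/ kap) with (1 / kap) by (field; lra). apply Rmult_lt_compat_r; [now apply Rinv_0_lt_compat|lra]. }
    assert (1 < w kap (r / kap) / w1); [|lra].
    apply Rmult_lt_reg_r with w1; [exact Hw1|]. unfold Rdiv. rewrite Rmult_assoc, Rinv_l; lra.
  - exact Hu1.
Qed.

End Scale.

(** The value at the origin is fixed by [w (/ kap)], which together with the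
    endpoint amplitude determines the scale. *)
Lemma solution_scale_injective (t1 t2 : R) :
  amplitude (exp t1) (- t1) = amplitude (exp t2) (- t2) ->
  solution (exp t1) 0 = solution (exp t2) 0 -> t1 = t2.
Proof.
  intros Ha Hs.
  assert (Hw : forall t, 0 < w (exp t) (/ exp t)).
  { intros t. apply w_pos; left; [|apply Rinv_0_lt_compat]; apply exp_pos. }
  assert (Hz : forall t, solution (exp t) 0 = 1 - / w (exp t) (/ exp t)).
  { intros t. unfold solution. unfold Rdiv at 1 2. rewrite Rmult_0_l, w_zero, Rmult_1_l. reflexivity. }
  rewrite !Hz in Hs.
  assert (Heq : w (exp t1) (/ exp t1) = w (exp t2) (/ exp t2)).
  { rewrite <- (Rinv_inv (w (exp t1) _)), <- (Rinv_inv (w (exp t2) _)). f_equal. lra. }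
  unfold amplitude in Ha. rewrite !exp_Ropp, Heq in Ha. nra.
Qed.

(** The endpoint amplitude oscillates around its limit as the scale tends to 0, and
    each of its values determines the parameter of a solution. *)
Lemma multiplicity :
  exists lamt : R,
    0 < lamt /\ Rbar_lt (Finite lamt) (lambda_star n k q rho) /\
    (forall N : nat, exists eps : R, 0 < eps /\
       forall lam : R, Rabs (lam - lamt) < eps ->
         at_least_solutions n k q rho lam N) /\
    infinitely_many_solutions n k q rho lamt.
Proof.
  set (Th := fun t => th (exp t)).
  assert (HTh : weight Th (fun t => dth (1 * exp t) * (1 * exp t))).
  { pose proof (Thk_weight 1 ltac:(lra)) as H.
    destruct H as [_ _ H3 H4].
    split; intros t.
    - apply th_range.
    - apply th_range.
    - specialize (H3 t). destruct (Rlt_dec 0 1) as [_|H01]; [|exfalso; lra].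
      apply (is_derive_ext (fun t => th (1 * exp t))); [|exact H3].
      intros x. unfold Th. rewrite Rmult_1_l. reflexivity.
    - specialize (H4 t). destruct (Rlt_dec 0 1) as [_|H01]; [exact H4|exfalso; lra]. }
  assert (HTh_lim : forall eps, 0 < eps -> exists T, forall t, t <= T -> 1 - Th t <= eps).
  { intros eps Heps.
    destruct (proj1 (filterlim_locally th (th 0)) (th_cont 0) (mkposreal eps Heps)) as [dl Hdl].
    exists (ln (dl / 2)). intros t Ht.
    assert (Hdp : 0 < dl) by apply cond_pos.
    assert (Het : exp t <= dl / 2) by (rewrite <- (exp_ln (dl / 2)) by lra; now apply exp_le_compat).
    pose proof (exp_pos t).
    specialize (Hdl (exp t)). unfold_ball_in Hdl.
    rewrite Ropp_0, Rplus_0_r, Rabs_pos_eq in Hdl by lra.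
    specialize (Hdl ltac:(lra)). rewrite th_zero in Hdl. apply Rabs_lt_between in Hdl. unfold Th. lra. }
  (* shifted by tau, all members of the family see the same weight, and the boundary
     point r = 1 is the time 0 *)
  set (A := fun tau t => amplitude (exp tau) (t - tau)). set (B := fun tau t => flux (exp tau) (t - tau)).
  assert (Hexp0 : forall tau, 0 <= exp tau) by (intros tau; left; apply exp_pos).
  assert (HThs : forall tau t, Th t = th (exp tau * exp (t - tau))).
  { intros tau t. unfold Th. rewrite <- exp_plus. do 2 f_equal. ring. }
  destruct (family_oscillates Th _ HTh HTh_lim A B (p / xs)) with (a := amplitude 0) (b := flux 0)
    as [al Hosc].
  { intros tau. apply (orbit_shift tau Th (fun t => th (exp tau * exp t))); [apply regular_orbit, Hexp0|apply HThs]. }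
  { intros tau. apply vanishing_shift, amplitude_vanishing, Hexp0. }
  { intros tau. apply vanishing_shift, flux_vanishing, Hexp0. }
  { intros tau t. rewrite (HThs tau t). apply regular_source_bound, Hexp0. }
  { intros t Ht. pose proof (regular_orbit 0 (Rle_refl 0) t I) as H. unfold Thk in H. cbv beta in H. rewrite Rmult_0_l, th_zero in H. exact H. }
  { apply amplitude_vanishing. lra. }
  { apply flux_vanishing. lra. }
  { intros t. pose proof (regular_source_bound 0 t (Rle_refl 0)) as H. unfold Thk in H. cbv beta in H. rewrite (Rmult_0_l (exp t)), th_zero, Rmult_1_l in H. exact H. }
  { intros s eps Heps. destruct (scale_limit s eps Heps) as [T HT]. exists T. intros tau Htau.
    unfold A, B. replace (s + tau - tau) with s by ring. now apply HT. }
  set (f := fun tau => amplitude (exp tau) (- tau)) in *.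
  assert (Hfosc : forall T, (exists t, t <= T /\ al < f t) /\ (exists t, t <= T /\ f t < al)).
  { intros T. destruct (Hosc T) as [[t1 [Ht1 H1]] [t2 [Ht2 H2]]].
    unfold A in H1, H2. rewrite Rminus_0_l in H1, H2.
    split; [exists t1|exists t2]; split; assumption. }
  pose proof INR_k_bounds as Hn2.
  set (cst := c_nk n k * (xs * ys ^ k / d)).
  assert (Hcst : 0 < cst).
  { unfold cst, c_nk. apply Rmult_lt_0_compat.
    - apply Rdiv_lt_0_compat; [apply C_pos; lia|lra].
    - apply Rdiv_lt_0_compat; [|exact Hd]. apply Rmult_lt_0_compat; [lra|now apply pow_lt]. }
  assert (Hpar : forall t, is_solution n k q rho (cst * exp ((q - K) * f t)) (solution (exp t))).
  { intros t. pose proof (solution_is_solution (exp t) (exp_pos t)) as H. unfold parameter in H. rewrite ln_exp in H. exact H. }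
  assert (Hdist : forall t1 t2, f t1 = f t2 -> t1 <> t2 -> distinct01 (solution (exp t1)) (solution (exp t2))).
  { intros t1 t2 Hf Hne. exists 0. split; [lra|]. intros Hu. apply Hne. now apply solution_scale_injective. }
  exists (cst * exp ((q - K) * al)).
  assert (HqK : 0 < q - K) by lra.
  split; [apply Rmult_lt_0_compat; [exact Hcst|apply exp_pos]|].
  split; [|split].
  - destruct (Hfosc 0) as [[t [_ Ht]] _].
    apply Rbar_lt_le_trans with (Finite (cst * exp ((q - K) * f t))).
    + simpl. apply Rmult_lt_compat_l; [exact Hcst|]. apply exp_increasing. now apply Rmult_lt_compat_l.
    + apply (proj1 (Lub_Rbar_correct _)). split; [apply Rmult_lt_0_compat; [exact Hcst|apply exp_pos]|].
      exists (solution (exp t)). split; [|apply Hpar].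
      apply solution_C2; [apply exp_pos|]. intros r [Hr _]. exact Hr.
  - intros N. destruct (many_preimages f al endpoint_continuous Hfosc N 0) as [dl [Hdl Hmany]].
    set (lam := fun x => cst * exp ((q - K) * x)).
    assert (Hinc : forall x y, x < y -> lam x < lam y).
    { intros x y Hxy. apply Rmult_lt_compat_l; [exact Hcst|]. apply exp_increasing. now apply Rmult_lt_compat_l. }
    exists (Rmin (lam (al + dl / 2) - lam al) (lam al - lam (al - dl / 2))).
    pose proof (Hinc (al - dl / 2) al ltac:(lra)). pose proof (Hinc al (al + dl / 2) ltac:(lra)).
    split; [apply Rmin_pos; lra|].
    intros mu Hmu. change (cst * exp ((q - K) * al)) with (lam al) in Hmu.
    apply Rabs_lt_between in Hmu.
    pose proof (Rmin_l (lam (al + dl / 2) - lam al) (lam al - lam (al - dl / 2))).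
    pose proof (Rmin_r (lam (al + dl / 2) - lam al) (lam al - lam (al - dl / 2))).
    assert (Hmu0 : 0 < mu).
    { assert (0 < lam (al - dl / 2)) by (apply Rmult_lt_0_compat; [exact Hcst|apply exp_pos]). lra. }
    set (v := ln (mu / cst) / (q - K)).
    assert (Hv : lam v = mu).
    { unfold lam, v. replace ((q - K) * (ln (mu / cst) / (q - K))) with (ln (mu / cst)) by (field; lra).
      rewrite exp_ln by (now apply Rdiv_lt_0_compat). field. lra. }
    assert (Hvd : Rabs (v - al) < dl).
    { apply Rabs_lt_between. split; apply Rnot_le_lt; intro Hout.
      - pose proof (Hinc v (al - dl / 2) ltac:(lra)). lra.
      - pose proof (Hinc (al + dl / 2) v ltac:(lra)). lra. }
    destruct (Hmany v Hvd) as [ts [Hts Hne]].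
    exists (fun i => solution (exp (ts i))). split.
    + intros i Hi. destruct (Hts i Hi) as [_ Hft]. rewrite <- Hv. unfold lam. rewrite <- Hft. apply Hpar.
    + intros i j Hi Hj Hij. apply Hdist; [|now apply Hne].
      destruct (Hts i Hi) as [_ ->]. destruct (Hts j Hj) as [_ ->]. reflexivity.
  - destruct (infinitely_many_preimages f al endpoint_continuous Hfosc) as [ts [Hts Hne]].
    exists (fun i => solution (exp (ts i))). split.
    + intros i. rewrite <- (Hts i). apply Hpar.
    + intros i j Hij. apply Hdist; [rewrite !Hts; reflexivity|now apply Hne].
Qed.

End Solutions.

End Regular.

End Plane.

Theorem theorem2p2 (k n : nat) (q : R) (rho : R -> R) (l0 : R)
  (hk : (0 < k)%nat) (hn : (2 * k < n)%nat) (hq : INR k < q)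
  (rho_C2 : C_on 2 (fun r => 0 < r) rho)
  (rho_C0 : C_on 0 (fun r => 0 <= r) rho)
  (rho_pos : forall r : R, 0 < r -> 0 < rho r)
  (ha_lim : filterlim (log_slope rho) (at_right 0) (locally l0))
  (ha : ((forall r : R, 0 < r -> log_slope rho r < l0) /\ q_star n k l0 <= q) \/
        ((forall r : R, 0 < r -> log_slope rho r <= l0) /\ q_star n k l0 < q))
  (hb : exists L : R, 0 < L /\
          forall r : R, 0 < r -> 0 < Rpower r (- l0) * rho r < L)
  (hc : polynomial_growth rho)
  (hq_star : q_star n k l0 < q)
  (hq_JL : Rbar_lt (Finite q) (q_JL n k l0)) :
  exists lamt : R,
    0 < lamt /\ Rbar_lt (Finite lamt) (lambda_star n k q rho) /\
    (forall N : nat, exists eps : R, 0 < eps /\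
       forall lam : R, Rabs (lam - lamt) < eps ->
         at_least_solutions n k q rho lam N) /\
    infinitely_many_solutions n k q rho lamt.
Proof.
  destruct hb as [L [_ HL]].
  assert (Hslope : forall r, 0 < r -> log_slope rho r <= l0).
  { intros r Hr. destruct ha as [[H _]|[H _]]; [left|]; now apply H. }
  pose proof (exponent_nonneg rho l0 L rho_C2 rho_C0 rho_pos Hslope HL) as Hl0.
  destruct (weight_normalisation rho l0 L rho_C2 rho_pos Hslope HL)
    as [d [th [dth [Hd [Hth [th_cont [th_range [th_zero [th_derive th_slope]]]]]]]]].
  set (K := INR k).
  assert (HK : 1 <= K) by (apply (le_INR 1 k); lia).
  assert (Hn2 : 2 * K < INR n).
  { pose proof (lt_INR _ _ hn) as H. rewrite mult_INR in H. exact H. }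
  set (ys := (2 * K + l0) / (q - K)).
  assert (Hys : 0 < ys) by (apply Rdiv_lt_0_compat; unfold K in *; lra).
  set (p := INR n + l0). assert (Hp : 0 < p) by (unfold p; lra).
  set (xs := p - q * ys).
  assert (Hxs : ys < xs).
  { apply (supercritical_gap K (INR n) q l0 ys); [lra|exact Hn2|exact Hl0|exact hq|exact hq_star|reflexivity]. }
  assert (Hspiral : (xs - ys) ^ 2 < 4 * xs * ys * (q - K) / K).
  { apply (spiral_condition K (INR n) q l0 ys); [lra|exact Hn2|exact Hl0|exact hq|reflexivity|exact Hxs|].
    unfold q_JL in hq_JL. fold K in hq_JL.
    destruct (Rlt_dec (2 * K + 8 + 4 * l0 / K) (INR n)) as [H|H].
    - right. split; [exact H|]. exact hq_JL.
    - left. apply Rnot_lt_le. exact H. }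
  set (e := l0 / K).
  assert (He : 0 <= e) by (apply Rmult_le_pos; [lra|left; apply Rinv_0_lt_compat; lra]).
  assert (Hel : K * e = l0) by (unfold e; field; lra).
  assert (Hscaling : (q - K) * ys = K * (2 + e)).
  { unfold ys, e. field. unfold K in *. lra. }
  apply (multiplicity K q xs ys HK hq Hys Hxs Hspiral p e Hp He Hscaling eq_refl th dth th_cont th_range th_zero
    th_derive th_slope k n l0 d rho hk hn eq_refl eq_refl Hel Hd Hth).
Qed.
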